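(* For integers $d,k$ let $G(d,k)\subset Sp_4(\mathbb{Z})$ be the subgroup generated by $$M_{d,k}=\begin{pmatrix}1&1&0&0\\0&1&0&0\\d&d&1&0\\0&-k&-1&1\end{pmatrix},\qquad N=\begin{pmatrix}1&0&0&0\\0&1&0&1\\0&0&1&0\\0&0&0&1\end{pmatrix}.$$ Then the indices $|Sp_4(\mathbb{Z}):G(d,k)|$ are as follows: $$|Sp_4(\mathbb{Z}):G(1,3)|=6,\qquad |Sp_4(\mathbb{Z}):G(1,2)|=10,\qquad |Sp_4(\mathbb{Z}):G(2,3)|=960,$$ $$|Sp_4(\mathbb{Z}):G(3,4)|=2^9\cdot 3^5\cdot 5^2,\qquad |Sp_4(\mathbb{Z}):G(4,4)|=2^{20}\cdot 3^2\cdot 5,$$ and for the two remaining pairs $$|Sp_4(\mathbb{Z}):G(6,5)|\ \ge\ 2^{10}\cdot 3^6\cdot 5^2,\qquad |Sp_4(\mathbb{Z}):G(9,6)|\ \ge\ 2^8\cdot 3^{13}\cdot 5^2.$$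
   Context: $Sp_4(\mathbb{Z})$ is the group of integral $4\times4$ matrices $X$ with $X^tSX=S$, where $$S=\begin{pmatrix}0&0&1&0\\0&0&0&1\\-1&0&0&0\\0&-1&0&0\end{pmatrix}.$$ The matrices $M_{d,k}$ and $N$ lie in $Sp_4(\mathbb{Z})$ for all integers $d,k$. For the pairs $(d,k)$ considered, $G(d,k)$ is the monodromy group (in a suitable basis) of a hypergeometric Calabi-Yau operator $\theta^4-Nz(\theta+\alpha_1)(\theta+\alpha_2)(\theta+1-\alpha_2)(\theta+1-\alpha_1)$, $M_{d,k}$ being the monodromy around $0$ and the matrix $N$ being the monodromy around the conifold point; this interpretation is not needed for the statement. *)

(* Defs.v *)
From HB Require Import structures.
From mathcomp Require Import all_boot all_order all_algebra ring.
Set Warnings "-notation-overridden,-ambiguous-paths,-notation-incompatible-prefix".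
From mathcomp Require Import boolp classical_sets functions cardinality.

Set Implicit Arguments.
Unset Strict Implicit.
Unset Printing Implicit Defensive.

Import GRing.Theory.
Local Open Scope ring_scope.
Local Open Scope classical_set_scope.
Local Open Scope card_scope.

Definition is_subgroup (G : groupType) (H : set G) : Prop :=
  [/\ H 1%g,
      forall x y, H x -> H y -> H (x * y)%g
    & forall x, H x -> H (x^-1)%g].

Definition gen_subgroup (G : groupType) (A : set G) : set G :=
  smallest (@is_subgroup G) A.

Lemma gen_subgroupP (G : groupType) (A : set G) : is_subgroup (gen_subgroup A).
Proof.
split=> [H [[]] //|x y Hx Hy H HA|x Hx H HA].
- by case: (HA) => -[_ HM _] _; apply: HM; [apply: Hx|apply: Hy].
- by case: (HA) => -[_ _ HV] _; apply: HV; apply: Hx.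
Qed.

Definition left_cosets (G : groupType) (H : set G) : set (set G) :=
  [set [set (x * h)%g | h in H] | x in [set: G]].

(** The index of [H] is the cardinality of its set of left cosets; it may be
    infinite, and then [index_ge H n] holds for every [n]. *)

Definition index_eq (G : groupType) (H : set G) (n : nat) : Prop :=
  left_cosets H #= `I_n.

Definition index_ge (G : groupType) (H : set G) (n : nat) : Prop :=
  `I_n #<= left_cosets H.

Definition mx4 (rows : seq (seq int)) : 'M[int]_4 :=
  \matrix_(i, j) nth 0 (nth [::] rows i) j.

Definition S4 : 'M[int]_4 :=
  mx4 [:: [::  0;  0; 1; 0];
          [::  0;  0; 0; 1];
          [:: -1;  0; 0; 0];
          [::  0; -1; 0; 0]].

Definition symplectic : pred 'M[int]_4 := fun X => X^T *m S4 *m X == S4.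

Record Sp4 := MkSp4 { Sp4_val :> 'M[int]_4; Sp4_valP : symplectic Sp4_val }.

HB.instance Definition _ := [isSub for Sp4_val].
HB.instance Definition _ := [Choice of Sp4 by <:].

Lemma S4_sqr : S4 *m S4 = - 1%:M.
Proof.
apply/matrixP => i j; rewrite !mxE !big_ord_recl big_ord0 !mxE.
by case: i => [[|[|[|[|//]]]] ?]; case: j => [[|[|[|[|//]]]] ?].
Qed.

Lemma symplectic1 : symplectic 1%:M.
Proof. by rewrite /symplectic trmx1 mul1mx mulmx1. Qed.

Lemma symplecticM X Y : symplectic X -> symplectic Y -> symplectic (X *m Y).
Proof.
move=> /eqP hX /eqP hY; apply/eqP.
by rewrite trmx_mul !mulmxA -(mulmxA Y^T) -(mulmxA Y^T) hX hY.
Qed.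

Definition symplectic_inv (X : 'M[int]_4) : 'M[int]_4 := - (S4 *m X^T *m S4).

Lemma symplectic_mulVmx X : symplectic X -> symplectic_inv X *m X = 1%:M.
Proof.
by move=> /eqP hX; rewrite mulNmx -!mulmxA (mulmxA X^T) hX S4_sqr opprK.
Qed.

Lemma symplecticV X : symplectic X -> symplectic (symplectic_inv X).
Proof.
move=> hX; have hV := symplectic_mulVmx hX; have hV' := mulmx1C hV.
move/eqP: hX => hX; apply/eqP; rewrite -[in LHS]hX.
by rewrite !mulmxA -trmx_mul hV' trmx1 mul1mx -mulmxA hV' mulmx1.
Qed.

Definition Sp4_one : Sp4 := MkSp4 symplectic1.
Definition Sp4_mul (X Y : Sp4) : Sp4 :=
  MkSp4 (symplecticM (Sp4_valP X) (Sp4_valP Y)).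
Definition Sp4_inv (X : Sp4) : Sp4 := MkSp4 (symplecticV (Sp4_valP X)).

Lemma Sp4_mulA : associative Sp4_mul.
Proof. by move=> X Y Z; apply: val_inj; rewrite /= mulmxA. Qed.

Lemma Sp4_mul1 : left_id Sp4_one Sp4_mul.
Proof. by move=> X; apply: val_inj; rewrite /= mul1mx. Qed.

Lemma Sp4_mul1r : right_id Sp4_one Sp4_mul.
Proof. by move=> X; apply: val_inj; rewrite /= mulmx1. Qed.

Lemma Sp4_mulV : left_inverse Sp4_one Sp4_inv Sp4_mul.
Proof.
by move=> X; apply: val_inj; rewrite /= symplectic_mulVmx //; exact: Sp4_valP.
Qed.

Lemma Sp4_mulVr : right_inverse Sp4_one Sp4_inv Sp4_mul.
Proof.
move=> X; apply: val_inj => /=; apply: mulmx1C.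
by rewrite symplectic_mulVmx //; exact: Sp4_valP.
Qed.

HB.instance Definition _ :=
  isGroup.Build Sp4 Sp4_mulA Sp4_mul1 Sp4_mul1r Sp4_mulV Sp4_mulVr.

Definition mxM (d k : int) : 'M[int]_4 :=
  mx4 [:: [:: 1;   1;  0; 0];
          [:: 0;   1;  0; 0];
          [:: d;   d;  1; 0];
          [:: 0; - k; -1; 1]].

Definition mxN : 'M[int]_4 :=
  mx4 [:: [:: 1; 0; 0; 0];
          [:: 0; 1; 0; 1];
          [:: 0; 0; 1; 0];
          [:: 0; 0; 0; 1]].

Lemma symplectic_mxM d k : symplectic (mxM d k).
Proof.
apply/eqP/matrixP => i j.
rewrite !mxE !big_ord_recl big_ord0 !mxE !big_ord_recl !big_ord0 !mxE.
by case: i => [[|[|[|[|//]]]] ?]; case: j => [[|[|[|[|//]]]] ?] /=; ring.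
Qed.

Lemma symplectic_mxN : symplectic mxN.
Proof.
apply/eqP/matrixP => i j.
rewrite !mxE !big_ord_recl big_ord0 !mxE !big_ord_recl !big_ord0 !mxE.
by case: i => [[|[|[|[|//]]]] ?]; case: j => [[|[|[|[|//]]]] ?].
Qed.

Definition M_ (d k : int) : Sp4 := MkSp4 (symplectic_mxM d k).
Definition N_ : Sp4 := MkSp4 symplectic_mxN.

Definition Gdk (d k : int) : set Sp4 := gen_subgroup [set M_ d k; N_].

(* Main.v *)
From Stdlib Require Import ZArith Lia MSetPositive.
From HB Require Import structures.
Require Import Defs.
From mathcomp Require Import all_boot all_order all_algebra ssrZ.
From mathcomp Require Import boolp classical_sets functions cardinality.

Set Implicit Arguments.
Unset Strict Implicit.
Unset Printing Implicit Defensive.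

(** Write G = G(d,k). Each index is pinned down by two finite computations, one
    for either inequality.

    For the upper bounds, let H be a group generated by s_1, ..., s_n, and K a
    subgroup. If 1 = r_1, ..., r_q are elements of H such that each s_i permutes
    the cosets r_j K, then the union of these cosets contains 1 and is stable
    under H, hence it is H and K has index at most q ([table_covered]). This is
    applied along a chain Sp_4(Z) = H_0 > H_1 > ... > H_t = G in which H_i is
    generated by M, N and a few explicit matrices ([chain_covered]). The data of
    a step are the representatives r_j and, for all i and j, an expression of
    the factor r_l^-1 s_i r_j as a word in the generators of H_(i+1). The chain
    starts from the fact that five transvections generate Sp_4(Z)
    ([full_of_transvections]): Euclid's algorithm moves the first column of a
    symplectic matrix to e_1, and then deals with the stabiliser of e_1. It is
    this half which shows that G has finite index, and what it needs is that
    many small elements of the H_i be expressed as words. Most of these words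
    come from transvections along the vectors in the G-orbit of e_2, whose
    conjugacy with N is easy to track.

    For the lower bounds, the index of G is at least the index of its image in
    Sp_4(Z/m), for m = 2, 2, 8, 36, 64, 72 and 162 respectively. The image is
    bounded from above: it is contained in the set of products of coset
    representatives modulo a prime p by normal forms g_1^e_1 ... g_r^e_r, 0 <=
    e_i < p, once this set is known to be stable under the generators
    ([modular_covered]). The order of Sp_4(Z/m) is bounded from below by
    exhibiting elements of Sp_4(Z) which differ modulo m ([packed_level],
    [packed_level2]): representatives modulo p, and between consecutive powers q
    and pq of p the p^10 products of powers, with exponents divisible by q, of
    the transvections along e_i and e_i + e_j. The pigeonhole principle
    [packed_div] turns both bounds into a lower bound for the index. Where the
    two inequalities are both available they agree. *)

(** * Counting cosets along a chain of subgroups *)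

Section Cosets.
Variable G : groupType.
Implicit Types (H K L : set G) (n m : nat).
Local Open Scope group_scope.
Local Open Scope classical_set_scope.

(** Bounds, from above and from below, for the index of [K] in [H]; unlike the
    index itself they make sense before this index is known to be finite. *)
Definition covered H K n :=
  exists2 R : seq G, (size R <= n)%N &
    forall x, H x -> exists2 r, r \in R & K (r^-1 * x).

Definition packed H K n :=
  exists2 f : 'I_n -> G, forall i, H (f i) &
    forall i j, K ((f i)^-1 * f j) -> i = j.

Lemma packed_fin H K (I : finType) (f : I -> G) :
  (forall i, H (f i)) -> (forall i j, K ((f i)^-1 * f j) -> i = j) ->
  packed H K #|I|.
Proof.
move=> Hf Kf; exists (f \o enum_val) => [i|i j]; first exact: Hf.
by move=> /Kf /enum_val_inj.
Qed.

Lemma covered_trans H K L n m :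
  covered H K n -> covered K L m -> covered H L (n * m).
Proof.
move=> [R Rn HR] [Q Qm KQ]; exists [seq r * q | r <- R, q <- Q].
  by rewrite size_allpairs leq_mul.
move=> x /HR[r rR /KQ[q qQ Lx]]; exists (r * q); first exact: allpairs_f.
by rewrite invgM -mulgA.
Qed.

Lemma packed_trans H K L n m : is_subgroup H -> is_subgroup K ->
  K `<=` H -> L `<=` K -> packed H K n -> packed K L m -> packed H L (n * m).
Proof.
move=> [_ HM _] [_ KM KV] KH LK [f Hf fK] [g Kg gL].
have := @packed_fin H L ('I_n * 'I_m)%type (fun p => f p.1 * g p.2).
rewrite card_prod !card_ord; apply=> [[i j]|[i j] [i' j']] /=.
  by apply: HM; [apply: Hf | apply/KH/Kg].
rewrite invgM mulgA -(mulgA (g j)^-1) => Lx.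
have ii' : i = i'.
  apply: fK; have := KM _ _ (KM _ _ (Kg j) (LK _ Lx)) (KV _ (Kg j')).
  by rewrite !mulgA mulgV mul1g -!mulgA mulgV mulg1.
by move: Lx; rewrite -ii' mulVg mulg1 => /gL ->.
Qed.

Lemma packed_sub H K L n : L `<=` K -> packed H K n -> packed H L n.
Proof. by move=> LK [f Hf fK]; exists f => // i j /LK /fK. Qed.

(** Pigeonhole: two of the [m] elements in the same coset [rL] would agree. *)
Lemma leq_packed_covered H L n m : is_subgroup L ->
  covered H L n -> packed H L m -> (m <= n)%N.
Proof.
move=> [_ LM LV] [R Rn HR] [f Hf fL].
have [g gP] : exists g : 'I_m -> G, forall i, g i \in R /\ L ((g i)^-1 * f i).
  have /choice[g gP] : forall i, exists r, r \in R /\ L (r^-1 * f i).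
    by move=> i; have [r rR Lr] := HR _ (Hf i); exists r.
  by exists g.
have g_inj : injective g.
  move=> i j gij; apply: fL.
  have := LM _ _ (LV _ (gP i).2) (gP j).2; rewrite gij invgM invgK mulgA.
  by rewrite -(mulgA _ (g j)) mulgV mulg1.
have : uniq (map g (enum 'I_m)) by rewrite map_inj_uniq ?enum_uniq.
move=> /uniq_leq_size -/(_ R) le.
have := leq_trans (le _) Rn; rewrite size_map size_enum_ord; apply.
by move=> _ /mapP[i _ ->]; apply: (gP i).1.
Qed.

(** If [L] has index at most [m] in [K] and [H] holds [n * m] cosets of [L],
    then [n] cosets of [K] can be picked one after the other: fewer of them
    would cover [H] by less than [n * m] cosets of [L]. *)
Lemma packed_div H K L n m : is_subgroup K -> is_subgroup L -> (0 < m)%N ->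
  covered K L m -> packed H L (n * m) -> packed H K n.
Proof.
move=> sK sL m_gt0 KL HL; have [_ KM KV] := sK.
suff: forall k, (k <= n)%N -> packed H K k by move=> /(_ n (leqnn n)).
elim=> [|k IHk] kn; first by exists (fun=> 1%g) => [[]|[]].
have [f Hf fK] := IHk (ltnW kn).
have [[x Hx xf]|noext] := pselect (exists2 x, H x & forall i, ~ K ((f i)^-1 * x)).
  pose g (i : 'I_k.+1) := if unlift ord_max i is Some j then f j else x.
  exists g => [i|i j]; first by rewrite /g; case: unlift.
  rewrite /g; case: unliftP => [i'|] ->; case: unliftP => [j'|] -> //.
  - by move=> /fK ->.
  - by move=> /xf.
  - by move=> /KV; rewrite invgM invgK => /xf.
have HK : covered H K k.
  exists (map f (enum 'I_k)) => [|x Hx]; first by rewrite size_map size_enum_ord.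
  apply: contrapT => nx; apply: noext; exists x => // i Ki; apply: nx.
  by exists (f i) => //; rewrite map_f ?mem_enum.
have := leq_packed_covered sL (covered_trans HK KL) HL.
by rewrite leq_pmul2r // leqNgt kn.
Qed.

Lemma coset_eq H x y : is_subgroup H -> H (x^-1 * y) ->
  [set x * h | h in H] = [set y * h | h in H].
Proof.
move=> [_ HM HV] Hxy; apply/seteqP; split=> _ [h Hh <-].
  exists (y^-1 * x * h); last by rewrite !mulgA mulgV mul1g.
  by apply: HM => //; have := HV _ Hxy; rewrite invgM invgK.
by exists (x^-1 * y * h); [apply: HM | rewrite !mulgA mulgV mul1g].
Qed.

Lemma packed_index_ge H n : is_subgroup H -> packed setT H n -> index_ge H n.
Proof.
move=> [H1 HM HV] [f _ fH].
pose c (i : nat) := if insub i is Some j then [set f j * h | h in H] else set0.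
have cE (i : 'I_n) : c i = [set f i * h | h in H] by rewrite /c valK.
have c_inj : {in `I_n &, injective c}.
  move=> i j; rewrite !inE => /= ni nj; rewrite (cE (Ordinal ni)) (cE (Ordinal nj)).
  move=> /seteqP[_ /(_ (f (Ordinal nj)))]; case.
    by exists 1 => //; rewrite mulg1.
  move=> h Hh fh; apply: (congr1 val (fH (Ordinal ni) (Ordinal nj) _)).
  by rewrite -fh mulgA mulVg mul1g.
rewrite /index_ge -(card_le_eql (inj_card_eq c_inj)).
apply: subset_card_le => _ [i /= ni <-].
by rewrite (cE (Ordinal ni)); exists (f (Ordinal ni)).
Qed.

Lemma covered_index_le H n : is_subgroup H -> covered setT H n ->
  (left_cosets H #<= `I_n)%card.
Proof.
move=> sH [R Rn HR].
pose c (i : nat) := [set nth 1 R i * h | h in H].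
apply: (@card_le_trans _ _ _ (c @` `I_n)); last exact: card_image_le.
apply: subset_card_le => _ [x _ <-]; have [//|r rR Hr] := HR x.
exists (index r R); first by rewrite /= (leq_trans _ Rn) ?index_mem.
by rewrite /c nth_index //; apply: coset_eq.
Qed.

Lemma covered_packed_index H n : is_subgroup H ->
  covered setT H n -> packed setT H n -> index_eq H n.
Proof.
move=> sH cH pH; apply/card_eqPle; split; first exact: covered_index_le.
exact: packed_index_ge.
Qed.
End Cosets.

(** * Integer matrices as tuples of binary integers *)

Import GRing.Theory.
Local Open Scope Z_scope.

(** Matrices over [int], whose entries are unary, are not suited to evaluation;
    the computations take place in this copy of the ring. *)
Inductive zmat := Zm of Z & Z & Z & Z & Z & Z & Z & Z & Z & Z & Z & Z & Z & Z & Z & Z.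

Definition zone := Zm 1 0 0 0  0 1 0 0  0 0 1 0  0 0 0 1.

Definition zmul A B :=
  let: Zm a0 a1 a2 a3 a4 a5 a6 a7 a8 a9 a10 a11 a12 a13 a14 a15 := A in
  let: Zm b0 b1 b2 b3 b4 b5 b6 b7 b8 b9 b10 b11 b12 b13 b14 b15 := B in
  Zm (a0*b0 + a1*b4 + a2*b8 + a3*b12) (a0*b1 + a1*b5 + a2*b9 + a3*b13)
     (a0*b2 + a1*b6 + a2*b10 + a3*b14) (a0*b3 + a1*b7 + a2*b11 + a3*b15)
     (a4*b0 + a5*b4 + a6*b8 + a7*b12) (a4*b1 + a5*b5 + a6*b9 + a7*b13)
     (a4*b2 + a5*b6 + a6*b10 + a7*b14) (a4*b3 + a5*b7 + a6*b11 + a7*b15)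
     (a8*b0 + a9*b4 + a10*b8 + a11*b12) (a8*b1 + a9*b5 + a10*b9 + a11*b13)
     (a8*b2 + a9*b6 + a10*b10 + a11*b14) (a8*b3 + a9*b7 + a10*b11 + a11*b15)
     (a12*b0 + a13*b4 + a14*b8 + a15*b12) (a12*b1 + a13*b5 + a14*b9 + a15*b13)
     (a12*b2 + a13*b6 + a14*b10 + a15*b14) (a12*b3 + a13*b7 + a14*b11 + a15*b15).

Definition ztr A :=
  let: Zm a0 a1 a2 a3 a4 a5 a6 a7 a8 a9 a10 a11 a12 a13 a14 a15 := A in
  Zm a0 a4 a8 a12 a1 a5 a9 a13 a2 a6 a10 a14 a3 a7 a11 a15.

(** The inverse [- S A^T S] of a symplectic matrix [A]. *)
Definition zinv A :=
  let: Zm a0 a1 a2 a3 a4 a5 a6 a7 a8 a9 a10 a11 a12 a13 a14 a15 := A in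
  Zm a10 a14 (- a2) (- a6)  a11 a15 (- a3) (- a7)
     (- a8) (- a12) a0 a4  (- a9) (- a13) a1 a5.

Definition zS := Zm 0 0 1 0  0 0 0 1  (-1) 0 0 0  0 (-1) 0 0.

Definition zeq A B :=
  let: Zm a0 a1 a2 a3 a4 a5 a6 a7 a8 a9 a10 a11 a12 a13 a14 a15 := A in
  let: Zm b0 b1 b2 b3 b4 b5 b6 b7 b8 b9 b10 b11 b12 b13 b14 b15 := B in
  [&& a0 =? b0, a1 =? b1, a2 =? b2, a3 =? b3, a4 =? b4, a5 =? b5, a6 =? b6,
      a7 =? b7, a8 =? b8, a9 =? b9, a10 =? b10, a11 =? b11, a12 =? b12,
      a13 =? b13, a14 =? b14 & a15 =? b15].

Lemma zeqP A B : reflect (A = B) (zeq A B).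
Proof.
apply: (iffP idP) => [|->]; last by case: B => *; rewrite /= !Z.eqb_refl.
case: A B => [? ? ? ? ? ? ? ? ? ? ? ? ? ? ? ?] [? ? ? ? ? ? ? ? ? ? ? ? ? ? ? ?] /=.
by do 15!case/andP=> /Z.eqb_eq ->; move/Z.eqb_eq ->.
Qed.

HB.instance Definition _ := hasDecEq.Build zmat zeqP.

Lemma zmulA A B C : zmul A (zmul B C) = zmul (zmul A B) C.
Proof. by rewrite /zmul; case: A; case: B; case: C => *; congr Zm; ring. Qed.

Lemma zmul1 A : zmul zone A = A.
Proof. by rewrite /zmul; case: A => *; congr Zm; ring. Qed.

Lemma zmulr1 A : zmul A zone = A.
Proof. by rewrite /zmul; case: A => *; congr Zm; ring. Qed.

Definition zsymp A := zeq (zmul (ztr A) (zmul zS A)) zS.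

(** ** The matrix of an element of the symplectic group *)

Definition o1 : 'I_4 := @Ordinal 4 1 isT.
Definition o2 : 'I_4 := @Ordinal 4 2 isT.
Definition o3 : 'I_4 := @Ordinal 4 3 isT.

Definition zmx (X : 'M[int]_4) : zmat :=
  let e i j := Z_of_int (X i j) in
  Zm (e ord0 ord0) (e ord0 o1) (e ord0 o2) (e ord0 o3)
     (e o1 ord0) (e o1 o1) (e o1 o2) (e o1 o3)
     (e o2 ord0) (e o2 o1) (e o2 o2) (e o2 o3)
     (e o3 ord0) (e o3 o1) (e o3 o2) (e o3 o3).

Definition mxz A : 'M[int]_4 :=
  let: Zm a0 a1 a2 a3 a4 a5 a6 a7 a8 a9 a10 a11 a12 a13 a14 a15 := A in
  mx4 (map (map int_of_Z) [:: [:: a0; a1; a2; a3]; [:: a4; a5; a6; a7];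
        [:: a8; a9; a10; a11]; [:: a12; a13; a14; a15]]).

Lemma ord4_ind (P : 'I_4 -> Prop) : P ord0 -> P o1 -> P o2 -> P o3 -> forall i, P i.
Proof.
move=> p0 p1 p2 p3 [[|[|[|[|//]]]] lti].
- by rewrite (_ : Ordinal _ = ord0) //; apply: val_inj.
- by rewrite (_ : Ordinal _ = o1) //; apply: val_inj.
- by rewrite (_ : Ordinal _ = o2) //; apply: val_inj.
- by rewrite (_ : Ordinal _ = o3) //; apply: val_inj.
Qed.

Lemma sum4 (R : nmodType) (F : 'I_4 -> R) :
  (\sum_i F i = F ord0 + (F o1 + (F o2 + F o3)))%R.
Proof.
rewrite !big_ord_recl big_ord0 GRing.addr0.
by do !congr (_ + _)%R; congr F; apply: val_inj.
Qed.

Lemma zmx_inj : injective zmx.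
Proof.
move=> X Y [] *; apply/matrixP; elim/ord4_ind; elim/ord4_ind;
  exact: (can_inj Z_of_intK).
Qed.

Lemma mxzK A : zmx (mxz A) = A.
Proof.
case: A => *; rewrite /zmx !mxE /=.
by rewrite !int_of_ZK.
Qed.

Lemma zmxM X Y : zmx (X *m Y) = zmul (zmx X) (zmx Y).
Proof.
rewrite /zmx !mxE !sum4 !rmorphD !rmorphM /= /zmul.
by congr Zm; rewrite -!Z.add_assoc.
Qed.

Lemma zmx_tr X : zmx X^T = ztr (zmx X).
Proof. by rewrite /zmx !mxE. Qed.

Lemma Z_of_intN x : Z_of_int (- x)%R = - Z_of_int x.
Proof. exact: (rmorphN Z_of_int). Qed.

Definition zopp A :=
  let: Zm a0 a1 a2 a3 a4 a5 a6 a7 a8 a9 a10 a11 a12 a13 a14 a15 := A in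
  Zm (- a0) (- a1) (- a2) (- a3) (- a4) (- a5) (- a6) (- a7)
     (- a8) (- a9) (- a10) (- a11) (- a12) (- a13) (- a14) (- a15).

Lemma zmxN X : zmx (- X)%R = zopp (zmx X).
Proof. by rewrite /zmx !mxE !Z_of_intN. Qed.

Lemma zmxS : zmx S4 = zS.
Proof. by rewrite /zmx !mxE. Qed.

Lemma zmx1 : zmx 1%:M = zone.
Proof. by rewrite /zmx !mxE. Qed.

Lemma symplecticE X : symplectic X = zsymp (zmx X).
Proof.
rewrite /symplectic /zsymp -mulmxA; apply/eqP/zeqP => [e|e].
  by rewrite -zmx_tr -zmxS -!zmxM e.
by apply: zmx_inj; rewrite !zmxM zmx_tr zmxS.
Qed.

(** For [A] not symplectic the value is the junk value [1]. *)
Definition sp (A : zmat) : Sp4 := insubd (1%g : Sp4) (mxz A).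

Definition zm (X : Sp4) : zmat := zmx X.

Lemma spK A : zsymp A -> zm (sp A) = A.
Proof. by move=> sA; rewrite /zm /sp val_insubd symplecticE mxzK sA mxzK. Qed.

Lemma zm_inj : injective zm.
Proof. by move=> X Y /zmx_inj/val_inj. Qed.

Lemma zmM X Y : zm (X * Y)%g = zmul (zm X) (zm Y).
Proof. exact: zmxM. Qed.

Lemma zm1 : zm 1%g = zone.
Proof. exact: zmx1. Qed.

Lemma zinvE A : zinv A = zopp (zmul (zmul zS (ztr A)) zS).
Proof.
by rewrite /zinv /zopp /zmul /ztr /zS; case: A => *; congr Zm; ring.
Qed.

Lemma zmV X : zm (X^-1)%g = zinv (zm X).
Proof. by rewrite zinvE /zm /= /symplectic_inv zmxN !zmxM zmx_tr zmxS. Qed.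

Lemma zmP X : zsymp (zm X).
Proof. by rewrite -symplecticE; apply: valP. Qed.

Definition inz (H : set Sp4) A := exists2 X, H X & zm X = A.

Lemma inzP (H : set Sp4) X : inz H (zm X) <-> H X.
Proof. by split=> [[Y HY /zm_inj <-]|HX] //; exists X. Qed.

Lemma zmulV A : zsymp A -> zmul A (zinv A) = zone.
Proof. by move=> /spK <-; rewrite -zmV -zmM mulgV zm1. Qed.

Lemma zmulVl A : zsymp A -> zmul (zinv A) A = zone.
Proof. by move=> /spK <-; rewrite -zmV -zmM mulVg zm1. Qed.

Section Inz.
Variable H : set Sp4.
Hypothesis sH : is_subgroup H.

Lemma inz1 : inz H zone.
Proof. by case: sH => H1 _ _; exists 1%g; rewrite ?zm1. Qed.

Lemma inzM A B : inz H A -> inz H B -> inz H (zmul A B).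
Proof.
case: sH => _ HM _ [X HX <-] [Y HY <-].
by exists (X * Y)%g; rewrite ?zmM //; apply: HM.
Qed.

Lemma inzV A : inz H A -> inz H (zinv A).
Proof.
by case: sH => _ _ HV [X HX <-]; exists (X^-1)%g; rewrite ?zmV //; apply: HV.
Qed.

Lemma inz_symp A : inz H A -> zsymp A.
Proof. by case=> X _ <-; apply: zmP. Qed.

Lemma inz_mulK A B : inz H A -> inz H (zmul A B) -> inz H B.
Proof.
move=> HA HAB; have := inzM (inzV HA) HAB.
by rewrite zmulA zmulVl ?zmul1 // inz_symp.
Qed.
End Inz.

Lemma zm_M d k : zm (M_ d k) = let d := Z_of_int d in let k := Z_of_int k in
  Zm 1 1 0 0  0 1 0 0  d d 1 0  0 (- k) (-1) 1.
Proof. by rewrite /zm /zmx !mxE /= Z_of_intN. Qed.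

Lemma zm_N : zm N_ = Zm 1 0 0 0  0 1 0 1  0 0 1 0  0 0 0 1.
Proof. by rewrite /zm /zmx !mxE. Qed.

#[local] Arguments Z.add : simpl never.
#[local] Arguments Z.mul : simpl never.
#[local] Arguments Z.sub : simpl never.
#[local] Arguments Z.opp : simpl never.

(** * Transvections generate the symplectic group *)

(** The [n]-th power of the transvection [x |-> x + <v,x> v], [v = (a,b,c,d)].
    *)
Definition tv n (v : Z * Z * Z * Z) :=
  let: (a, b, c, d) := v in
  Zm (1 - n*a*c) (- n*a*d) (n*a*a) (n*a*b)
     (- n*b*c) (1 - n*b*d) (n*b*a) (n*b*b)
     (- n*c*c) (- n*c*d) (1 + n*c*a) (n*c*b)
     (- n*d*c) (- n*d*d) (n*d*a) (1 + n*d*b).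

Lemma tvD n m v : zmul (tv n v) (tv m v) = tv (n + m) v.
Proof. by case: v => [[[a b] c] d]; rewrite /zmul /tv; congr Zm; ring. Qed.

Lemma tv_inv n v : zinv (tv n v) = tv (- n) v.
Proof. by case: v => [[[a b] c] d]; rewrite /zinv /tv; congr Zm; ring. Qed.

Lemma tv_symp n v : zsymp (tv n v).
Proof.
by case: v => [[[a b] c] d]; apply/zeqP; rewrite /zmul /ztr /zS /tv; congr Zm; ring.
Qed.

(** These relations are the values of the symplectic form on pairs of columns.
    *)
Lemma zsymp_cols a0 a1 a2 a3 a4 a5 a6 a7 a8 a9 a10 a11 a12 a13 a14 a15 :
  zsymp (Zm a0 a1 a2 a3 a4 a5 a6 a7 a8 a9 a10 a11 a12 a13 a14 a15) ->
  (a0*a9 + a4*a13 - a8*a1 - a12*a5 = 0 /\ a0*a10 + a4*a14 - a8*a2 - a12*a6 = 1 /\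
   a0*a11 + a4*a15 - a8*a3 - a12*a7 = 0 /\ a1*a10 + a5*a14 - a9*a2 - a13*a6 = 0 /\
   a1*a11 + a5*a15 - a9*a3 - a13*a7 = 1 /\ a2*a11 + a6*a15 - a10*a3 - a14*a7 = 0).
Proof.
move=> /zeqP; rewrite /zmul /ztr /zS => E.
have pick (f : zmat -> Z) := congr1 f E.
do !split.
- have := pick (fun A => let: Zm _ x _ _ _ _ _ _ _ _ _ _ _ _ _ _ := A in x); lia.
- have := pick (fun A => let: Zm _ _ x _ _ _ _ _ _ _ _ _ _ _ _ _ := A in x); lia.
- have := pick (fun A => let: Zm _ _ _ x _ _ _ _ _ _ _ _ _ _ _ _ := A in x); lia.
- have := pick (fun A => let: Zm _ _ _ _ _ _ x _ _ _ _ _ _ _ _ _ := A in x); lia.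
- have := pick (fun A => let: Zm _ _ _ _ _ _ _ x _ _ _ _ _ _ _ _ := A in x); lia.
- have := pick (fun A => let: Zm _ _ _ _ _ _ _ _ _ _ _ x _ _ _ _ := A in x); lia.
Qed.

Section Generation.
Variable H : set Sp4.
Hypothesis sH : is_subgroup H.

Lemma inz_tv n v : inz H (tv 1 v) -> inz H (tv n v).
Proof.
move=> Hv; have pos m : 0 <= m -> inz H (tv m v).
  move: m; apply: natlike_ind => [|m _ IH]; last by rewrite -tvD; apply: inzM.
  have <- : zone = tv 0 v by case: v {Hv} => [[[a b] c] d] /=; congr Zm; ring.
  exact: inz1.
have [|/Z.opp_nonneg_nonpos n0] := Z.le_ge_cases 0 n; first exact: pos.
have := inzV sH (pos (- n) _); rewrite tv_inv Z.opp_involutive; apply; lia.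
Qed.

Definition row_step A B := exists2 K, inz H K & zmul K A = B.

Lemma row_step_trans A B C : row_step A B -> row_step B C -> row_step A C.
Proof.
by move=> [K HK <-] [L HL <-]; exists (zmul L K); rewrite ?zmulA //; apply: inzM.
Qed.

Lemma row_step_inz A B : row_step A B -> inz H B -> inz H A.
Proof. by move=> [K HK <-] /(inz_mulK sH HK). Qed.

Lemma row_step_symp A B : row_step A B -> zsymp A -> zsymp B.
Proof.
by move=> [K [k _ <-] <-] /spK <-; rewrite -zmM; apply: zmP.
Qed.

(** The moves generate a rotation [(x, y) -> (y, - x)], which is what allows
    signs to change and the coordinates to be exchanged; each division step
    then decreases the first coordinate. *)
Lemma euclid (E : Z * Z -> Z * Z -> Prop) :
  (forall x y z, E x y -> E y z -> E x z) ->
  (forall n a c, E (a, c) (a + n * c, c)) ->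
  (forall n a c, E (a, c) (a, c - n * a)) ->
  forall a c, E (a, c) (0, Z.gcd a c).
Proof.
move=> Et Ea Ec a c.
have rot x y : E (x, y) (y, - x).
  have := Et _ _ _ (Ea 1 x y) (Et _ _ _ (Ec 1 _ _) (Ea 1 _ _)).
  by congr (E _ (_, _)); ring.
have [n lt_n] : exists n : nat, Z.abs a < Z.of_nat n.
  by exists (Z.to_nat (Z.abs a + 1)); lia.
elim: n a c lt_n => [|n IHn] a c lt_n; first lia.
have [->|a0] := Z.eq_dec a 0.
  have [c0|c0] := Z.le_gt_cases 0 c.
    by have := Ea 0 0 c; rewrite Z.gcd_0_l Z.abs_eq.
  have := Et _ _ _ (rot 0 c) (rot _ _).
  by rewrite Z.gcd_0_l Z.abs_neq //; lia.
apply: (Et _ _ _ (Ec (c / a) _ _)); apply: (Et _ _ _ (rot _ _)).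
have -> : c - c / a * a = c mod a by rewrite Z.mod_eq //; ring.
have := IHn (c mod a) (- a) _; rewrite Z.gcd_opp_r Z.gcd_mod //; apply.
by have := Z.mod_bound_or c a a0; lia.
Qed.

Hypothesis H1 : inz H (tv 1 (1, 0, 0, 0)).
Hypothesis H2 : inz H (tv 1 (0, 1, 0, 0)).
Hypothesis H3 : inz H (tv 1 (0, 0, 1, 0)).
Hypothesis H4 : inz H (tv 1 (0, 0, 0, 1)).
Hypothesis H12 : inz H (tv 1 (1, -1, 0, 0)).

Lemma row_step_tv n v A B : inz H (tv 1 v) -> zmul (tv n v) A = B -> row_step A B.
Proof. by move=> Hv <-; exists (tv n v) => //; apply: inz_tv. Qed.

Definition col1 A v :=
  let: Zm a _ _ _ b _ _ _ c _ _ _ d _ _ _ := A in v = (a, b, c, d).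

(** Row operations act on the columns separately, so that the reduction of the
    first column may forget the others. *)
Definition reach v w := forall A, col1 A v -> exists2 B, row_step A B & col1 B w.

Lemma reach_trans u v w : reach u v -> reach v w -> reach u w.
Proof.
move=> uv vw A /uv[B AB /vw[C BC Cw]]; exists C => //.
exact: row_step_trans AB BC.
Qed.

Lemma reach_tv n v a b c d : inz H (tv 1 v) ->
  reach (a, b, c, d)
    (let: (p, q, r, s) := v in let e := n * (p * c + q * d - r * a - s * b) in
     (a + e * p, b + e * q, c + e * r, d + e * s)).
Proof.
move=> Hv A Aa; exists (zmul (tv n v) A); first exact: row_step_tv Hv _.
case: A Aa => a0 a1 a2 a3 a4 a5 a6 a7 a8 a9 a10 a11 a12 a13 a14 a15 /= [-> -> -> ->].
by case: v Hv => [[[p q] r] s] _ /=; congr (_, _, _, _); ring.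
Qed.

Lemma reach_plane13 a b c d : reach (a, b, c, d) (0, b, Z.gcd a c, d).
Proof.
apply: (@euclid (fun x y => reach (x.1, b, x.2, d) (y.1, b, y.2, d))) => /=.
- by move=> x y z; apply: reach_trans.
- move=> n x y; have /= := @reach_tv n _ x b y d H1.
  by congr (reach _ (_, _, _, _)); ring.
- move=> n x y; have /= := @reach_tv n _ x b y d H3.
  by congr (reach _ (_, _, _, _)); ring.
Qed.

Lemma reach_plane24 a b c d : reach (a, b, c, d) (a, 0, c, Z.gcd b d).
Proof.
apply: (@euclid (fun x y => reach (a, x.1, c, x.2) (a, y.1, c, y.2))) => /=.
- by move=> x y z; apply: reach_trans.
- move=> n x y; have /= := @reach_tv n _ a x c y H2.
  by congr (reach _ (_, _, _, _)); ring.
- move=> n x y; have /= := @reach_tv n _ a x c y H4.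
  by congr (reach _ (_, _, _, _)); ring.
Qed.

(** Euclid's algorithm in the planes [<e_1, e_3>] and [<e_2, e_4>] leads to
    [(0, 0, g, h)] with [g] and [h] coprime. The transvection along [e_1 - e_2]
    is the only one of the five to mix the two planes; after it, the components
    in both planes are primitive. *)
Lemma reach_primitive a b c d : Z.gcd (Z.gcd a c) (Z.gcd b d) = 1 ->
  reach (a, b, c, d) (1, 0, 0, 0).
Proof.
set g := Z.gcd a c; set h := Z.gcd b d => gh.
apply: (reach_trans (@reach_plane13 a b c d)).
apply: (reach_trans (@reach_plane24 _ b _ d)); rewrite -/g -/h.
apply: (reach_trans (@reach_tv 1 _ 0 0 g h H12)) => /=.
apply: (reach_trans (@reach_plane13 _ _ _ _)).
apply: (reach_trans (@reach_plane24 _ _ _ _)).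
have gcd_diff x y : Z.gcd (0 + 1 * (1 * x - 1 * y) * 1) x = Z.gcd x y.
  rewrite -[RHS]Z.gcd_sub_diag_r -[RHS]Z.gcd_opp_r [LHS]Z.gcd_comm.
  by congr (Z.gcd _ _); ring.
have -> : Z.gcd (0 + 1 * (1 * g + -1 * h - 0 * 0 - 0 * 0) * 1)
    (g + 1 * (1 * g + -1 * h - 0 * 0 - 0 * 0) * 0) = 1.
  by rewrite -[RHS]gh -[RHS]gcd_diff; congr (Z.gcd _ _); ring.
have -> : Z.gcd (0 + 1 * (1 * g + -1 * h - 0 * 0 - 0 * 0) * -1)
    (h + 1 * (1 * g + -1 * h - 0 * 0 - 0 * 0) * 0) = 1.
  by rewrite -[RHS]gh [RHS]Z.gcd_comm -[RHS]gcd_diff; congr (Z.gcd _ _); ring.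
apply: (reach_trans (@reach_tv 1 _ _ _ _ _ H2)) => /=.
apply: (reach_trans (@reach_tv 1 _ _ _ _ _ H4)) => /=.
apply: (reach_trans (@reach_tv 1 _ _ _ _ _ H12)) => /=.
exact: (@reach_tv 1 _ _ _ _ _ H3).
Qed.

Lemma shear_inz r : inz H (Zm 1 0 0 r  0 1 r 0  0 0 1 0  0 0 0 1).
Proof.
have -> : Zm 1 0 0 r 0 1 r 0 0 0 1 0 0 0 0 1 =
    zmul (tv (- r) (1, -1, 0, 0)) (zmul (tv r (1, 0, 0, 0)) (tv r (0, 1, 0, 0))).
  by rewrite /zmul /tv; congr Zm; ring.
by do ?[apply: inzM => //]; apply: inz_tv.
Qed.

(** The previous shear, conjugated by the rotation [e_2 -> - e_4 -> - e_2]. *)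
Lemma shear'_inz p : inz H (Zm 1 p 0 0  0 1 0 0  0 0 1 0  0 0 (- p) 1).
Proof.
pose J := zmul (tv 1 (0, 1, 0, 0)) (zmul (tv 1 (0, 0, 0, 1)) (tv 1 (0, 1, 0, 0))).
have HJ : inz H J by do ?[apply: inzM => //].
have -> : Zm 1 p 0 0 0 1 0 0 0 0 1 0 0 0 (- p) 1 =
    zmul (zmul J (Zm 1 0 0 p 0 1 p 0 0 0 1 0 0 0 0 1)) (zinv J).
  by rewrite /J /zinv /zmul /tv; congr Zm; ring.
by apply: inzM (inzV _ _) => //; apply: inzM (shear_inz _).
Qed.

(** Once the first column is [e_1], the third row is [(0, 0, 1, 0)], and the
    submatrix on [e_2], [e_4] has determinant 1: Euclid's algorithm in that
    plane makes it trivial. What remains is in the Heisenberg group fixing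
    [e_1], a product of a transvection and two shears. *)
Lemma full_of_transvections X : H X.
Proof.
rewrite -inzP; move: (zm X) (zmP X) => A sA.
have [B AB B1] : exists2 B, row_step A B & col1 B (1, 0, 0, 0).
  move: sA; case: A => a0 a1 a2 a3 a4 a5 a6 a7 a8 a9 a10 a11 a12 a13 a14 a15.
  move=> /zsymp_cols[_ [e _]].
  apply: (@reach_primitive a0 a4 a8 a12) => //.
  apply: Z.divide_1_r_nonneg; first exact: Z.gcd_nonneg.
  have [dl dr] := (Z.gcd_divide_l (Z.gcd a0 a8) (Z.gcd a4 a12),
                   Z.gcd_divide_r (Z.gcd a0 a8) (Z.gcd a4 a12)).
  have [d0 d8] := (Z.divide_trans _ _ _ dl (Z.gcd_divide_l _ _),
                   Z.divide_trans _ _ _ dl (Z.gcd_divide_r _ _)).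
  have [d4 d12] := (Z.divide_trans _ _ _ dr (Z.gcd_divide_l _ _),
                    Z.divide_trans _ _ _ dr (Z.gcd_divide_r _ _)).
  by rewrite -e; do ?[apply: Z.divide_sub_r | apply: Z.divide_add_r];
    apply: Z.divide_mul_l.
apply: (row_step_inz AB); have sB := row_step_symp AB sA.
case: B B1 sB {AB} => b0 p q r b4 a s b b8 e u f b12 c t d [<- <- <- <-] sB.
have [e0 [u1 [f0 [tp [ad st]]]]] := zsymp_cols sB.
have {}e0 : e = 0 by lia. have {}u1 : u = 1 by lia. have {}f0 : f = 0 by lia.
subst e u f.
pose Y x y z w v v' := Zm 1 p q r 0 x v y 0 0 1 0 0 z v' w.
have [y [w [v [v' s1]]]] : exists y w v v',
    row_step (Y a b c d s t) (Y 0 y (Z.gcd a c) w v v').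
  apply: (@euclid (fun x x' => forall y w v v', exists y' w' z z', row_step
    (Y x.1 y x.2 w v v') (Y x'.1 y' x'.2 w' z z'))) => /=.
  - move=> x x' x'' xx' xx'' y w v v'.
    have [y' [w' [z [z' s1]]]] := xx' y w v v'.
    have [y'' [w'' [u [u' s2]]]] := xx'' y' w' z z'.
    by exists y'', w'', u, u'; apply: row_step_trans s1 s2.
  - move=> n x z y w v v'; exists (y + n * w), w, (v + n * v'), v'.
    by apply: (row_step_tv (n := n) H2); rewrite /zmul /tv /Y; congr Zm; ring.
  - move=> n x z y w v v'; exists y, (w - n * y), v, (v' - n * v).
    by apply: (row_step_tv (n := n) H4); rewrite /zmul /tv /Y; congr Zm; ring.
have ac1 : Z.gcd a c = 1.
  apply: Z.divide_1_r_nonneg; first exact: Z.gcd_nonneg.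
  rewrite (_ : 1 = a * d - c * b); last by lia.
  by apply: Z.divide_sub_r; apply: Z.divide_mul_l;
    [apply: Z.gcd_divide_l | apply: Z.gcd_divide_r].
rewrite {}ac1 in s1; apply: (row_step_inz s1).
have {sB}sY := row_step_symp s1 sB.
have [_ [_ [_ [c23 [c24 c34]]]]] := zsymp_cols sY.
pose Z := Zm 1 p q r 0 1 r 0 0 0 1 0 0 0 (- p) 1.
have s2 : row_step (Y 0 y 1 w v v') (Y 1 (y + w) 1 w (v + v') v').
  by apply: (row_step_tv (n := 1) H2); rewrite /zmul /tv /Y; congr Zm; ring.
have s3 : row_step (Y 1 (y + w) 1 w (v + v') v') (Y 1 (y + w) 0 (- y) (v + v') (- v)).
  by apply: (row_step_tv (n := 1) H4); rewrite /zmul /tv /Y; congr Zm; ring.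
have s4 : row_step (Y 1 (y + w) 0 (- y) (v + v') (- v)) Z.
  have [-> ->] : y = - 1 /\ v = p by lia.
  apply: (row_step_tv (n := - (-1 + w)) H2).
  by rewrite /zmul /tv /Y /Z; congr Zm; try ring; nia.
apply: (row_step_inz s2); apply: (row_step_inz s3); apply: (row_step_inz s4).
have -> : Z = zmul (Zm 1 p 0 0 0 1 0 0 0 0 1 0 0 0 (- p) 1)
    (zmul (Zm 1 0 0 r 0 1 r 0 0 0 1 0 0 0 0 1) (tv (q - p * r) (1, 0, 0, 0))).
  by rewrite /Z /zmul /tv; congr Zm; ring.
apply: inzM (shear'_inz _) _ => //; apply: inzM (shear_inz _) _ => //.
exact: inz_tv.
Qed.
End Generation.

Local Open Scope classical_set_scope.

(** * Coset tables *)

(** The letters of a word are the positions, counted from 1, of matrices in an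
    environment; a negative letter stands for the inverse matrix. Letters denote
    arbitrary previous results, as in a straight-line program, so that a short
    list of words reaches elements whose expanded words are very long. *)
Definition letter (env : seq zmat) l :=
  if l <? 0 then zinv (nth zone env (Z.to_nat (- l)).-1)
  else nth zone env (Z.to_nat l).-1.

Definition word (env : seq zmat) (w : seq Z) :=
  foldr (fun l A => zmul (letter env l) A) zone w.

Definition extend (env : seq zmat) (ws : seq (seq Z)) :=
  foldl (fun env w => rcons env (word env w)) env ws.

(** [table] has a row for each generator [s], which lists for each
    representative [r] the position of the representative [r'] of the coset
    of [s r], and the letter for [r'^-1 s r], 0 standing for the identity. *)
Definition entry_ok env reps s (re : zmat * (nat * Z)) :=
  let: (r, (i, l)) := re in
  zeq (zmul s r) (zmul (nth zone reps i) (word env (if l =? 0 then [::] else [:: l]))).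

(** All positions must occur in a row: this makes [s] permute the cosets, so
    that [s^-1] does too. *)
Definition row_ok env reps (sr : zmat * seq (nat * Z)) :=
  let: (s, row) := sr in
  [&& size row == size reps, all (fun i => i \in map fst row) (iota 0 (size reps))
    & all (entry_ok env reps s) (zip reps row)].

Definition table_ok env gens reps table :=
  [&& zeq (head zone reps) zone, (0 < size reps)%N, size table == size gens,
      all zsymp reps & all (row_ok env reps) (zip gens table)].

Definition gen_by (gens : seq zmat) : set Sp4 :=
  gen_subgroup [set X | exists2 A, List.In A gens & zm X = A]%classic.

Lemma gen_by_subgroup gens : is_subgroup (gen_by gens).
Proof. exact: gen_subgroupP. Qed.

Lemma gen_subgroup_min (A H : set Sp4) : is_subgroup H -> A `<=` H ->
  gen_subgroup A `<=` H.
Proof. by move=> sH AH X; apply. Qed.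

Lemma sub_gen_subgroup (A : set Sp4) : A `<=` gen_subgroup A.
Proof. by move=> X AX B [_]; apply. Qed.

Lemma gen_by_inz gens A : List.In A gens -> zsymp A -> inz (gen_by gens) A.
Proof.
move=> Ag sA; exists (sp A); last exact: spK.
by apply: sub_gen_subgroup; exists A => //; apply: spK.
Qed.

Definition allz (H : set Sp4) (env : seq zmat) := forall A, List.In A env -> inz H A.

Section Words.
Variables (H : set Sp4) (sH : is_subgroup H).

Lemma inz_letter env l : allz H env -> inz H (letter env l).
Proof.
move=> He; have in_nth i : inz H (nth zone env i).
  elim: env i He => [|A env IH] [|i] He; try exact: inz1.
    by apply: He; left.
  by apply: IH => B Be; apply: He; right.
by rewrite /letter; case: ifP => _; [apply: inzV|].
Qed.

Lemma inz_word env w : allz H env -> inz H (word env w).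
Proof.
move=> He; elim: w => [|l w IH] /=; first exact: inz1.
by apply: inzM => //; apply: inz_letter.
Qed.

Lemma allz_extend env ws : allz H env -> allz H (extend env ws).
Proof.
elim: ws env => [//|w ws IH] env He; apply: IH => A.
have: inz H (word env w) by apply: inz_word.
move: (word env w) => B HB; elim: env He => [|C env IHe] He /=; first by case=> // <-.
case=> [<-|]; first by apply: He; left.
by apply: IHe => D De; apply: He; right.
Qed.
End Words.

(** Each generator permutes the cosets [rH] of the table, so that their union,
    which contains [1], is stable under the group that is generated. *)
Lemma table_covered env gens reps table (H : set Sp4) :
  is_subgroup H -> allz H env -> table_ok env gens reps table ->
  covered (gen_by gens) H (size reps).
Proof.
move=> sH He; rewrite /table_ok => /and5P[/zeqP hd sz0 /eqP szt symp_reps rows].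
pose U A := exists2 i, (i < size reps)%N &
  exists2 B, inz H B & A = zmul (nth zone reps i) B.
have symp_nth i : zsymp (nth zone reps i).
  have [ltir|leri] := ltnP i (size reps); first exact: (all_nthP zone symp_reps).
  by rewrite nth_default //; apply/zeqP.
have U_gen s : List.In s gens -> forall i, (i < size reps)%N ->
    exists row, [/\ size row = size reps, i \in map fst row &
      forall j, (j < size reps)%N -> exists2 B, inz H B &
        zmul s (nth zone reps j) =
        zmul (nth zone reps (nth (0%N, 0) row j).1) B].
  move=> gs i lti.
  have [row [/eqP szr /allP it /(all_nthP (zone, (0%N, 0))) ent]] :
      exists row, [/\ size row == size reps,
        all (fun i => i \in map fst row) (iota 0 (size reps))
        & all (entry_ok env reps s) (zip reps row)].
    elim: gens table szt rows gs {hd} => [//|s' g IH] [//|row t] /= [szt].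
    by case/andP=> /and3P[? ? ?] rs [<-|/(IH t szt rs)] //; exists row.
  exists row; split=> // [|j ltj]; first by apply: it; rewrite mem_iota.
  have := ent j; rewrite size_zip szr minnn nth_zip // /entry_ok => /(_ ltj).
  case: (nth _ row j) => k l /zeqP ->; eexists; last reflexivity.
  exact: inz_word.
pose P : set Sp4 := fun g => forall A, U A -> U (zmul (zm g) A) /\ U (zmul (zinv (zm g)) A).
have sP : is_subgroup P.
  split=> [A UA|g h Pg Ph A UA|g Pg A UA].
  - by rewrite zm1 !zmul1; split.
  - have [Ug _] := Pg _ (Ph A UA).1; have [_ Uh] := Ph _ (Pg A UA).2.
    split; first by rewrite zmM -zmulA.
    by rewrite -zmV invgM zmM !zmV -zmulA.
  - have [Ug Uh] := Pg A UA; split; first by rewrite zmV.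
    by rewrite -zmV invgK.
have gP : gen_by gens `<=` P.
  apply: gen_subgroup_min => // X [s gs Xs] A [i lti [B HB ->]]; rewrite Xs.
  have ss : zsymp s by rewrite -Xs; apply: zmP.
  have [row [szr ir Hrow]] := U_gen s gs i lti.
  split.
  - have [C HC e] := Hrow i lti; rewrite zmulA e -zmulA.
    have HCB : inz H (zmul C B) by apply: inzM.
    have [lt_k|le_k] := ltnP (nth (0%N, 0) row i).1 (size reps).
      by exists (nth (0%N, 0) row i).1 => //; exists (zmul C B).
    exists 0%N => //; exists (zmul C B) => //.
    by rewrite (nth_default _ le_k) nth0 hd.
  - have /(nthP 0%N)[j ltj ej] := ir; rewrite size_map szr in ltj.
    rewrite (nth_map (0%N, 0)) ?szr // in ej.
    have [C HC e] := Hrow j ltj; exists j => //; rewrite ej in e.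
    exists (zmul (zinv C) B); first by apply: inzM => //; apply: inzV.
    have -> : nth zone reps i = zmul (zmul s (nth zone reps j)) (zinv C).
      by rewrite e -zmulA zmulV ?zmulr1 // (inz_symp HC).
    by rewrite !zmulA zmulVl ?zmul1.
exists (map sp reps); first by rewrite size_map.
move=> X /gP /(_ zone); case.
  by exists 0%N => //; exists zone; [apply: inz1 | rewrite nth0 hd zmul1].
rewrite zmulr1 => -[i lti [B HB e]] _.
exists (sp (nth zone reps i)); first by rewrite -(nth_map _ (1%g : Sp4)) // mem_nth ?size_map.
rewrite -inzP zmM zmV spK // e zmulA zmulVl ?zmul1 //.
Qed.

(** * Chains of subgroups *)

(** One step of the chain: the generators that join [M] and [N] in the next
    subgroup, words in them and in the elements of [G] already obtained, and a
    table for the index of the next subgroup. *)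
Record step := Step {
  step_gens : seq zmat;
  step_words : seq (seq Z);
  step_reps : seq zmat;
  step_table : seq (seq nat * seq Z) }.

Section Chain.
Variables (MN : seq zmat) (base : seq zmat).

Fixpoint chain_ok gens (steps : seq step) :=
  if steps is st :: steps' then
    all zsymp (step_gens st) &&
    table_ok (extend (base ++ step_gens st) (step_words st)) gens (step_reps st)
      [seq zip row.1 row.2 | row <- step_table st]
    && chain_ok (MN ++ step_gens st) steps'
  else gens == MN.

Definition chain_index (steps : seq step) : Z :=
  foldr (fun st z => Z.of_nat (size (step_reps st)) * z) 1 steps.

Lemma gen_by_catl s t : gen_by s `<=` gen_by (s ++ t).
Proof.
apply: gen_subgroup_min; first exact: gen_by_subgroup.
move=> X [A As XA]; apply: sub_gen_subgroup; exists A => //.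
by apply/List.in_or_app; left.
Qed.

Hypothesis baseP : allz (gen_by MN) base.

(** The library [base] is available at each step, because the group generated by
    [MN] is contained in all the subgroups of the chain. *)
Lemma chain_covered gens steps : chain_ok gens steps ->
  covered (gen_by gens) (gen_by MN) (Z.to_nat (chain_index steps)).
Proof.
elim: steps gens => [|st steps IH] gens /=.
  move=> /eqP ->; exists [:: 1%g] => // X HX; exists 1%g; rewrite ?inE //.
  by rewrite invg1 mul1g.
case/andP=> /andP[symp tab] /IH cov.
have pos : 0 <= chain_index steps.
  by elim: steps {IH cov} => //= s l IHl; apply: Z.mul_nonneg_nonneg => //; apply: Nat2Z.is_nonneg.
rewrite Z2Nat.inj_mul // ?Nat2Z.id; last exact: Nat2Z.is_nonneg.
apply: covered_trans cov; apply: table_covered tab; first exact: gen_by_subgroup.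
apply: allz_extend; first exact: gen_by_subgroup.
move=> A /List.in_app_iff[/baseP[X HX <-]|Ast].
  by exists X => //; apply: gen_by_catl.
apply: gen_by_inz; first by apply/List.in_or_app; right.
by elim: (step_gens st) symp Ast => //= B s IHs /andP[sB ss] [<-|/(IHs ss)].
Qed.
End Chain.

#[local] Arguments zm : simpl never.
#[local] Arguments zmul : simpl never.

(** * Principal congruence subgroups *)

Definition zred m A :=
  let: Zm a0 a1 a2 a3 a4 a5 a6 a7 a8 a9 a10 a11 a12 a13 a14 a15 := A in
  Zm (a0 mod m) (a1 mod m) (a2 mod m) (a3 mod m)
     (a4 mod m) (a5 mod m) (a6 mod m) (a7 mod m)
     (a8 mod m) (a9 mod m) (a10 mod m) (a11 mod m)
     (a12 mod m) (a13 mod m) (a14 mod m) (a15 mod m).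

#[local] Arguments zred : simpl never.

Lemma dot_mod m a0 b0 a1 b1 a2 b2 a3 b3 :
  ((a0 mod m) * (b0 mod m) + (a1 mod m) * (b1 mod m) + (a2 mod m) * (b2 mod m)
    + (a3 mod m) * (b3 mod m)) mod m = (a0*b0 + a1*b1 + a2*b2 + a3*b3) mod m.
Proof.
have add a b c d : a mod m = c mod m -> b mod m = d mod m ->
    (a + b) mod m = (c + d) mod m.
  by move=> ac bd; rewrite Zplus_mod ac bd -Zplus_mod.
by apply: (add _ _ _ _ (add _ _ _ _ (add _ _ _ _ _ _) _) _); rewrite [RHS]Zmult_mod.
Qed.

Lemma zredM m A B : zred m (zmul (zred m A) (zred m B)) = zred m (zmul A B).
Proof. by rewrite /zred /zmul; case: A; case: B => *; congr Zm; apply: dot_mod. Qed.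

Lemma zred_id m A : zred m (zred m A) = zred m A.
Proof. by rewrite /zred; case: A => *; congr Zm; apply: Zmod_mod. Qed.

Lemma zredMl m A B : zred m (zmul (zred m A) B) = zred m (zmul A B).
Proof. by rewrite -zredM zred_id zredM. Qed.

Lemma zredMr m A B : zred m (zmul A (zred m B)) = zred m (zmul A B).
Proof. by rewrite -zredM zred_id zredM. Qed.

Lemma zred_div m n A : (n | m) -> zred n (zred m A) = zred n A.
Proof. by rewrite /zred; case: A => *; congr Zm; apply: Z.mod_mod_divide. Qed.

Lemma zredW m n A B : (n | m) -> zred m A = zred m B -> zred n A = zred n B.
Proof. by move=> nm e; rewrite -(zred_div A nm) e zred_div. Qed.

Definition Gamma m : set Sp4 := [set X | zred m (zm X) = zred m zone].

Lemma GammaP m X Y : Gamma m (X^-1 * Y)%g <-> zred m (zm X) = zred m (zm Y).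
Proof.
rewrite /Gamma /= zmM zmV; split=> [e|e].
  have := congr1 (fun A => zred m (zmul (zm X) A)) e.
  by rewrite !zredMr zmulA zmulV ?zmP // zmul1 zmulr1.
by rewrite -zredMr -e zredMr zmulVl ?zmP.
Qed.

Lemma Gamma_subgroup m : is_subgroup (Gamma m).
Proof.
split=> [|X Y GX GY|X GX]; rewrite /Gamma /=.
- by rewrite zm1.
- by rewrite zmM -zredM GX GY zredM zmul1.
- have: Gamma m (X^-1 * 1)%g by apply/GammaP; rewrite GX zm1.
  by rewrite mulg1.
Qed.

Definition Gamma2 m n : set Sp4 := Gamma m `&` Gamma n.

Lemma setI_subgroup (H K : set Sp4) :
  is_subgroup H -> is_subgroup K -> is_subgroup (H `&` K).
Proof.
move=> [H1 HM HV] [K1 KM KV]; split=> // [x y [Hx Kx] [Hy Ky]|x [Hx Kx]].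
  by split; [apply: HM|apply: KM].
by split; [apply: HV|apply: KV].
Qed.

(** Two cosets of [K] and of [L] meet in at most one coset of their
    intersection. *)
Lemma covered_setI (H K L : set Sp4) n m :
  is_subgroup K -> is_subgroup L ->
  covered H K n -> covered H L m -> covered H (K `&` L) (n * m).
Proof.
move=> [_ KM KV] [_ LM LV] [R Rn HR] [Q Qm HQ].
pose good (rq : Sp4 * Sp4) x := [/\ H x, K (rq.1^-1 * x)%g & L (rq.2^-1 * x)%g].
have /choice[f fP] : forall rq, exists x, (exists y, good rq y) -> good rq x.
  by move=> rq; have [[y gy]|no] := pselect (exists y, good rq y);
    [exists y | exists 1%g].
exists [seq f (r, q) | r <- R, q <- Q]; first by rewrite size_allpairs leq_mul.
move=> x Hx; have [[r rR Kr] [q qQ Lq]] := (HR x Hx, HQ x Hx).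
exists (f (r, q)); first exact: allpairs_f.
have [|_ Kf Lf] := fP (r, q); first by exists x.
split.
- by have := KM _ _ (KV _ Kf) Kr; rewrite invgM invgK -mulgA mulVKg.
- by have := LM _ _ (LV _ Lf) Lq; rewrite invgM invgK -mulgA mulVKg.
Qed.

(** * Orders of subgroups modulo m *)

Section ModularGroup.
Variable m : Z.

Definition zmulm A B := zred m (zmul A B).
Definition one_m := zred m zone.

Lemma zmulmA A B C : zmulm A (zmulm B C) = zmulm (zmulm A B) C.
Proof. by rewrite /zmulm zredMr zredMl zmulA. Qed.

Lemma zmul1m A : zmulm one_m A = zred m A.
Proof. by rewrite /zmulm zredMl zmul1. Qed.

Lemma zmulm1 A : zmulm A one_m = zred m A.
Proof. by rewrite /zmulm zredMr zmulr1. Qed.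

Lemma zred_zmulm A B : zred m (zmulm A B) = zmulm A B.
Proof. exact: zred_id. Qed.

Definition entry A (i : nat) :=
  let: Zm a0 a1 a2 a3 a4 a5 a6 a7 a8 a9 a10 a11 a12 a13 a14 a15 := A in
  nth 0 [:: a0; a1; a2; a3; a4; a5; a6; a7; a8; a9; a10; a11; a12; a13; a14; a15] i.

(** A pivot [(g, i, q)] is a matrix [g] whose successive powers take different
    values modulo [q] at the entry [i]: this tells which power of [g] to strip
    off the left of a product [g_1^e_1 ... g_r^e_r]. *)
Definition pivot := (zmat * nat * Z)%type.

Variable p : nat.

Definition zpower g k := iter k (zmulm g) one_m.

Fixpoint products (gs : seq pivot) :=
  if gs is (g, _, _) :: gs' then
    [seq zmulm (zpower g e) d | e <- iota 0 p, d <- products gs']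
  else [:: one_m].

Lemma size_products gs : size (products gs) = (p ^ size gs)%N.
Proof.
elim: gs => [|[[g i] q] gs IH] //=.
by rewrite size_allpairs size_iota IH expnS.
Qed.

(** Divides [A] on the left by [g_1], [g_2], ... as long as the pivots require
    it; [A] is a product of powers of the pivots as soon as the quotient is 1.
    *)
Fixpoint strip (found : zmat -> bool) g i q k A :=
  if k is k'.+1 then
    if (entry A i - entry zone i) mod q =? 0 then found A
    else strip found g i q k' (zmulm (zinv g) A)
  else false.

Fixpoint sift (gs : seq pivot) :=
  if gs is (g, i, q) :: gs' then strip (sift gs') g i q p
  else fun A => zeq A one_m.

(** The consistency of a polycyclic series: it makes the products of the
    pivots closed under multiplication. *)
Fixpoint polycyclic (gs : seq pivot) :=
  if gs is (g, _, _) :: gs' then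
    [&& zeq (zmulm g (zinv g)) one_m, zeq (zmulm (zinv g) g) one_m,
        sift gs' (zpower g p),
        all (fun h : pivot => sift gs' (zmulm (zinv g) (zmulm h.1.1 g))) gs'
      & polycyclic gs']
  else true.

Lemma zpower_red g k : zred m (zpower g k) = zpower g k.
Proof. by case: k => [|k]; apply: zred_id. Qed.

Lemma zpowerD g j k : zmulm (zpower g j) (zpower g k) = zpower g (j + k).
Proof.
elim: j => [|j IH]; first by rewrite zmul1m zpower_red.
by rewrite addSn /zpower !iterS -/(zpower g j) -zmulmA IH.
Qed.

Lemma sift_products gs A : polycyclic gs -> sift gs A -> zred m A \in products gs.
Proof.
elim: gs A => [|[[g i] q] gs IH] A /=.
  by move=> _ /zeqP ->; rewrite inE zred_id.
case/and5P=> /zeqP gV _ _ _ pc.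
have stripP k B : strip (sift gs) g i q k B -> exists2 j, (j < k)%N &
    exists2 d, d \in products gs & zred m B = zmulm (zpower g j) d.
  elim: k B => [|k IHk] B //=; case: ifP => _.
    move=> /(IH B pc) Bd; exists 0%N => //.
    by exists (zred m B); rewrite // zmul1m zred_id.
  move=> /IHk[j jk [d dg e]]; exists j.+1 => //; exists d => //.
  by rewrite /zpower iterS -/(zpower g j) -zmulmA -e zred_zmulm zmulmA gV zmul1m.
move=> /stripP[j jp [d dg ->]].
by apply: (allpairs_f (fun e d => zmulm (zpower g e) d)); rewrite ?mem_iota.
Qed.

Lemma products_ind (P : zmat -> Prop) gs :
  P one_m -> (forall h, h \in map (fun h : pivot => h.1.1) gs -> P h) ->
  (forall A B, P A -> P B -> P (zmulm A B)) ->
  forall d, d \in products gs -> P d.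
Proof.
move=> P1 Pg PM; elim: gs Pg => [|[[g i] q] gs IH] Pg d /=.
  by rewrite inE => /eqP ->.
case/allpairsP=> -[j e] /= [_ eg ->]; apply: (PM); last first.
  by apply: IH eg => h' h'g; apply: Pg; rewrite inE h'g orbT.
have Ph : P g by apply: Pg; rewrite inE eqxx.
by elim: j => //= j IHj; apply: (PM).
Qed.

Hypothesis p_gt0 : (0 < p)%N.

Lemma products1 gs : one_m \in products gs.
Proof.
elim: gs => [|[[g i] q] gs IH] /=; first by rewrite inE.
have -> : one_m = zmulm (zpower g 0) one_m by rewrite zmul1m zred_id.
by apply: (allpairs_f (fun e d => zmulm (zpower g e) d)); rewrite ?mem_iota.
Qed.

(** The collection process: [g_1] moves to the left across the other pivots,
    at the expense of conjugating them, and [g_1^p] is a product of the pivots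
    which follow. *)
Lemma productsM gs A B : polycyclic gs ->
  A \in products gs -> B \in products gs -> zmulm A B \in products gs.
Proof.
elim: gs A B => [|[[g i] q] gs IH] A B.
  by move=> _; rewrite !inE => /eqP -> /eqP ->; rewrite zmul1m zred_id.
rewrite /= => /and5P[/zeqP gV /zeqP Vg gp conj pc].
have {}IH C D : C \in products gs -> D \in products gs ->
  zmulm C D \in products gs by apply: IH.
have conjD d : d \in products gs ->
    exists2 d', d' \in products gs & zmulm d g = zmulm g d'.
  move=> dg; exists (zmulm (zinv g) (zmulm d g)); last first.
    by rewrite zmulmA gV zmul1m zred_zmulm.
  move: d dg; apply: products_ind => [|h /mapP[h' h'g ->]|C D Cg Dg].
  - by rewrite zmul1m -[zmulm _ _]/(zred m _) zredMr -/(zmulm _ _) Vg products1.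
  - have /(sift_products pc) := allP conj h' h'g.
    by rewrite zred_zmulm.
  - rewrite (_ : zmulm _ _ = zmulm (zmulm (zinv g) (zmulm C g))
        (zmulm (zinv g) (zmulm D g))); first exact: IH.
    rewrite -!zmulmA; congr zmulm; congr zmulm.
    by rewrite [RHS]zmulmA gV zmul1m zred_zmulm.
have conjX k d : d \in products gs ->
    exists2 d', d' \in products gs & zmulm d (zpower g k) = zmulm (zpower g k) d'.
  elim: k d => [|k IHk] d dg; first by exists d => //; rewrite zmul1m zmulm1.
  have [d' d'g e'] := conjD d dg; have [d'' d''g e] := IHk d' d'g.
  exists d'' => //; rewrite /zpower iterS -/(zpower g k).
  by rewrite zmulmA e' -zmulmA e zmulmA.
case/allpairsP=> -[e d] /= [ep dg ->] /allpairsP[[f d'] /= [fp d'g ->]].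
rewrite !mem_iota /= !add0n in ep fp.
have [d'' d''g e'] := conjX f d dg.
have -> : zmulm (zmulm (zpower g e) d) (zmulm (zpower g f) d') =
    zmulm (zpower g (e + f)) (zmulm d'' d').
  by rewrite -zpowerD -!zmulmA; congr zmulm; rewrite !zmulmA e'.
have dd := IH _ _ d''g d'g.
have [lt_ef|le_ef] := ltnP (e + f)%N p.
  by apply: (allpairs_f (fun e d => zmulm (zpower g e) d)); rewrite ?mem_iota.
rewrite -(subnKC le_ef) [(p + _)%N]addnC -zpowerD -zmulmA.
apply: (allpairs_f (fun e d => zmulm (zpower g e) d)).
  by rewrite mem_iota /= add0n ltn_subLR //; lia.
apply: IH => //; rewrite -zpower_red; exact: sift_products.
Qed.
End ModularGroup.

Lemma Gamma_covered (H : set Sp4) m (s : seq zmat) :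
  (forall X, H X -> zred m (zm X) \in s) -> covered H (Gamma m) (size s).
Proof.
move=> Hs; have /choice[f fP] : forall A, exists X, (exists2 Y, H Y & zred m (zm Y) = A) ->
    zred m (zm X) = A.
  move=> A; have [[Y HY e]|no] := pselect (exists2 Y, H Y & zred m (zm Y) = A).
    by exists Y.
  by exists 1%g => -[Y HY e]; case: no; exists Y.
exists (map f s); first by rewrite size_map.
move=> X HX; exists (f (zred m (zm X))); first by rewrite map_f ?Hs.
by apply/GammaP; apply: fP; exists X.
Qed.

(** [T] lists representatives, modulo [m], of the cosets of the subgroup
    generated by the pivots [gs]. As the pivots are 1 modulo [p], the residue
    modulo [p] of [s t] tells the representative of its coset. *)
Definition modular_ok (m : Z) (p : nat) gens (gs : seq pivot) (T : seq zmat) :=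
  let q := Z.of_nat p in
  [&& polycyclic m p gs, zeq (head zone T) (one_m m), (0 < size T)%N,
      all (fun t => zeq (zmulm m t (zinv t)) (one_m m)) T &
      let keys := map (zred q) T in
      all (fun s => all (fun t =>
        let A := zmulm m s t in
        let i := index (zred q A) keys in
        (i < size T)%N && sift m p gs (zmulm m (zinv (nth zone T i)) A)) T)
        (gens ++ map zinv gens)].

(** The set of the products [t d], with [t] in [T] and [d] a product of pivots,
    is stable under the generators, so it contains the image modulo [m] of the
    group that they generate. *)
Lemma modular_covered m p gens gs T : (0 < p)%N -> modular_ok m p gens gs T ->
  covered (gen_by gens) (Gamma m) (size T * p ^ size gs)%N.
Proof.
move=> p_gt0; rewrite /modular_ok => /and5P[pc /zeqP hT T0 TV Tg].
pose TD := [seq zmulm m t d | t <- T, d <- products m p gs].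
have -> : (size T * p ^ size gs)%N = size TD.
  by rewrite size_allpairs size_products.
apply: Gamma_covered.
have stable s : s \in gens ++ map zinv gens -> forall x, x \in TD -> zmulm m s x \in TD.
  move=> sg _ /allpairsP[[t d] /= [tT dD ->]].
  have /andP[iT si] := allP (allP Tg s sg) t tT.
  move: (nth _ _ _) (mem_nth zone iT) si => t' t'T si.
  have := sift_products pc si; rewrite zred_zmulm => wD.
  rewrite zmulmA; have -> : zmulm m s t = zmulm m t' (zmulm m (zinv t') (zmulm m s t)).
    by rewrite zmulmA (zeqP _ _ (allP TV t' t'T)) zmul1m zred_zmulm.
  rewrite -zmulmA; apply: allpairs_f => //; exact: productsM.
pose P : set Sp4 := fun X =>
  forall x, x \in TD -> zmulm m (zm X) x \in TD /\ zmulm m (zm X^-1%g) x \in TD.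
have TDr x : x \in TD -> zred m x = x.
  by case/allpairsP=> -[t d] [_ _ ->]; apply: zred_zmulm.
have sP : is_subgroup P.
  split=> [x xT|X Y PX PY x xT|X PX x xT].
  - by rewrite invg1 zm1 /zmulm zmul1 TDr.
  - have E A B : zmulm m (zmul A B) x = zmulm m A (zmulm m B x).
      by rewrite /zmulm zredMr zmulA.
    have [Yx _] := PY x xT; have [_ Xx] := PX x xT.
    split; first by rewrite zmM E; apply: (PX _ Yx).1.
    by rewrite invgM zmM E; apply: (PY _ Xx).2.
  - by have [? ?] := PX x xT; rewrite invgK.
have gP : gen_by gens `<=` P.
  apply: gen_subgroup_min => // X [A Ag XA] x xT.
  have {}Ag : A \in gens.
    by elim: gens Ag {Tg stable} => //= B g IH [->|/IH]; rewrite inE ?eqxx // => ->; rewrite orbT.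
  rewrite zmV XA; split; apply: stable => //; rewrite mem_cat ?Ag //.
  by rewrite map_f ?orbT.
move=> X /gP /(_ (one_m m)); case.
  rewrite -[one_m m]zred_id -zmulm1 -/(one_m m); apply: allpairs_f; last exact: products1.
  by rewrite -hT -nth0 mem_nth.
by rewrite zmulm1.
Qed.

(** Exploration of the orbit of [x0], up to the equality of keys; [seen] holds
    the codes of the keys met so far. The search is breadth first, lest the
    entries of the matrices become huge. *)
Section Search.
Variables (act : zmat -> zmat -> zmat) (key : zmat -> zmat) (q : Z).

Definition code A : positive :=
  let: Zm a0 a1 a2 a3 a4 a5 a6 a7 a8 a9 a10 a11 a12 a13 a14 a15 := key A in
  Z.to_pos (foldl (fun c a => c * q + a mod q) 1
    [:: a0; a1; a2; a3; a4; a5; a6; a7; a8; a9; a10; a11; a12; a13; a14; a15]).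

Fixpoint new_images gens x seen acc :=
  if gens is g :: gens' then
    let y := act g x in let c := code y in
    if PositiveSet.mem c seen then new_images gens' x seen acc
    else new_images gens' x (PositiveSet.add c seen) (rcons acc y)
  else (seen, acc).

Fixpoint search gens fuel seen todo found :=
  if fuel is fuel'.+1 then
    if todo is x :: todo' then
      let: (seen', todo'') := new_images gens x seen todo' in
      search gens fuel' seen' todo'' (rcons found x)
    else found
  else found.

Definition orbit_reps gens fuel x0 :=
  search gens fuel (PositiveSet.add (code x0) PositiveSet.empty) [:: x0] [::].

Lemma orbit_repsP (Q : zmat -> Prop) gens fuel x0 : Q x0 ->
  (forall g x, g \in gens -> Q x -> Q (act g x)) ->
  forall x, x \in orbit_reps gens fuel x0 -> Q x.
Proof.
move=> Q0 Qg; rewrite /orbit_reps.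
have new g x seen acc : {subset g <= gens} -> Q x -> (forall y, y \in acc -> Q y) ->
    forall y, y \in (new_images g x seen acc).2 -> Q y.
  move=> gg Qx; elim: g seen acc gg => [//|h g IH] seen acc gg Qa /=.
  have hg : h \in gens by apply: gg; rewrite inE eqxx.
  have gg' : {subset g <= gens} by move=> z zg; apply: gg; rewrite inE zg orbT.
  case: ifP => _; apply: IH => // y; rewrite mem_rcons inE => /orP[/eqP ->|/Qa //].
  exact: Qg.
suff searchP seen todo found : (forall y, y \in found -> Q y) ->
    (forall y, y \in todo -> Q y) ->
    forall y, y \in search gens fuel seen todo found -> Q y.
  by apply: searchP => // y; rewrite inE => /eqP ->.
elim: fuel seen todo found => [//|fuel IH] seen todo found Qf Qt /=.
case: todo Qt => [//|x todo] Qt.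
have := new gens x seen todo (fun y yg => yg).
case: new_images => seen' todo' /= Qn; apply: IH => y.
  by rewrite mem_rcons inE => /orP[/eqP ->|/Qf //]; apply: Qt; rewrite inE eqxx.
apply: Qn; first by apply: Qt; rewrite inE eqxx.
by move=> z zt; apply: Qt; rewrite inE zt orbT.
Qed.
End Search.

(** * The order of the symplectic group modulo prime powers *)

Lemma packed_seq (H K : set Sp4) (key : zmat -> zmat) (s : seq zmat) :
  (forall A, A \in s -> inz H A) -> uniq (map key s) ->
  (forall X Y, H X -> H Y -> K (X^-1 * Y)%g -> key (zm X) = key (zm Y)) ->
  packed H K (size s).
Proof.
move=> Hs us HK; exists (fun i => sp (nth zone s i)) => [i|i j].
  have [X HX e] := Hs _ (mem_nth zone (ltn_ord i)).
  by rewrite -e; rewrite (_ : sp (zm X) = X) //; apply: zm_inj; rewrite spK // zmP.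
have [X HX eX] := Hs _ (mem_nth zone (ltn_ord i)).
have [Y HY eY] := Hs _ (mem_nth zone (ltn_ord j)).
have spz Z : sp (zm Z) = Z by apply: zm_inj; rewrite spK // zmP.
rewrite -eX -eY !spz => /(HK _ _ HX HY); rewrite eX eY => e.
apply: val_inj; apply/eqP; rewrite -(nth_uniq (key zone) _ _ us) ?size_map //=.
by rewrite !(nth_map zone) // e.
Qed.

Definition zadd A B :=
  let: Zm a0 a1 a2 a3 a4 a5 a6 a7 a8 a9 a10 a11 a12 a13 a14 a15 := A in
  let: Zm b0 b1 b2 b3 b4 b5 b6 b7 b8 b9 b10 b11 b12 b13 b14 b15 := B in
  Zm (a0+b0) (a1+b1) (a2+b2) (a3+b3) (a4+b4) (a5+b5) (a6+b6) (a7+b7)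
     (a8+b8) (a9+b9) (a10+b10) (a11+b11) (a12+b12) (a13+b13) (a14+b14) (a15+b15).

Definition zscale k A :=
  let: Zm a0 a1 a2 a3 a4 a5 a6 a7 a8 a9 a10 a11 a12 a13 a14 a15 := A in
  Zm (k*a0) (k*a1) (k*a2) (k*a3) (k*a4) (k*a5) (k*a6) (k*a7)
     (k*a8) (k*a9) (k*a10) (k*a11) (k*a12) (k*a13) (k*a14) (k*a15).

(** Modulo [q^2], the matrices [1 + q A] multiply as their parts [A] add. *)
Definition lin q A := zadd zone (zscale q A).

Definition tv0 n (v : Z * Z * Z * Z) :=
  let: (a, b, c, d) := v in
  Zm (- n*a*c) (- n*a*d) (n*a*a) (n*a*b)
     (- n*b*c) (- n*b*d) (n*b*a) (n*b*b)
     (- n*c*c) (- n*c*d) (n*c*a) (n*c*b)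
     (- n*d*c) (- n*d*d) (n*d*a) (n*d*b).

Lemma lin_tv q n v : tv (q * n) v = lin q (tv0 n v).
Proof. by case: v => [[[a b] c] d]; rewrite /lin /tv /=; congr Zm; ring. Qed.

Lemma zred_add_scale m k A B : (m | k) -> zred m (zadd A (zscale k B)) = zred m A.
Proof.
move=> [r ->]; case: A => *; case: B => *; rewrite /zred /=.
by congr Zm; rewrite -Z.mul_assoc [m * _]Z.mul_comm Z.mul_assoc Z_mod_plus_full.
Qed.

Lemma lin_mul m q A B : (m | q * q) ->
  zred m (zmul (lin q A) (lin q B)) = zred m (lin q (zadd A B)).
Proof.
move=> mq; rewrite -[RHS](zred_add_scale _ (zmul A B) mq); congr zred.
by rewrite /zmul /lin; case: A => *; case: B => * /=; congr Zm; ring.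
Qed.

Lemma lin_inj q p A B : 0 < q -> 0 < p ->
  zred (q * p) (lin q A) = zred (q * p) (lin q B) -> zred p A = zred p B.
Proof.
move=> q0 p0; have inj c a b :
    (c + q * a) mod (q * p) = (c + q * b) mod (q * p) -> a mod p = b mod p.
  move=> e; have := Zminus_mod (c + q * a) (c + q * b) (q * p).
  rewrite e Z.sub_diag Zmod_0_l (_ : _ - _ = q * (a - b)); last by ring.
  rewrite Zmult_mod_distr_l => e0.
  have {}e0 : (a - b) mod p = 0 by nia.
  by rewrite (_ : a = b + (a - b)); [rewrite Zplus_mod e0 Z.add_0_r Zmod_mod | ring].
case: A => a0 a1 a2 a3 a4 a5 a6 a7 a8 a9 a10 a11 a12 a13 a14 a15.
case: B => b0 b1 b2 b3 b4 b5 b6 b7 b8 b9 b10 b11 b12 b13 b14 b15.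
by rewrite /zred /lin /=; case; do 16!move=> /inj ->.
Qed.

(** The rank one forms [v v^T] of these vectors span the symmetric 4 x 4
    matrices, hence their transvections span each quotient of consecutive
    congruence subgroups. *)
Definition sym_vectors : seq (Z * Z * Z * Z) :=
  [:: (1,1,0,0); (1,0,1,0); (1,0,0,1); (0,1,1,0); (0,1,0,1); (0,0,1,1);
      (1,0,0,0); (0,1,0,0); (0,0,1,0); (0,0,0,1)].

(** The coefficient [c k] weighs the [k]-th vector; a fixed common factor [n]
    allows the product to be trivial modulo another integer. *)
Definition sym_prod n (c : nat -> Z) :=
  foldr (fun kv A => zmul (tv (n * c kv.1) kv.2) A) zone (zip (iota 0 10) sym_vectors).

Definition sym_sum n (c : nat -> Z) :=
  foldr (fun kv A => zadd (tv0 (n * c kv.1) kv.2) A) (zscale 0 zone)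
    (zip (iota 0 10) sym_vectors).

Lemma sym_prod_lin m q n c : (m | q * q) ->
  zred m (sym_prod (q * n) c) = zred m (lin q (sym_sum n c)).
Proof.
move=> mq; rewrite /sym_prod /sym_sum; elim: (zip _ _) => [|[k v] s IH].
  by congr zred; rewrite /lin /zone /=; congr Zm; ring.
by rewrite /= -zredMr IH zredMr -Z.mul_assoc lin_tv lin_mul.
Qed.

(** The entries off the diagonal of the symmetric matrix give the coefficients
    of the vectors [e_i + e_j], then the diagonal gives those of the [e_i]. *)
Lemma sym_sum_inj (p : nat) n c c' : n mod (Z.of_nat p) = 1 ->
  (forall k, 0 <= c k < Z.of_nat p) -> (forall k, 0 <= c' k < Z.of_nat p) ->
  zred (Z.of_nat p) (sym_sum n c) = zred (Z.of_nat p) (sym_sum n c') ->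
  forall k, (k < 10)%N -> c k = c' k.
Proof.
move: (Z.of_nat p) => q n1 cp cp'; have q0 : 0 < q by have := cp 0%N; lia.
have can k x y u : x = n * (c k + u) -> y = n * (c' k + u) ->
    x mod q = y mod q -> c k = c' k.
  move=> -> ->; rewrite Z.mul_comm [n * (_ k + _)]Z.mul_comm.
  rewrite Zmult_mod [RHS]Zmult_mod n1 !Z.mul_1_r !Zmod_mod => e.
  have := Zminus_mod (c k + u) (c' k + u) q; rewrite e Z.sub_diag Zmod_0_l.
  rewrite (_ : _ - _ = c k - c' k); last by ring.
  have qn0 : q <> 0 by lia.
  move=> /(proj1 (Z.mod_divide _ _ qn0))[z ez].
  have := cp k; have := cp' k => ? ?; have zq : - q < z * q < q by rewrite -ez; lia.
  have z0 : z = 0 by clear -zq q0; nia.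
  by rewrite z0 in ez; lia.
have canN k x y u : x = - (n * (c k + u)) -> y = - (n * (c' k + u)) ->
    x mod q = y mod q -> c k = c' k.
  move=> ex ey e; apply: (can k (- x) (- y) u); rewrite ?ex ?ey; try by ring.
  rewrite -ex -ey -(Z.sub_0_l x) -(Z.sub_0_l y).
  by rewrite Zminus_mod e -Zminus_mod.
rewrite /zred /sym_sum /=; case.
move=> f0 f1 f2 f3 f4 f5 f6 f7 f8 f9 f10 f11 f12 f13 f14 f15.
have e0 : c 0%N = c' 0%N by apply: (can _ _ _ 0 _ _ f3); ring.
have e1 : c 1%N = c' 1%N by apply: (canN _ _ _ 0 _ _ f0); ring.
have e2 : c 2%N = c' 2%N by apply: (canN _ _ _ 0 _ _ f1); ring.
have e3 : c 3%N = c' 3%N by apply: (canN _ _ _ 0 _ _ f4); ring.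
have e4 : c 4%N = c' 4%N by apply: (canN _ _ _ 0 _ _ f5); ring.
have e5 : c 5%N = c' 5%N by apply: (canN _ _ _ 0 _ _ f9); ring.
have e6 : c 6%N = c' 6%N by apply: (can _ _ _ (c 0%N + c 1%N + c 2%N) _ _ f2); rewrite ?e0 ?e1 ?e2; ring.
have e7 : c 7%N = c' 7%N by apply: (can _ _ _ (c 0%N + c 3%N + c 4%N) _ _ f7); rewrite ?e0 ?e3 ?e4; ring.
have e8 : c 8%N = c' 8%N by apply: (canN _ _ _ (c 1%N + c 3%N + c 5%N) _ _ f8); rewrite ?e1 ?e3 ?e5; ring.
have e9 : c 9%N = c' 9%N by apply: (canN _ _ _ (c 2%N + c 4%N + c 5%N) _ _ f13); rewrite ?e2 ?e4 ?e5; ring.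
by do 10!(case=> //).
Qed.

Lemma Gamma_tv m n v : (m | n) -> Gamma m (sp (tv n v)).
Proof.
move=> [r ->]; rewrite /Gamma /= spK ?tv_symp // Z.mul_comm lin_tv /lin.
exact/zred_add_scale/Z.divide_refl.
Qed.

Lemma inz_Gamma_tv m n v : (m | n) -> inz (Gamma m) (tv n v).
Proof. by move=> mn; exists (sp (tv n v)); [apply: Gamma_tv | apply/spK/tv_symp]. Qed.

(** The quotient of the congruence subgroups of levels [q] and [q p] is the
    additive group of the symmetric matrices modulo [p], which has order
    [p^10]. Staying inside [Gamma m] costs a factor [n] on the exponents of the
    transvections, invisible modulo [p]. *)
Lemma packed_layer (p : nat) m n q : 0 < q -> (1 < p)%N -> (Z.of_nat p | q) ->
  (m | n) -> n mod (Z.of_nat p) = 1 ->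
  packed (Gamma2 m q) (Gamma2 m (q * Z.of_nat p)) (p ^ 10).
Proof.
move=> q0 p1 [r qE] mn n1; have p0 : 0 < Z.of_nat p by lia.
rewrite -[10%N]card_ord -[X in (X ^ _)%N]card_ord -card_ffun.
pose c (f : {ffun 'I_10 -> 'I_p}) k := Z.of_nat (f (inord k)).
have cp f k : 0 <= c f k < Z.of_nat p by rewrite /c; have := ltn_ord (f (inord k)); lia.
have sG H X : is_subgroup H -> inz H X -> H (sp X).
  by move=> _ [Y HY <-]; rewrite (_ : sp _ = Y) //; apply: zm_inj; rewrite spK ?zmP.
have inG d f : (d | n) \/ (d | q) -> inz (Gamma d) (sym_prod (q * n) (c f)).
  move=> dq; rewrite /sym_prod; elim: (zip _ _) => [|[k v] s IH].
    exact: inz1 (Gamma_subgroup d).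
  apply: inzM IH; first exact: Gamma_subgroup.
  apply: inz_Gamma_tv; apply: Z.divide_mul_l.
  by case: dq => dq; [apply: Z.divide_mul_r | apply: Z.divide_mul_l].
apply: (packed_fin (f := fun f => sp (sym_prod (q * n) (c f)))) => [f|f f'].
  split; apply: sG; try exact: Gamma_subgroup.
    by apply: inG; left.
  by apply: inG; right; apply: Z.divide_refl.
case=> _ /GammaP.
have zsp g : zsymp (sym_prod (q * n) (c g)).
  by apply: (@inz_symp (Gamma q)); apply: inG; right; apply: Z.divide_refl.
have pq : (q * Z.of_nat p | q * q).
  by rewrite [X in (_ | _ * X)]qE; exists r; ring.
rewrite (spK (zsp f)) (spK (zsp f')) (sym_prod_lin n (c f) pq) (sym_prod_lin n (c f') pq).
move=> /(lin_inj q0 p0) /(sym_sum_inj n1 (cp f) (cp f')) e.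
apply/ffunP => i; have := e i (ltn_ord i); rewrite /c inord_val.
by move=> /Nat2Z.inj /val_inj.
Qed.

(** Products with this matrix keep the first column only, which stands for a
    vector. *)
Definition e1_proj := Zm 1 0 0 0  0 0 0 0  0 0 0 0  0 0 0 0.

Definition Gamma_e1 m p : set Sp4 :=
  [set X | Gamma m X /\ zred p (zmul (zm X) e1_proj) = zred p e1_proj].

Lemma zred_e1 p A : zsymp A -> zred p (zmul A e1_proj) = zred p e1_proj ->
  zred p (zmul (zinv A) e1_proj) = zred p e1_proj.
Proof. by move=> sA e; rewrite -zredMr -e zredMr zmulA zmulVl // zmul1. Qed.

Lemma Gamma_e1_subgroup m p : is_subgroup (Gamma_e1 m p).
Proof.
have [G1 GM GV] := Gamma_subgroup m.
split=> [|X Y [GX eX] [GY eY]|X [GX eX]].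
- by split=> //; rewrite zm1 zmul1.
- by split; [apply: GM | rewrite zmM -zmulA -zredMr eY zredMr].
- by split; [apply: GV | rewrite zmV zred_e1 ?zmP].
Qed.

Definition basic_vectors : seq (Z * Z * Z * Z) :=
  [:: (1,0,0,0); (0,1,0,0); (0,0,1,0); (0,0,0,1); (1,-1,0,0)].

(** Vectors orthogonal to [e_1], so that their transvections fix it. *)
Definition e1_vectors : seq (Z * Z * Z * Z) :=
  [:: (1,0,0,0); (0,1,0,0); (0,0,0,1); (1,1,0,0); (1,0,0,1)].

Definition column_key p A := zred p (zmul A e1_proj).

(** The fuel 700 exceeds the sizes of the orbits to be explored, the largest of
    which has 648 elements. *)
Definition column_reps p n :=
  orbit_reps zmul (column_key p) p (map (tv n) basic_vectors) 700 zone.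

Definition e1_reps p n :=
  orbit_reps zmul (zred p) p (map (tv n) e1_vectors) 700 zone.

(** For [p] prime the expected values are [p^4 - 1] nonzero columns, and
    [p^3 |SL_2(F_p)|] for the order of the stabiliser of one of them. *)
Definition sp4_count p n N1 N2 :=
  [&& size (column_reps p n) == N1, uniq (map (column_key p) (column_reps p n)),
      size (e1_reps p n) == N2 & uniq (map (zred p) (e1_reps p n))].

(** An orbit and stabiliser count, for the action on [e_1] modulo [p]. *)
Lemma packed_modp m p n N1 N2 : (m | n) -> sp4_count p n N1 N2 ->
  packed (Gamma m) (Gamma2 m p) (N1 * N2).
Proof.
move=> mn /and4P[/eqP <- u1 /eqP <- u2].
have sG := Gamma_subgroup m; have sE := Gamma_e1_subgroup m p.
apply: (@packed_trans _ _ (Gamma_e1 m p)) => //; first by move=> X [].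
- move=> X [GX eX]; split=> //.
  by rewrite -zredMl eX zredMl zmul1.
- apply: (packed_seq _ u1) => [A|X Y _ _ [_]].
    apply: orbit_repsP => [|g B /mapP[v _ ->]]; first exact: inz1.
    by apply: inzM => //; apply: inz_Gamma_tv.
  rewrite zmM zmV => e; rewrite /column_key.
  have := congr1 (fun A => zred p (zmul (zm X) A)) e.
  by rewrite !zredMr !zmulA zmulV ?zmP // zmul1.
- apply: (packed_seq _ u2) => [A|X Y _ _ [_ /GammaP //]].
  apply: orbit_repsP => [|g B /mapP[v vs ->]]; first exact: inz1.
  apply: inzM => //; exists (sp (tv n v)); last exact/spK/tv_symp.
  split; first exact: Gamma_tv.
  rewrite spK ?tv_symp //; move: vs; rewrite !inE.
  by do !case/predU1P=> [->|]; [..|move/eqP ->]; congr zred; rewrite /zmul /=; congr Zm; ring.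
Qed.

Lemma zpowS x b : x ^ Z.of_nat b.+1 = x ^ Z.of_nat b * x.
Proof.
rewrite Nat2Z.inj_succ (Z.pow_succ_r x _ (Nat2Z.is_nonneg b)); exact: Z.mul_comm.
Qed.

Lemma packed_congruence m (p : nat) n a N : (1 < p)%N -> (m | n) ->
  n mod (Z.of_nat p) = 1 -> packed (Gamma m) (Gamma2 m (Z.of_nat p)) N ->
  packed (Gamma m) (Gamma2 m (Z.of_nat p ^ Z.of_nat a.+1)) (N * (p ^ 10) ^ a).
Proof.
move=> p1 mn n1 packed1; have p0 : 0 < Z.of_nat p by lia.
have powS b := zpowS (Z.of_nat p) b.
have sG d : is_subgroup (Gamma2 m d) by apply: setI_subgroup; apply: Gamma_subgroup.
elim: a => [|a IH]; first by rewrite Z.pow_1_r expn0 muln1.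
rewrite expnSr mulnA powS.
apply: (packed_trans _ _ _ _ IH) => //; first exact: Gamma_subgroup.
- by move=> X [].
- by move=> X [GX GX']; split=> //; apply: zredW GX'; exists (Z.of_nat p); apply: Z.mul_comm.
- apply: (packed_layer (n := n)) => //; first exact: Z.pow_pos_nonneg (Nat2Z.is_nonneg _).
  by exists (Z.of_nat p ^ Z.of_nat a); apply: powS.

Qed.

Lemma Gamma_1 : Gamma 1 = setT.
Proof.
apply/seteqP; split=> // X _; rewrite /Gamma /= /zred /=.
by case: (zm X) => *; rewrite !Z.mod_1_r.
Qed.

Lemma packed_level (p : nat) a N : (1 < p)%N ->
  packed (Gamma 1) (Gamma2 1 (Z.of_nat p)) N ->
  packed setT (Gamma (Z.of_nat p ^ Z.of_nat a.+1)) (N * (p ^ 10) ^ a).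
Proof.
move=> p1 packed1; rewrite -Gamma_1.
apply: (packed_sub (K := Gamma2 1 (Z.of_nat p ^ Z.of_nat a.+1))).
  by move=> X GX; split=> //; rewrite Gamma_1.
apply: (packed_congruence (n := 1)) => //; first exact: Z.divide_refl.
by apply: Z.mod_small; lia.
Qed.

Lemma packed_level2 m (p : nat) n a N N' : (1 < p)%N -> (m | n) ->
  n mod (Z.of_nat p) = 1 -> packed setT (Gamma m) N ->
  packed (Gamma m) (Gamma2 m (Z.of_nat p)) N' ->
  packed setT (Gamma2 m (Z.of_nat p ^ Z.of_nat a.+1)) (N * (N' * (p ^ 10) ^ a)).
Proof.
move=> p1 mn n1 pm packed1.
apply: (packed_trans _ _ _ _ pm (packed_congruence a p1 mn n1 packed1)) => //.
- exact: Gamma_subgroup.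
- by move=> X [].
Qed.

(** * Bounds for the index of G(d,k) *)

Definition M_mat d k := Zm 1 1 0 0  0 1 0 0  d d 1 0  0 (- k) (-1) 1.
Definition N_mat := Zm 1 0 0 0  0 1 0 1  0 0 1 0  0 0 0 1.
Definition MN d k := [:: M_mat d k; N_mat].

Lemma Gdk_gen d k : Gdk d k = gen_by (MN (Z_of_int d) (Z_of_int k)).
Proof.
rewrite /Gdk /gen_by; congr gen_subgroup; apply/seteqP; split=> [X [->|->]|X [A]] /=.
- by exists (M_mat (Z_of_int d) (Z_of_int k)); [left | rewrite zm_M].
- by exists N_mat; [right; left | rewrite zm_N].
case=> [<- e|[<- e|//]]; [left|right]; apply: zm_inj.
- by rewrite zm_M e.
- by rewrite zm_N e.
Qed.

Lemma inz_MN d k : allz (gen_by (MN d k)) (MN d k).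
Proof.
move=> A AMN; apply: gen_by_inz => //.
by case: AMN => [<-|[<-|//]]; apply/zeqP; rewrite /zmul /=; congr Zm; ring.
Qed.

Definition elementary := [seq tv 1 v | v <-
  [:: (1,0,0,0); (0,0,1,0); (1,-1,0,0); (0,0,0,1); (0,1,0,0)]].

Lemma gen_by_elementary : gen_by elementary = setT.
Proof.
apply/seteqP; split=> // X _.
have inH v : List.In (tv 1 v) elementary -> inz (gen_by elementary) (tv 1 v).
  by move=> vl; apply: gen_by_inz => //; apply: tv_symp.
apply: full_of_transvections; [exact: gen_by_subgroup|..]; apply: inH => /=; tauto.
Qed.

Lemma index_upper d k lib steps :
  chain_ok (MN d k) (extend (MN d k) lib) elementary steps ->
  covered setT (gen_by (MN d k)) (Z.to_nat (chain_index steps)).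
Proof.
rewrite -gen_by_elementary; apply: chain_covered.
by apply: allz_extend; [apply: gen_by_subgroup | apply: inz_MN].
Qed.

(** The fuel 130 exceeds the order, at most 120, of the image of G(d,k) modulo 2
    or 3 in the cases at hand. *)
Definition mod_reps (m q d k : Z) := orbit_reps (zmulm m) (zred q) q (MN d k) 130 (one_m m).

Lemma zmuln m n : Z.of_nat (m * n)%N = Z.of_nat m * Z.of_nat n.
Proof. exact: Nat2Z.inj_mul. Qed.

Lemma zexpn m n : Z.of_nat (m ^ n)%N = Z.of_nat m ^ Z.of_nat n.
Proof. by elim: n => [|n IH]; rewrite ?expn0 // expnSr zmuln zpowS IH. Qed.

Section Bounds.
Variables (d k : Z).
Let G := gen_by (MN d k).

Lemma index_eq_chain n lib steps :
  chain_ok (MN d k) (extend (MN d k) lib) elementary steps ->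
  chain_index steps = Z.of_nat n -> packed setT G n -> index_eq G n.
Proof.
move=> /index_upper upper e lower; rewrite e Nat2Z.id in upper.
by apply: covered_packed_index => //; apply: gen_by_subgroup.
Qed.

Lemma packed_quotient (L : set Sp4) n c N : is_subgroup L -> (0 < c)%N ->
  covered G L c -> packed setT L N -> N = (n * c)%N -> packed setT G n.
Proof.
move=> sL c0 cov pack e; rewrite e in pack.
exact: packed_div (gen_by_subgroup _) sL c0 cov pack.
Qed.

(** The equation between the orders is stated in [Z], since their unary
    representations are out of reach. *)
Lemma packed_mod_p (p a N n c : nat) gs :
  let m := Z.of_nat p ^ Z.of_nat a.+1 in
  packed setT (Gamma m) (N * (p ^ 10) ^ a) -> (0 < p)%N ->
  modular_ok m p (MN d k) gs (mod_reps m (Z.of_nat p) d k) ->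
  size (mod_reps m (Z.of_nat p) d k) = c.+1 ->
  Z.of_nat N * (Z.of_nat p ^ 10) ^ Z.of_nat a
    = Z.of_nat n * (Z.of_nat c.+1 * Z.of_nat p ^ Z.of_nat (size gs)) ->
  packed setT G n.
Proof.
move=> m pack p0 /(modular_covered p0) cov sz; rewrite sz in cov.
rewrite -[10]/(Z.of_nat 10%N) -!zexpn -!zmuln => /Nat2Z.inj.
apply: (packed_quotient _ _ cov pack); first exact: Gamma_subgroup.
by rewrite muln_gt0 expn_gt0 p0.
Qed.

(** The indices in question are products of a 2-part and a 3-part, obtained
    from separate computations modulo a power of 2 and modulo a power of 3. *)
Lemma packed_mod_2_3 (m2 m3 : Z) (N2 a N3 b n c2 c3 : nat) gs2 gs3 :
  packed setT (Gamma2 m2 m3) (N2 * (2 ^ 10) ^ a * (N3 * (3 ^ 10) ^ b)) ->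
  modular_ok m2 2 (MN d k) gs2 (mod_reps m2 2 d k) ->
  modular_ok m3 3 (MN d k) gs3 (mod_reps m3 3 d k) ->
  size (mod_reps m2 2 d k) = c2.+1 -> size (mod_reps m3 3 d k) = c3.+1 ->
  let two := Z.of_nat 2 in let three := Z.of_nat 3 in
  Z.of_nat N2 * (two ^ 10) ^ Z.of_nat a * (Z.of_nat N3 * (three ^ 10) ^ Z.of_nat b)
    = Z.of_nat n * (Z.of_nat c2.+1 * two ^ Z.of_nat (size gs2)
                    * (Z.of_nat c3.+1 * three ^ Z.of_nat (size gs3))) ->
  packed setT G n.
Proof.
move=> pack /modular_covered-/(_ isT) cov2 /modular_covered-/(_ isT) cov3 sz2 sz3.
rewrite sz2 in cov2; rewrite sz3 in cov3.
have cov := covered_setI (Gamma_subgroup m2) (Gamma_subgroup m3) cov2 cov3.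
move=> two three; rewrite /two /three.
rewrite -[10]/(Z.of_nat 10%N) -!zexpn -!zmuln => /Nat2Z.inj.
apply: (packed_quotient _ _ cov pack).
  by apply: setI_subgroup; apply: Gamma_subgroup.
by rewrite !muln_gt0 !expn_gt0.
Qed.
End Bounds.

Lemma zprime_powers a b c d e : Z.of_nat (a ^ b * c ^ d * e)%N =
  Z.of_nat a ^ Z.of_nat b * Z.of_nat c ^ Z.of_nat d * Z.of_nat e.
Proof. by rewrite !zmuln !zexpn. Qed.

Ltac by_compute := vm_compute; reflexivity.

Lemma packed_mod2 : packed (Gamma 1) (Gamma2 1 2) (15 * 48).
Proof. by apply: (@packed_modp 1 2 1 15%N 48%N (Z.divide_refl 1)); by_compute. Qed.

(** The candidates for [n] are multiples of 4, 8 and 2 congruent to 1 modulo 3,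
    one for each power of 2 that occurs together with 3. *)
Lemma packed_mod3 m n : (m | n) -> n \in [:: 4; -8; -2] ->
  packed (Gamma m) (Gamma2 m 3) (80 * 648).
Proof.
move=> mn n_in; apply: (@packed_modp m 3 n 80%N 648%N mn).
by move: n_in; rewrite !inE => /or3P[] /eqP ->; by_compute.
Qed.

Lemma packed_2 a : packed setT (Gamma (2 ^ Z.of_nat a.+1)) (15 * 48 * (2 ^ 10) ^ a).
Proof. exact: (packed_level a (isT : 1 < 2)%N packed_mod2). Qed.

Lemma packed_2_3 a n b : let m := 2 ^ Z.of_nat a.+1 in
  (m | n) -> n mod 3 = 1 -> n \in [:: 4; -8; -2] ->
  packed setT (Gamma2 m (3 ^ Z.of_nat b.+1))
    (15 * 48 * (2 ^ 10) ^ a * (80 * 648 * (3 ^ 10) ^ b)).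
Proof.
move=> m mn n1 n_in.
exact: (packed_level2 b (isT : 1 < 3)%N mn n1 (packed_2 a) (packed_mod3 mn n_in)).
Qed.

(** * Coset tables and polycyclic series *)

(** The environment of the words starts with [M], [N] and the words of the
    library [lib]. The library consists of elements of [G]: transvections along
    vectors of the [G]-orbit of [e_2], each a conjugate of an earlier one by [M]
    or by another of them, and in the case of [G(4,4)] further elements. In each
    [step] the new generators come next in the environment, followed by the
    results of the words.

    When the index is 6 or 10 a single step is enough. Otherwise the first
    subgroup of the chain is the stabiliser of a nonzero linear form modulo 2,
    or modulo 3 in the case of [G(3,4)]; the next ones are given by the condition
    that the residue modulo 2, 4, 8, ... belongs to the image of [G], preceded in
    the case of [G(3,4)] by the same condition modulo 3 and 9. *)

Definition lib_13 : seq (seq Z) :=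
  [:: [:: -1; 2; 1]; [:: 1; 2; -1]; [:: 2; 4; -2]; [:: 1; 5; -1]; [:: 2; 6; -2]; [:: 7; 3;
  -7]; [:: -1; 8; 1]; [:: 9; 2; -9]; [:: -1; 10; 1]; [:: -1; 11; 1]; [:: 12; 2; -12]; [::
  -1; 13; 1]; [:: 9; 14; -9]; [:: 11; 14; -11]; [:: 10; 14; -10]; [:: 17; 11; -17]; [:: 8;
  13; -8]; [:: 13; 16; -13]].

Definition step_13_1 := Step
  [::]
  [:: [:: -11; 10; -11; 12; 9; -13]; [:: -2; -2; 19; 20]; [:: -11; 10; -11; 12; 16; -18];
  [:: -11; 10; -11; 12]; [:: 2; -11; 10; -11; 12; -2]]
  [:: Zm 1 0 0 0 0 1 0 0 0 0 1 0 0 0 0 1; Zm 1 0 0 0 0 1 0 0 0 0 1 0 0 (-1) 0 1; Zm 1 0 0 0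
  0 0 0 1 0 0 1 0 0 (-1) 0 1; Zm 1 0 (-1) 1 0 1 1 (-1) 0 0 1 0 0 0 0 1; Zm 1 0 (-1) 1 0 1 1
  (-1) 1 0 0 1 0 0 0 1; Zm 0 0 (-1) 0 0 1 1 (-1) 1 0 0 1 0 0 0 1]
  [:: ([:: 0; 1; 2; 3; 5; 4]%N, [:: 15; 15; 15; 15; 21; 0]); ([:: 0; 1; 2; 4; 3; 5]%N, [::
  11; 11; 11; 22; 0; 15]); ([:: 3; 1; 2; 0; 4; 5]%N, [:: 23; 16; 16; 0; 11; 11]); ([:: 1; 0;
  2; 3; 4; 5]%N, [:: 0; 24; 2; 16; 16; 16]); ([:: 0; 2; 1; 3; 4; 5]%N, [:: 2; 0; 25; 2; 2;
  2])].

Definition lib_12 : seq (seq Z) :=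
  [:: [:: -1; 2; 1]; [:: -2; 3; 2]; [:: -1; 4; 1]; [:: 2; 5; -2]; [:: 1; 6; -1]; [:: 1; 7;
  -1]; [:: -1; 5; 1]; [:: 7; 9; -7]; [:: 2; 8; -2]; [:: 1; 11; -1]; [:: 8; 2; -8]; [:: 2; 6;
  -2]; [:: 7; 10; -7]; [:: 11; 6; -11]; [:: 13; 6; -13]; [:: 12; 9; -12]; [:: 12; 7; -12]].

Definition step_12_1 := Step
  [::]
  [:: [:: -2; 12; -2; 10]; [:: -2; 12; -2; 10; 7; -18]; [:: 2; -7; -7; 17]; [:: 2; 13; 1;
  14; -8; -15]; [:: -2; 7; 9; 19; 1; -2]; [:: 2; 7; 1; -2]; [:: 7; -6; 7; 1; -7; 6; -2; 10];
  [:: -7; 6; -7; 8]; [:: -7; 6; -7; 8; 16; -2]]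
  [:: Zm 1 0 0 0 0 1 0 0 0 0 1 0 0 0 0 1; Zm 1 0 (-1) 0 0 1 0 0 0 0 1 0 0 0 0 1; Zm 1 0 (-1)
  0 0 1 0 0 1 0 0 0 0 0 0 1; Zm 1 0 0 0 0 1 0 0 0 0 1 0 0 (-1) 0 1; Zm 1 0 0 0 0 0 0 1 0 0 1
  0 0 (-1) 0 1; Zm 1 0 (-1) 0 0 0 0 1 0 0 1 0 0 (-1) 0 1; Zm 1 0 (-1) 0 0 0 0 1 1 0 0 0 0
  (-1) 0 1; Zm 1 0 (-1) 0 0 1 0 0 0 0 1 0 0 (-1) 0 1; Zm 1 0 (-1) 0 0 1 0 0 1 0 0 0 0 (-1) 0
  1; Zm 0 0 (-1) 1 1 1 0 (-1) 1 0 0 0 0 0 0 1]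
  [:: ([:: 1; 0; 2; 7; 5; 4; 6; 3; 8; 9]%N, [:: 20; 0; 7; 20; 20; 0; 7; 0; 7; 7]); ([:: 0;
  2; 1; 3; 4; 6; 5; 8; 7; 9]%N, [:: 7; 21; 0; 7; 7; 21; 0; 21; 0; 10]); ([:: 0; 1; 9; 5; 7;
  3; 6; 4; 8; 2]%N, [:: 10; 10; 22; 23; 24; 25; 14; 26; 14; 0]); ([:: 3; 7; 8; 0; 4; 5; 6;
  1; 2; 9]%N, [:: 0; 0; 0; 27; 2; 2; 2; 27; 27; 14]); ([:: 0; 1; 2; 4; 3; 7; 8; 5; 6; 9]%N,
  [:: 2; 2; 2; 0; 28; 28; 28; 0; 0; 2])].

Definition lib_23 : seq (seq Z) :=
  [:: [:: 1; 2; -1]; [:: 2; 3; -2]; [:: -1; 2; 1]; [:: 5; 4; -5]; [:: 1; 6; -1]; [:: 2; 7;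
  -2]; [:: 2; 8; -2]; [:: -9; 5; 9]; [:: 2; 10; -2]; [:: 10; 2; -10]; [:: 2; 11; -2]; [::
  -1; 13; 1]; [:: -6; 14; 6]; [:: 15; 9; -15]; [:: -12; 16; 12]; [:: 2; 17; -2]; [:: 2; 15;
  -2]; [:: 19; 18; -19]; [:: -2; 14; 2]; [:: 21; 7; -21]; [:: 1; 11; -1]; [:: 7; 6; -7]; [::
  -1; 15; 1]; [:: 1; 9; -1]; [:: 10; 19; -10]; [:: 10; 13; -10]; [:: 10; 8; -10]; [:: 8; 5;
  -8]; [:: 6; 9; -6]].

Definition step_23_1 := Step
  [:: Zm 1 0 0 0 0 0 0 1 0 0 1 0 0 (-1) 0 0; Zm 1 0 1 0 0 1 0 0 0 0 1 0 0 0 0 1]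
  [:: [:: 2; 32; 8; -1; 33; -32; 2; -33; -33]; [:: 32; 8; -32]; [:: 1; -33; 8; -1; 33; -11];
  [:: 2; 32; -33; 8; -1; -32; 2; 23; -11]; [:: 2; 32; -33; 8; -1; -32; 2]; [:: 32; -1; 2;
  32; 33; -11; -32; 2; -12]; [:: 32; 2; -32]; [:: 2; 32; -33; 8; -1; 32; 2; -32; 24; -8;
  -32]; [:: 32; 1; -22; 2; 32; -33; 8; -1; -2; -32; 33; 2]; [:: 32; 32; 33; -11; -12]; [::
  -9; 8; -1; 33; 32; 32; -2; -11; -2]; [:: 2; 32; -33; 8; -1; -32; 2; 25; -10]; [:: -1; 32;
  32; -2; 33; -11; -9]; [:: -32; -20; 1; -33; 8; -1; -32; 33]]
  [:: Zm 1 0 0 0 0 1 0 0 0 0 1 0 0 0 0 1; Zm 1 0 0 0 0 1 0 0 (-1) 0 1 0 0 0 0 1; Zm 0 0 1 0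
  0 1 0 0 (-1) 0 1 0 0 0 0 1; Zm 0 0 1 (-1) 1 1 (-1) 1 (-1) 0 1 0 0 0 0 1; Zm 1 0 0 (-1) 1 1
  (-1) 1 (-1) 0 1 0 0 0 0 1; Zm 1 0 0 (-1) 1 1 (-1) 1 0 0 1 (-1) 0 0 0 1; Zm 0 0 1 (-1) 1 1
  (-1) 1 (-1) 0 1 0 (-1) (-1) 1 0; Zm 0 0 1 (-1) 0 0 0 1 (-1) 0 1 0 (-1) (-1) 1 0; Zm 1 0 0
  (-1) 0 0 0 1 (-1) 0 1 0 (-1) (-1) 1 0; Zm 1 0 0 (-1) 0 0 0 1 0 0 1 (-1) (-1) (-1) 1 0; Zm
  0 (-1) 0 0 1 1 0 0 0 0 1 (-1) (-1) (-1) 1 0; Zm 0 (-1) 0 0 1 1 0 0 0 0 1 (-1) 0 0 1 0; Zm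
  0 (-1) 0 0 0 0 1 0 0 0 1 (-1) (-1) (-1) 1 0; Zm 1 0 0 (-1) (-1) (-1) 1 1 (-1) 0 1 0 (-1)
  (-1) 1 0; Zm 1 0 0 (-1) (-1) (-1) 1 1 0 0 1 (-1) (-1) (-1) 1 0]
  [:: ([:: 0; 2; 1; 4; 3; 5; 13; 8; 7; 9; 10; 11; 12; 6; 14]%N, [:: 33; 0; 34; 34; 0; 35;
  36; 34; 0; 35; 35; 35; 35; 37; 35]); ([:: 1; 0; 2; 3; 5; 4; 6; 7; 9; 8; 10; 11; 12; 14;
  13]%N, [:: 0; 38; 33; 35; 39; 0; 35; 35; 39; 0; 40; 40; 40; 39; 0]); ([:: 0; 3; 4; 1; 2;
  5; 6; 7; 8; 10; 9; 11; 14; 13; 12]%N, [:: 35; 0; 34; 41; 42; 43; 40; 40; 40; 44; 0; 2; 0;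
  40; 44]); ([:: 0; 1; 2; 6; 13; 14; 3; 7; 8; 9; 11; 10; 12; 4; 5]%N, [:: 40; 40; 40; 0;
  -37; -37; 45; 2; 2; 2; 46; 0; 33; 47; 47]); ([:: 0; 1; 2; 3; 4; 5; 7; 6; 13; 14; 12; 11;
  10; 8; 9]%N, [:: 2; 2; 2; 2; 2; 2; 0; 37; 0; 0; 0; 33; 37; 37; 37])].

Definition step_23_2 := Step
  [:: Zm 1 0 1 0 0 1 0 0 0 0 1 0 0 0 0 1]
  [:: [:: 2; 26; 1; -10; -26]; [:: -6; 2; -32; 8; 2; 10; -32; 8; -32; 11; -32; 2; -11; -12];
  [:: -32; 8; -32; 11]; [:: 2; -32; 8; 2; 10; -32; 8; -32; 11; -32]; [:: -32; 8; -32; 11;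
  2]; [:: 2; 2; 10; 13; -12]; [:: -27; -32; 8; -1; 11; -32; 1; 8; -32; 9; 10]]
  [:: Zm 1 0 0 0 0 1 0 0 0 0 1 0 0 0 0 1; Zm 1 0 0 0 0 0 0 (-1) 0 0 1 0 0 1 0 0; Zm 1 0 0 0
  0 (-1) 0 (-1) 0 0 1 0 0 1 0 0; Zm 1 0 0 (-1) 0 0 0 (-1) 2 0 1 (-2) 0 1 (-1) 3]
  [:: ([:: 0; 3; 2; 1]%N, [:: 1; 0; 33; 34]); ([:: 0; 2; 1; 3]%N, [:: 2; 35; 0; 28]); ([::
  1; 0; 2; 3]%N, [:: 36; 0; 37; 38]); ([:: 0; 1; 2; 3]%N, [:: 32; 32; 32; 39])].

Definition step_23_3 := Step
  [:: Zm (-1) 0 (-1) 0 0 (-1) 0 0 2 0 1 0 0 0 0 (-1)]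
  [:: [:: -2; 32; -11; -9]; [:: 2; 26; 1; -8; 1; 11; -32; 8]; [:: 8; 11; 2; 26; 1; -8; -2;
  -30; -11]; [:: 2; 26; 1; -8; 1; -8; 32; 32; 2; 2; 7; 2; 8; 29]]
  [:: Zm 1 0 0 0 0 1 0 0 0 0 1 0 0 0 0 1; Zm 1 0 (-1) 0 0 1 0 0 0 0 1 0 0 0 0 1; Zm 1 0 1 0
  0 1 0 0 0 0 1 0 0 0 0 1; Zm 1 0 (-2) 0 0 1 0 0 0 0 1 0 0 0 0 1]
  [:: ([:: 0; 2; 1; 3]%N, [:: 1; 33; 34; 35]); ([:: 0; 1; 2; 3]%N, [:: 2; 2; 2; 2]); ([:: 2;
  0; 3; 1]%N, [:: 0; 0; 36; 0])].

Definition step_23_4 := Step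
  [::]
  [:: [:: 31; 8; -1; 11; -22]; [:: 2; 26; 1; -8; -2; -30; 11]; [:: 22; 8; -1; 8; -31]]
  [:: Zm 1 0 0 0 0 1 0 0 0 0 1 0 0 0 0 1; Zm (-1) 0 (-1) 0 0 (-1) 0 0 2 0 1 0 0 0 0 (-1); Zm
  (-1) 0 0 0 0 1 0 0 0 0 (-1) 0 0 0 0 1; Zm 1 0 1 0 0 (-1) 0 0 (-2) 0 (-1) 0 0 0 0 (-1)]
  [:: ([:: 0; 3; 2; 1]%N, [:: 1; 32; 33; 34]); ([:: 0; 1; 2; 3]%N, [:: 2; 2; 2; 2]); ([:: 1;
  2; 3; 0]%N, [:: 0; 0; 0; 0])].

Definition lib_34 : seq (seq Z) :=
  [:: [:: -1; 2; 1]; [:: -2; 3; 2]; [:: -1; 4; 1]; [:: -2; 5; 2]; [:: -1; 6; 1]; [:: -1; 7;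
  1]; [:: 2; 8; -2]; [:: 2; 5; -2]; [:: -7; 10; 7]; [:: 1; 11; -1]; [:: 1; 12; -1]; [:: -3;
  13; 3]; [:: 1; 2; -1]; [:: 2; 15; -2]; [:: 16; 14; -16]; [:: 8; 17; -8]; [:: 2; 18; -2];
  [:: 19; 9; -19]; [:: 18; 20; -18]; [:: -2; 21; 2]; [:: -2; 22; 2]; [:: -2; 23; 2]; [:: -2;
  24; 2]; [:: -2; 25; 2]; [:: 11; 26; -11]; [:: -2; 6; 2]; [:: -7; 9; 7]; [:: 1; 29; -1];
  [:: -30; 28; 30]; [:: -2; 31; 2]; [:: 2; 29; -2]; [:: 2; 33; -2]; [:: 34; 32; -34]; [::
  -2; 35; 2]; [:: 36; 27; -36]; [:: 37; 27; -37]; [:: 38; 8; -38]; [:: 39; 2; -39]; [:: 40;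
  2; -40]; [:: 41; 2; -41]; [:: -2; 15; 2]; [:: 41; 21; -41]; [:: 44; 11; -44]; [:: 1; 16;
  -1]; [:: 46; 45; -46]; [:: 2; 47; -2]; [:: -1; 48; 1]; [:: 40; 49; -40]; [:: 2; 3; -2];
  [:: 51; 50; -51]; [:: 18; 21; -18]; [:: 1; 53; -1]; [:: 1; 54; -1]; [:: 40; 55; -40]; [::
  -1; 56; 1]; [:: 57; 52; -57]; [:: 2; 57; -2]; [:: 59; 58; -59]; [:: 60; 43; -60]; [:: -2;
  12; 2]; [:: 62; 61; -62]; [:: 44; 2; -44]; [:: 64; 25; -64]; [:: 1; 42; -1]; [:: 66; 3;
  -66]; [:: 67; 3; -67]; [:: 41; 39; -41]; [:: 2; 59; -2]; [:: 70; 58; -70]; [:: -2; 53; 2];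
  [:: 2; 55; -2]; [:: 39; 73; -39]; [:: 39; 74; -39]; [:: -65; 32; 65]; [:: -2; 76; 2]; [::
  -2; 77; 2]; [:: 78; 75; -78]; [:: -1; 79; 1]; [:: 1; 13; -1]; [:: -2; 81; 2]; [:: 40; 46;
  -40]; [:: -1; 83; 1]; [:: 84; 82; -84]; [:: -2; 84; 2]; [:: 86; 85; -86]; [:: -2; 87; 2];
  [:: 88; 85; -88]; [:: 2; 48; -2]; [:: -2; 54; 2]; [:: -2; 88; 2]; [:: -40; 18; 40]; [:: 2;
  37; -2]; [:: 2; 11; -2]; [:: 95; 25; -95]; [:: -2; 47; 2]; [:: -2; 57; 2]; [:: 2; 39; -2];
  [:: 2; 94; -2]; [:: 2; 19; -2]; [:: 2; 66; -2]; [:: -39; 22; 39]; [:: -53; 39; 53]; [:: 1;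
  104; -1]; [:: -39; 53; 39]; [:: 57; 87; -57]; [:: -2; 66; 2]; [:: 108; 107; -108]; [:: 2;
  109; -2]; [:: 2; 110; -2]; [:: -2; 75; 2]; [:: 80; 59; -80]; [:: 80; 70; -80]; [:: 1; 69;
  -1]; [:: 2; 38; -2]; [:: -40; 23; 40]; [:: 87; 113; -87]; [:: 2; 100; -2]; [:: 1; 116;
  -1]; [:: 67; 120; -67]; [:: 3; 49; -3]; [:: 122; 121; -122]; [:: -59; 80; 59]; [:: 67;
  124; -67]; [:: 125; 7; -125]; [:: 2; 53; -2]; [:: -99; 127; 99]; [:: -2; 78; 2]].

Definition step_34_1 := Step
  [:: Zm 1 0 0 0 0 1 0 0 0 0 1 0 0 (-1) 0 1; Zm 1 0 1 0 0 1 0 0 0 0 1 0 0 0 0 1; Zm 1 0 1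
  (-2) 0 1 (-2) 4 0 0 1 0 0 0 0 1; Zm 1 0 0 0 0 1 0 0 (-3) (-3) 1 0 (-3) (-3) 0 1]
  [:: [:: 1; -130; -130; -130; 1; 133; 130; 130; -1; 130; -1]; [:: 42; -131; 2; -130; -2;
  130; 130; 130; -1; -134; 132; 63]; [:: 130; 2; 134; 1; 131; -1; -134; -2; -130]; [:: -130;
  -2; -130; -130; -130; 1; 133; 2; 130; -131; 132; -136; 132; 30]; [:: 134; 130; -2; -2;
  132; -2; 130; -137; -130; 131; 2; -132; 2; 2; 130; 131; -42]; [:: 131; -2; 130; -2; -2;
  132; -2; 130; -137; -130; 131; 2; -132; 2; -130; 131; 2; -132; 2; -130; -2; 130; 130; 130;
  -1; -2; -2; -130; -2; -131]; [:: -2; -130; -2; 130; -2; -2; 132; -2; 130; -137; -130; 131;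
  2; -132; 2; -130; 131; 2; -132; 2; 2; 130; 2; 130; -131; 2; 130]; [:: -2; -130; -2; 130;
  -2; -2; 132; -2; 130; -137; -130; 131; 2; -132; 2; -130; 131; 2; -132; 2; -130; -2; 131;
  -2; -130]; [:: -2; -130; -2; 130; -2; -2; 132; -2; 130; -137; -130; 131; 2; -132; 2; -130;
  131; 2; -132; 2; -130; -2; -131; 2; 130]; [:: 2; -130; 2; 131; 2; 2; -132; 2; 130; 2; 130;
  131; 131; 131; 131; -2; -2]; [:: 133; -130; -2; -2; -2; 132; 130; 2; 130; 130; 130; 133;
  2; 2]; [:: -2; 134; -130; 2; 130; -2; -2; 132; -2; 130; -137; -130; 131; 2; -132; 2; -130;
  -2; -2; -130; -130; 134; -131]; [:: 131; 134; -41; -131; -134; -2; -130; -131; 2; 2;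
  -130]; [:: -130; -2; 130; -2; -2; 132; -2; 130; -137; -130; 131; 2; -132; 2; -130; -2;
  -130; -2; -130; -130; 131; 134; -2; -130]; [:: -130; -2; 130; -2; -2; 132; -2; 130; -137;
  -130; 131; 2; -132; 2; -130; 131; 2; -132; 2; 2; 130; 2; 131; 134; -2; -130]; [:: -2; 133;
  -130; 2; 130; -2; -2; 132; -2; 130; -137; -130; 131; 2; -132; 2; -130; 131; 2; -132; 2; 2;
  130; 2; 130; 2; -130; 134; -131]; [:: -131; -2; -131; -134; 130; -2; -2; 132; -2; 130;
  -137; -130; 131; 2; -132; 2; -130; -2; -131]; [:: 2; 131; 2; 2; -132; 2; -130]; [:: 2;
  -130; 2; 131; 2; 2; -132; 2; 130; 2; 130; 131; 131; 131; -2; -2; -134; 131]; [:: 134; 130;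
  -2; -2; 132; -2; 130; -137; -130; 131; -2; -130; -131; -131; -72; 130]; [:: -133; 2; 130;
  -131; -2; -2; 132; -2; -2; -2; -44]; [:: -132; 2; 130; 2; 2; 130; 2; 131]; [:: 2; 130; 2;
  2; 130; 2]; [:: 2; 2; 130; -2; -2; 132; -2; 130; -137; -130; 131; 2; -132; 2; -130; 131;
  2; -132; 2; 2; 130; 2; 130; 131; -2; 131; -2; 130; -134; -63; -130]; [:: -2; 130; -2; -2;
  132; -2; 130; -137; -130; 131; 2; -132; 2; -130; 131; 2; -132; 2; -130; -2; 130; 130; 130;
  -1; -2; -2; -130; -2]; [:: 130; 131; 130; 130; -1; 131; 42; 131]; [:: -131; -131; -131;
  -131]; [:: 2; 131; 2; 2; -132; 2]; [:: 130; -2; -2; 132; -2; 130; -137; -130; 131; 2;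
  -132; 2; 2; 130; 130; 130; 130; 133; -1; -135; -2; -132; 131; -2]; [:: 131; -132]; [:: -2;
  134; -130; -2; -131; -2; -2; 132; -2; -130; -2; -130; -130; -130]; [:: -130; -47; 130; -2;
  -2; 132; -2; 130; -137; -130; 131; 2; -132; 2; 2; 130; 131; 133; -2; 130]; [:: -132; 131;
  130; 2; -130; -130; 134; -2; -130; 2; 132; -131; 2]; [:: -2; -130; -2; -130; -130; -130;
  133; 2; 130; 2; 2; 2; 2]; [:: 131; 131; -42; 2; 131; 2; 2; -132; 2; 130; 2; 130; 130; 130;
  134; 131; 131]; [:: 131; -2; -131; -2; -2; 132; -2; -130; -2; 131; 134; 131; 2; 130; 131];
  [:: 2; 131; 2; 2; -132; 2; -131; -131; -131; -131]; [:: -2; -131; -2; -2; 132; -2; -2;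
  -131; -2; -131; -131; -2; -131; -2]; [:: -2; 134; -130; -2; -131; -2; -2; 132; -2; -130;
  -2; -130; -130; -131; -130; -134; 131]; [:: -2; -130; -2; -2; -131; -2; -2; 132; -2; -2;
  131; 131; -130; -2; -130; -131; -131; 130; 130]; [:: 130; -2; -2; 132; -2; 130; -137;
  -130; 131; 2; -132; 2; -130; -2; -130; -2; 130; 134; 131; -12]; [:: -131; 1; 130; -2; -2;
  132; -2; 130; -137; -130; 131; 2; -132; 2; -130; 131; 2; -132; 2; 2; 130; 2; -130; -130;
  2; 133; 131; -2; -130]; [:: 132; 65; -131; 1; 130; -2; -2; 132; -2; 130; -137; -130; 131;
  2; -132; 2; -130; 131; 2; -132; 2; -130; -2; -130; -130; -130; 2; -1]; [:: -132; 130; 2;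
  -130; -130; 134; -2; -130; 2; 132; 2]; [:: 130; -2; -2; 132; -2; 130; -137; -130; 131; 2;
  -132; 2; -130; -2; -130; -2; 134; 131; -12]; [:: 2; 130; 2; 2; 131; 2; 2; -132; 130; 2;
  -131; 130; 130; 130; 131; -130]; [:: 131; 130; 2; 131; -44; 2; 133; 130; -2; -2; 132; -2;
  130; -137; -130; 131; 2; -132; 2; -130; 131; 2; -132; 2; -130; -2; -2; 130; -133]; [::
  131; 2; 130; 2; 130; 2; -130; -130; 1; -131; 2; 133; -130; 63; 130]; [:: 130; -2; 130; -2;
  -2; 132; -2; 130; -137; -130; 131; 2; -132; 2; -130; -2; -130; -2; -130; 131; 2; -130;
  134; -2]; [:: 130; 63; -130; 134; 2; -131; -134; 130; -2; -2; 132; -2; 130; -137; -130;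
  131; 2; -132; 2; 2; 130; 131]; [:: 2; 130; -131; -2; -2; 132; -2; -130; -2; -130; 131;
  134; -131]; [:: 131; -134; 130; -2; 130; -2; -2; 132; -2; 130; -137; -130; 131; 2; -132;
  2; 2; 130; 2; -130]; [:: 2; 131; 2; 2; -132; 2; 2; 131; 2; 2; 2]; [:: 132; -2; -130; -2;
  -130; -130; -130; 134; 2; 130; 2; 2; 2; 2; -132]; [:: -2; 134; -130; -2; -131; -2; -2;
  132; -2; -130; -2; -130; -130]; [:: -2; 130; -2; -2; 132; -2; 130; -137; -130; 131; 2;
  -132; 2; 2; 2; 130; 2; 131; -130]; [:: -130; 2; 130; -2; -2; 132; -2; 130; -137; -130;
  131; 2; -132; 2; -130; -2; -130; -130; 134; -131]; [:: -130; 2; 130; -2; -2; 132; -2; 130;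
  -137; -130; 131; 2; -132; 2; -130; -2; -131; -130; -130]; [:: 130; -2; 130; -2; -2; 132;
  -2; 130; -137; -130; 131; 2; -132; 2; 2; 2; 130; 2; 131; -130; -130]; [:: -63; 135; -133;
  130; 2; -130; -130; -130; 1; 133]; [:: -63; -133; -137; 2; 130; -131; -2; -2; 132; -2;
  131; 130; 130; 71]; [:: -131; 134; 131]; [:: 133; 130; -2; -2; 132; -2; 130; -137; -130;
  131; 2; -132; 2; -130; 131; 2; -132; 2; 2; 130; 2; 130; 130; 130; -134; -135; -130; -2;
  -134; 2]; [:: 133; -2; -130; -2; -130; -130; -130; -130; 1]; [:: -2; -130; -2; 130; -2;
  -2; 132; -2; 130; -137; -130; 131; 2; -132; 2; -130; -2; -130; -2; -130; -134; 2]; [:: -2;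
  131; 133; 2; 130; -131; -130]; [:: 68; -130; -130; -2; 131; 130; 130; 130; -1; 2; 2; 2];
  [:: -2; 133; 2; 130; 132; -130; -69]; [:: 2; 130; 2; 2; 130; -2; 132; -133; -2; -133;
  -131]; [:: 130; -2; -2; 132; -2; 130; -137; -130; 131; 2; -132; 2; -130; 131; 2; -132; 2;
  2; 130; 2; 131; 134; 131; 12; 131]; [:: 134; 130; -2; -2; 132; -2; 130; -137; -130; 131;
  2; -132; 2; -130; -2]; [:: -130; -2; 130; -2; -2; 132; -2; 130; -137; -130; 131; 2; -132;
  2; -130; -2; -130; -2; -130; -130; 131; 134; 131; 2; 130; 131]; [:: -2; -130; -2; 130; -2;
  -2; 132; -2; 130; -137; -130; 131; 2; -132; 2; -130; -2; -130; -2; -130; 131; 2; 130; 131;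
  131]; [:: 2; 131; 2; 2; -132; 2; 130; 2; 130; 130; 131; -2; -134; -2; -131; -2]; [:: 2;
  -134; -130; -2; 130; -2; -2; 132; -2; 130; -137; -130; 131; 2; -132; 2; 2; 2; 130; 2;
  -134; 2]; [:: 131; -130; 2; 1; 2; 130; -2; 131; 41; 131]; [:: -131; 130; 2; -131; -134;
  130; -2; -2; 132; -2; 130; -137; -130; 131; 2; -132; 2; -130; -2; -2; -131; -2]; [:: 130;
  2; 130; -2; -2; 132; -2; 130; -137; -130; 131; 2; -132; 2; -130; -2; -2; -131; -2; -131;
  -131]; [:: -130; -131; -130; -130; -2; -2; -2; 132; 130; 2; 130; 130; 130; -1; -2; -133;
  -130; 2]; [:: -2; 130; -2; -2; 132; -2; 130; -137; -130; 131; 2; -132; 2; -130; -2; -2;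
  -130; -130; 134; 2; -131]; [:: -130; -2; 130; -2; -2; 132; -2; 130; -137; -130; 131; 2;
  -132; 2; -130; 131; 2; -132; 2; -130; -2; -2; -130; -2; -2; -131; -131; 134; 2; -131]; [::
  2; 130; 2; 2; 131; 2; 2; -132; -130; -2; 130; 131; 130; 130; 130]; [:: -130; 41; -2; -2;
  -2; -2; 132; 130; 2; -131; -130; -131; -130; -133; -131; 2]; [:: -130; 2; 131; 2; 2; -132;
  2; 130; 2; 130; 131; 131; 131; 131; -2]; [:: 131; -134; 130; -2; 130; -2; -2; 132; -2;
  130; -137; -130; 131; 2; -132; 2; -130; -2; -2; -130]; [:: 2; 130; 2; 2; 130; 2; 131; 134;
  -131]; [:: -2; -130; -2; -2; -131; -2; -2; 132; -2; -2; -130; -2; 131; 134; -131]; [::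
  131; 134; -131]; [:: 2; 130; 2; 2; 130; 2; -131; 133; 132]; [:: 131; 133; -131; -134; -2;
  -130; -2; -2; -131; -2; -2; 132; -2; -2; -2; -44]]
  [:: Zm 1 0 0 0 0 1 0 0 0 0 1 0 0 0 0 1; Zm 1 0 0 0 0 1 0 0 (-1) 0 1 0 0 0 0 1; Zm 0 0 1 0
  0 1 0 0 (-1) 0 1 0 0 0 0 1; Zm 1 0 0 0 0 1 0 0 1 0 1 0 0 0 0 1; Zm 0 0 (-1) 0 0 1 0 0 1 0
  1 0 0 0 0 1; Zm (-1) 0 (-2) 0 0 1 0 0 1 0 1 0 0 0 0 1; Zm (-1) 0 (-2) 0 0 1 0 0 0 0 (-1) 0
  0 0 0 1; Zm (-1) 0 2 0 0 1 0 0 (-1) 0 1 0 0 0 0 1; Zm 0 0 (-1) (-1) (-1) 1 (-1) 1 1 0 1 0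
  0 0 0 1; Zm 0 0 (-1) 1 1 1 1 (-1) 1 0 1 0 0 0 0 1; Zm 0 0 1 (-1) 1 1 (-1) 1 (-1) 0 1 0 0 0
  0 1; Zm 0 0 1 1 (-1) 1 1 (-1) (-1) 0 1 0 0 0 0 1; Zm 1 0 0 (-1) (-1) 1 (-1) 1 1 0 1 0 0 0
  0 1; Zm 1 0 0 (-1) (-1) 1 (-1) 1 0 0 1 1 0 0 0 1; Zm 1 0 0 (-1) 1 1 (-1) 1 (-1) 0 1 0 0 0
  0 1; Zm 1 0 0 (-1) 1 1 (-1) 1 0 0 1 (-1) 0 0 0 1; Zm 1 0 0 1 (-1) 1 1 (-1) (-1) 0 1 0 0 0
  0 1; Zm 1 0 0 1 1 1 1 (-1) 1 0 1 0 0 0 0 1; Zm 0 0 (-1) (-1) (-1) 1 (-1) 1 1 0 1 0 1 (-1)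
  1 0; Zm 0 0 (-1) (-1) 0 0 0 1 1 0 1 0 1 (-1) 1 0; Zm 1 0 0 (-1) 0 0 0 1 1 0 1 0 1 (-1) 1
  0; Zm 1 0 0 (-1) 0 0 0 1 0 0 1 1 1 (-1) 1 0; Zm 0 1 0 0 1 (-1) 0 0 0 0 1 1 1 (-1) 1 0; Zm
  0 1 0 0 1 (-1) 0 0 0 0 1 1 0 0 1 0; Zm 0 1 0 0 0 0 (-1) 0 0 0 1 1 1 (-1) 1 0; Zm 0 1 0 0 1
  (-1) 0 0 0 0 1 1 (-1) 1 1 0; Zm 0 1 0 0 0 0 1 0 0 0 1 1 (-1) 1 1 0; Zm 1 0 0 1 0 0 0 (-1)
  0 0 1 1 (-1) 1 1 0; Zm 1 0 0 1 0 0 0 (-1) (-1) 0 1 0 (-1) 1 1 0; Zm 0 0 1 1 0 0 0 (-1)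
  (-1) 0 1 0 (-1) 1 1 0; Zm 0 0 (-1) (-1) 1 (-1) 1 1 1 0 1 0 1 (-1) 1 0; Zm 0 0 1 (-1) 1 1
  (-1) 1 (-1) 0 1 0 (-1) (-1) 1 0; Zm 0 0 1 1 (-1) 1 1 (-1) (-1) 0 1 0 (-1) 1 1 0; Zm 1 0 0
  (-1) (-1) 1 (-1) 1 0 0 1 1 1 (-1) 1 0; Zm 1 0 0 (-1) (-1) 1 (-1) 1 1 0 1 0 1 (-1) 1 0; Zm
  1 0 0 (-1) 1 (-1) 1 1 0 0 1 1 1 (-1) 1 0; Zm 1 0 0 (-1) 1 (-1) 1 1 1 0 1 0 1 (-1) 1 0; Zm
  1 0 0 (-1) 1 1 (-1) 1 (-1) 0 1 0 (-1) (-1) 1 0; Zm 1 0 0 (-1) 1 1 (-1) 1 0 0 1 (-1) (-1)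
  (-1) 1 0; Zm 1 0 0 1 (-1) 1 1 (-1) (-1) 0 1 0 (-1) 1 1 0; Zm 1 0 0 1 (-1) 1 1 (-1) 0 0 1 1
  (-1) 1 1 0; Zm (-1) 0 (-2) (-1) 0 0 0 1 1 0 1 0 1 (-1) 1 0; Zm (-1) 0 (-2) (-1) 0 0 0 1 0
  0 (-1) (-1) 1 (-1) 1 0; Zm (-1) 0 2 1 0 0 0 (-1) (-1) 0 1 0 (-1) 1 1 0; Zm (-1) 0 2 1 0 0
  0 (-1) 0 0 (-1) (-1) (-1) 1 1 0; Zm 0 (-1) 0 0 (-1) 1 (-2) 0 0 0 (-1) (-1) 1 (-1) 1 0; Zm
  0 (-1) 0 0 (-1) 1 (-2) 0 0 0 (-1) (-1) 0 0 (-1) 0; Zm 0 (-1) 0 0 (-1) 1 2 0 0 0 (-1) (-1)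
  (-1) 1 1 0; Zm 1 0 0 (-1) 0 0 0 1 (-1) 0 1 2 1 (-1) 1 0; Zm 0 0 1 1 0 0 0 1 (-1) 0 1 2 1
  (-1) 1 0; Zm 1 0 0 1 0 0 0 (-1) (-2) 0 1 (-1) (-1) 1 1 0; Zm (-1) 0 1 0 0 0 0 (-1) (-2) 0
  1 (-1) (-1) 1 1 0; Zm 0 (-1) 0 0 1 1 0 0 (-2) 0 1 (-1) (-1) 1 1 0; Zm (-1) 0 (-2) (-1)
  (-1) 1 (-1) 1 1 0 1 0 0 0 0 1; Zm (-1) 0 (-2) (-1) (-1) 1 (-1) 1 0 0 (-1) (-1) 0 0 0 1; Zm
  (-1) 0 (-2) 1 1 1 1 (-1) 1 0 1 0 0 0 0 1; Zm (-1) 0 (-2) 1 1 1 1 (-1) 0 0 (-1) 1 0 0 0 1;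
  Zm (-1) 0 2 (-1) 1 1 (-1) 1 (-1) 0 1 0 0 0 0 1; Zm (-1) 0 2 1 (-1) 1 1 (-1) (-1) 0 1 0 0 0
  0 1; Zm (-1) 0 (-2) (-1) (-1) 1 (-1) 1 0 0 (-1) (-1) 1 (-1) 1 0; Zm (-1) 0 (-2) (-1) (-1)
  1 (-1) 1 1 0 1 0 1 (-1) 1 0; Zm (-1) 0 (-2) (-1) 1 (-1) 1 1 0 0 (-1) (-1) 1 (-1) 1 0; Zm
  (-1) 0 (-2) (-1) 1 (-1) 1 1 1 0 1 0 1 (-1) 1 0; Zm (-1) 0 1 0 (-1) 1 1 (-1) (-2) 0 1 (-1)
  (-1) 1 1 0; Zm (-1) 0 1 0 (-1) 1 1 (-1) (-1) 0 0 (-1) (-1) 1 1 0; Zm (-1) 0 1 0 (-1) 1 1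
  (-1) 0 0 (-1) (-1) (-1) 1 1 0; Zm (-1) 0 1 0 1 (-1) (-1) (-1) (-2) 0 1 (-1) (-1) 1 1 0; Zm
  (-1) 0 1 0 1 (-1) (-1) (-1) (-1) 0 0 (-1) (-1) 1 1 0; Zm (-1) 0 1 0 1 (-1) (-1) (-1) 0 0
  (-1) (-1) (-1) 1 1 0; Zm 0 (-1) 0 0 0 2 1 0 (-2) 0 1 (-1) (-1) 1 1 0; Zm 0 (-1) 0 0 2 0
  (-1) 0 (-2) 0 1 (-1) (-1) 1 1 0; Zm 0 0 1 (-1) 1 1 (-1) 1 (-1) 0 1 0 1 1 (-1) 2; Zm 0 0 1
  1 (-1) 1 (-1) 1 (-1) 0 1 2 1 (-1) 1 0; Zm 1 0 0 (-1) (-1) 1 (-1) 1 (-1) 0 1 2 1 (-1) 1 0;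
  Zm (-1) 1 0 1 1 0 (-1) (-1) (-1) 0 1 2 1 (-1) 1 0; Zm 1 0 0 (-1) (-1) 1 (-1) 1 1 0 1 0
  (-1) 1 (-1) 2; Zm 1 0 0 (-1) 1 (-1) 1 1 (-1) 0 1 2 1 (-1) 1 0; Zm 1 0 0 (-1) 1 1 (-1) 1
  (-2) 0 1 1 (-1) (-1) 1 0; Zm (-1) 1 0 1 0 1 (-2) (-1) (-1) 0 1 2 1 (-1) 1 0; Zm (-1) 1 0 1
  2 (-1) 0 (-1) (-1) 0 1 2 1 (-1) 1 0]
  [:: ([:: 0; 2; 7; 5; 3; 4; 6; 1; 12; 17; 57; 58; 53; 13; 10; 15; 11; 55; 34; 20; 41; 21;
  22; 23; 24; 25; 26; 27; 29; 43; 36; 67; 64; 33; 60; 35; 62; 31; 38; 32; 40; 19; 42; 28;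
  44; 45; 46; 47; 49; 78; 51; 69; 77; 8; 54; 9; 56; 14; 16; 59; 18; 61; 30; 70; 39; 65; 52;
  37; 68; 50; 75; 74; 79; 72; 76; 63; 71; 66; 48; 73]%N, [:: 131; 0; 0; 138; 0; 0; 131; 139;
  0; 0; 0; 0; 138; -140; 0; 141; 0; 138; 0; 0; 138; -140; -140; -140; -140; -140; -140;
  -140; 0; 0; 0; 142; 140; -140; 138; -140; 138; 0; 141; 0; -140; 0; -140; 139; -140; -140;
  -140; -140; 0; 143; 0; 144; 145; 0; -140; 0; 141; 139; 139; -140; 0; -140; 0; 146; 147;
  -140; 144; 148; -140; 149; 150; 151; 152; 0; 153; 154; 155; 156; 153; 157]); ([:: 1; 3; 2;
  0; 4; 7; 5; 6; 8; 9; 10; 11; 13; 16; 17; 14; 12; 15; 18; 19; 21; 48; 22; 23; 24; 25; 26;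
  28; 50; 29; 30; 31; 32; 73; 33; 76; 35; 77; 37; 75; 39; 78; 41; 44; 51; 45; 46; 47; 20;
  49; 27; 43; 52; 58; 53; 57; 55; 56; 54; 60; 79; 62; 74; 64; 65; 63; 67; 68; 66; 69; 70;
  71; 72; 34; 61; 40; 36; 38; 42; 59]%N, [:: 0; 158; 131; 0; 131; 159; 0; 160; -140; 141;
  141; -140; 0; -161; -162; 0; -154; 163; -140; -140; 0; 0; 130; 130; 130; 130; 130; 0; 0;
  -140; -140; 141; -140; 0; 0; 0; 0; 0; 0; -154; 0; 164; 0; 0; 165; 130; 130; 130; 166;
  -140; 167; -140; 130; 168; 0; 169; 0; 170; 171; 0; 172; 0; 164; 0; 0; 139; 0; 0; 139; 130;
  130; 141; -140; 166; 173; -161; 166; 166; 173; 174]); ([:: 0; 10; 57; 53; 12; 8; 6; 14;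
  17; 3; 58; 7; 55; 13; 11; 15; 2; 5; 18; 19; 20; 22; 59; 23; 61; 27; 40; 65; 28; 29; 30;
  31; 32; 24; 34; 45; 36; 37; 44; 39; 68; 41; 35; 43; 47; 42; 46; 38; 79; 73; 52; 77; 63; 9;
  54; 4; 56; 16; 1; 21; 60; 33; 62; 50; 64; 25; 75; 67; 26; 66; 51; 48; 76; 74; 49; 69; 78;
  70; 72; 71]%N, [:: 141; 0; 0; 138; 0; 0; -140; 139; 175; 0; 176; 0; 177; 131; 176; 132; 0;
  138; 130; 130; 130; 0; 178; 2; 179; 0; 0; 180; 130; 130; 130; 130; 130; 0; 130; 178; 130;
  130; 181; 130; 182; 130; 183; 130; 0; 0; 2; 184; 0; 157; 0; 145; 185; 175; 186; 0; 131;
  187; 139; 183; 130; 188; 130; 149; 189; 190; 150; 189; 191; 192; 185; 193; 153; 0; 194;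
  154; 195; 156; 194; 196]); ([:: 0; 1; 2; 3; 4; 5; 6; 7; 18; 52; 31; 72; 34; 33; 37; 38;
  73; 77; 70; 19; 20; 21; 23; 25; 24; 22; 26; 27; 28; 29; 9; 71; 11; 40; 75; 15; 17; 76; 35;
  16; 13; 41; 42; 43; 44; 47; 45; 46; 48; 49; 50; 51; 30; 60; 59; 66; 68; 67; 79; 65; 63;
  56; 55; 53; 58; 54; 62; 74; 61; 69; 8; 10; 32; 39; 57; 12; 14; 36; 78; 64]%N, [:: 130;
  130; 130; 130; 130; 130; 130; 130; 0; 197; 0; 161; 0; 0; 0; 0; 161; 162; 198; 2; 2; 2; 0;
  0; 131; 134; 131; 2; 2; 2; 156; 199; 0; 200; 201; 155; 156; 202; 202; 0; 161; 2; 2; 2; 2;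
  203; 0; 160; 2; 2; 2; 2; 204; 0; 0; 205; 206; 142; 207; 208; 209; 156; 156; 210; -140;
  211; 212; 213; 214; 215; 150; 0; 200; 200; -151; 0; 155; 216; 217; 218]); ([:: 0; 1; 2; 3;
  4; 5; 6; 7; 8; 9; 10; 11; 12; 13; 14; 15; 16; 17; 19; 30; 36; 35; 45; 23; 22; 26; 47; 40;
  39; 32; 18; 29; 31; 21; 20; 33; 34; 28; 27; 37; 38; 62; 61; 64; 65; 24; 46; 25; 76; 71;
  75; 63; 69; 53; 54; 55; 56; 57; 58; 42; 41; 59; 60; 66; 67; 68; 51; 43; 44; 70; 52; 72;
  49; 48; 79; 77; 73; 50; 74; 78]%N, [:: 2; 2; 2; 2; 2; 2; 2; 2; 2; 2; 2; 2; 2; 2; 2; 2; 2;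
  2; 0; 0; 0; 0; 178; 131; 0; 0; 179; 0; 0; 0; 195; 156; 219; 0; 0; 195; 195; 156; 156; 219;
  219; 0; 0; 140; 140; 179; 131; 220; 0; 155; -154; 0; 0; 2; 2; 2; 2; 2; 2; 0; 0; 195; 195;
  221; 221; 221; 0; -140; -140; 221; 0; 222; 0; 0; 0; 223; 195; 156; 0; 195])].

Definition step_34_2 := Step
  [:: Zm 1 0 1 0 0 1 0 0 0 0 1 0 0 0 0 1; Zm 1 0 0 2 0 (-1) (-2) 0 0 0 1 0 0 0 0 (-1); Zm 1
  3 1 0 0 1 0 0 0 0 1 0 0 (-9) (-3) 1]
  [:: [:: -42; -130; -2; 1; 1; 1; -130; -66; 130; -1; 130; -1; 2; 63; -69; -130; -131]; [::
  130; 42; -130; 2; 1; 1; -130; -66; -67; 130; -1; -2; 131; -130; -2; -2; -130; 2; 2; 2; 2;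
  2]; [:: -2; -2; 1; 30; -2; -1; 130; 42; -130; 1; -130; 2; -130; -130; -130; 2; -30; 2];
  [:: 2; 2; 1; 30; -2; -1; 130; 42; -130; 1; -130; 2; -130; -130; -130; 2; -30; 2]; [:: -2;
  -2; 1; 1; -130; -66; 130; -1; 132; -1; 130; -42; -130; 1; -132; 130; 130; -2; -2]; [:: 2;
  2; 2; 1; -132; 1; -130; -66; -67; 130; -1; 130; 2; 2]; [:: -131; 2; 2; 30; 1; -130; -66;
  130; -1; -2; -130; 131; -130; 2; -130; -130; -130; -130; 4]; [:: -2; -2; 30; -2; -1; 130;
  42; -130; 1; -130; 2; -130; -130; -130; -130; -130; -130; -130; -131; -130; -130; 132; 3;
  -2]; [:: 2; -131; 2; 2; 2; 30; 1; -130; -66; -67; 130; -1; -2; 131; -130; -130; -130;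
  -130; -130; -130; 3]; [:: -2; -2; 30; -1; 130; 42; -130; 1; -130; 2; -130; -130; -130;
  -130; -130; -130; -130; -130; -131; -130; 132; 3; 2; 2]; [:: -2; -2; -2; -2]; [:: 30; 1;
  -130; -66; -67; 130; -1; -2; 131; -2; -2; -30]; [:: 30; 2; 130; 2; 130; 2; 2; 131; 2; 2;
  -30]; [:: 1; -130; -66; 130; -1; 132; -1; 130; -42; -130; 1; -132; -2; 131; -130; -2]; [::
  -131; -89; 1; -130; -66; 130; -1; 130; 130; 130; 130; 130; -30; 130; 130; 130; 130; 2;
  130; 130; 2]; [:: -2; 132; 75; 1; -130; -66; -67; 130; -1; 130; -2; 130; 130; 130; -30;
  130; -2; -2; 30]; [:: 2; 130; 2; 2; 2; 131; 2; 2]; [:: -1; 3; 1; -130; -66; -67; 130; -1;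
  130; -2; 130; 130; 130; -30; 130; 130; 130; -2; -2; 132]; [:: -1; -41; 2; 30; 1; -130;
  -66; 130; -1; -2; -130; 131; -130; -130; -130; -130; -130; -130; -130; -1; -2; -2; 130; 1;
  7]; [:: 130; 80; 41; 2; -12; -42; -130; 1; 1; 1; -130; -66; 130; -1; 130; -1; 130; 1; 2];
  [:: -69; -130; 7; 30; 1; -130; -66; -67; 130; -1; -2; 131; -130; -130; -130; -130; -130;
  -130; -130; -1; 130]; [:: 2; 2; 1; -130; -1; 2; -131; 30; 1; -130; -66; 130; -1; -2; -1;
  130; 42; 42; -130; 1; -130; -130; 131; -130; -130; 3; -130; 42; -130; -1; -2; -2]; [::
  -130; 1; -130; -1; 2; 2; -131; 30; 1; -130; -66; 130; -1; -2; -1; 130; 42; -130; 1; -130;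
  131; -130; -130; -130; -130; 3; 42; -130; -1; 130]]
  [:: Zm 1 0 0 0 0 1 0 0 0 0 1 0 0 0 0 1; Zm 1 0 0 0 0 1 0 0 0 0 1 0 0 (-1) 0 1; Zm 1 0 0 0
  0 0 0 1 0 0 1 0 0 (-1) 0 1; Zm 1 0 0 0 0 1 0 0 0 0 1 0 0 1 0 1; Zm 1 0 0 0 0 0 0 (-1) 0 0
  1 0 0 1 0 1; Zm 1 0 0 0 0 (-1) 0 (-2) 0 0 1 0 0 1 0 1; Zm 1 0 0 0 0 (-1) 0 (-2) 0 0 1 0 0
  0 0 (-1); Zm 1 0 0 0 0 (-1) 0 2 0 0 1 0 0 (-1) 0 1; Zm 1 0 (-1) (-2) 0 (-1) 2 2 0 0 1 0 0
  0 0 (-1)]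
  [:: ([:: 0; 1; 8; 3; 2; 6; 7; 5; 4]%N, [:: 1; 1; 133; 1; 134; 135; 136; 137; 138]); ([::
  0; 2; 7; 5; 3; 4; 6; 1; 8]%N, [:: 2; 0; 0; 139; 0; 0; 2; 140; 2]); ([:: 1; 3; 2; 0; 4; 7;
  5; 6; 8]%N, [:: 0; 141; 2; 0; 2; 142; 0; 143; 144]); ([:: 0; 1; 2; 3; 4; 5; 6; 7; 8]%N,
  [:: 130; 130; 130; 130; 130; 130; 130; 130; 130]); ([:: 8; 7; 1; 3; 4; 5; 0; 2; 6]%N, [::
  145; 146; 147; 148; 148; 148; 149; 147; 0]); ([:: 0; 1; 2; 3; 4; 5; 6; 7; 8]%N, [:: 150;
  150; 151; 150; 152; 153; 153; 154; 155])].

Definition step_34_3 := Step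
  [:: Zm 1 1 1 0 0 1 0 0 0 0 1 0 0 (-1) (-1) 1]
  [:: [:: 1; 2; 1; -130; -2; -1; -2; -1; -2; 7; -2; -1; -2; 130; 130; -3; -130; 3; -130; 2;
  130; -77]; [:: -90; -15; -130; -2; -1; -2; -1; -2; 7; -2; -1; 30; 130; -30; 130; 2; 1; -2;
  131; 91]; [:: -42; 12; -130; -2; -1; -2; -1; -2; 7; -2; -1; -2; 130; 130; -3; 130; -1;
  130; 130; 130]; [:: 130; -131; -92; -46; 2; 2; -130; 1; 2; -7; -1; -2; 130; 130; 130; -2;
  -130; 2; 2; 2; -42; 130]; [:: -130; -130; 12; -130; -2; -1; -2; -1; -2; 7; -2; -1; 30;
  130; -30; 130; 2; 1; 130; 130]; [:: -42; -130; 1; 1; -130; -2; -1; -2; -1; -2; 7; -2; -1;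
  30; 130; -30; 130; 2; -130; -130; -130]; [:: 130; 1; -69; -130; -131; -2; 99; 131; -100;
  130; -1; 130; -1; 130; -1; 130; 1; -2; 44; 130]; [:: 130; 1; -130; 1; 2; 4; 1; 2; 1; 130;
  130; 7; -130; -7; 130; 2; 131; 130; 130; 13]; [:: 130; 1; -42; 12; -130; -2; -1; -2; -1;
  -2; 7; -2; -1; -2; 130; 130; -3; 130; -1; 130; 130; -1]; [:: -130; 12; -130; -2; -1; -2;
  -1; -2; 7; -2; -1; 30; 130; -30; 130; 2; 1; 42]; [:: 12; -130; -2; -1; -2; -1; -2; 7; -2;
  -1; -2; 130; 130; -3; 130; -1; 130; 1; 130]; [:: 66; 1; -130; -2; -1; -2; -1; -2; 7; -2;
  -1; 30; 130; -30; 130; 2; 13; -130]; [:: 1; -42; 12; -130; -2; -1; -2; -1; -2; 7; -2; -1;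
  -2; 130; 130; -3; 130; -1; 130; 130; 130]; [:: 66; 130; -1; 130; 130; -42]; [:: 42; 42;
  -130; -2; -1; -2; -1; -2; 7; -2; -1; 30; 130; -30; 130; 2; 1; 42; 42]; [:: -130; -130; 93;
  1; -130; -130]; [:: 130; 13; -60; -130; -130; -2; 130; 130; -1; -2; -130; -67]; [:: -130;
  -130; -2; -1; -2; -1; -2; 7; -2; -1; 30; 130; -30; 130; 2; -130; -42; 12]; [:: -42; -1;
  -130; -130; 1; -130; -2; -1; -2; -1; -2; 7; -2; -1; 30; 130; 130; 2; -130; -130; -130;
  -12; 42; -130; 93]; [:: 130; -13; 130; 130; -1; 130; -42; 12]; [:: -130; 1; 1; -131; 2; 2;
  2; 131; -130; -1; -130]; [:: 130; 130; 130; 2; -1; -2; -1; -2; -1; -2; 7; -2; -1; -2; 130;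
  130; -3; -130; -130; 2; 2; 130; -2; 102; 94]; [:: 42; 1; -130; 2; 130; -1; -42]; [:: 1; 2;
  4; 1; 2; 1; 130; 130; 7; -130; -130; 2; 130; -2; -2; -2; -2; -2; 63; -130]; [:: 44; 63;
  -2; -130; 30; 130; 2; -130; 30; 130; -30; 130; 2; -130; -2; -63; -44]; [:: -42; -42; -2;
  -130; 30; 130; 2; -130; 30; 130; -30; -30; 130; 2; -130; -2; 130; 42; 42]; [:: -130; -2;
  -1; -2; -1; -2; 7; -2; -1; -2; -130; -130; -130; -30; 130; 130; -3; -130; -130; 2; 130;
  -2; -2; 30]; [:: 42; 42; -130; 1; 1; -130]; [:: 130; 1; -60; -2; -130; -2; -2; -130; -30;
  130; 130; -2; 130; 1; 130]; [:: -130; 1; -130; -2; -1; -2; -1; -2; 7; -2; -1; 30; 130;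
  -30; 130; 2; 130; 130; 130; 130; -1; 130]; [:: 130; 130; -1; -1; 130; 42; 42; 130]; [::
  130; -1; 130; -1; 130; -69; 2; 2; 2; 69]; [:: -130; 12; 12; 42; -130; -2; -1; -2; -1; -2;
  7; -2; -1; 30; 130; -30; 130; 2; -130]; [:: 101; -130; -130; -2; -1; -2; -1; -2; 7; -2;
  -1; 30; 130; 2; -130; -30; 130; -30; 130; 2; -130; -130; -130; 2; 130; 94; 94]; [:: 2;
  130; 2; 2; 130; 2]; [:: -1; -2; -2; 1; -66; -3; -67; -3]; [:: -42; -42; -42; -2; -130; 2;
  -130; -30; 130; 130; 2; -130; -130; -54; 130; -42]; [:: -130; -1; 132; 1; 130]; [:: -130;
  -3; 1; -130; 2; 2; 2; -130; -98; 131; -65; 2; -130; -2; 130]; [:: 130; 1; -130; 132; 130;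
  -1; -130]; [:: -130; 12; 88; 130; 1; -130; 2; 2; 2; 2; 130; -1]; [:: 41; -2; -2; -2; -2;
  130; 2; 2; 130; 131; 1; -130; -2; -1; -2; -1; -2; 7; -2; -1; 130; -2; -2; -2; -2; -2; 39;
  130; 2; 2; 130; -41]; [:: -2; -2; -130; -30; 130; 2; -130; -130; -2; 130; -3; 130; 130];
  [:: -130; -2; -1; -2; -1; -2; 7; -2; -1; 130; -2; 130; 130; -3; 130; 130; 130]; [:: 12; 1;
  -130; 1; -130; 1; -130; -1; -66]; [:: -130; 12; -130; -2; -1; -2; -1; -2; 7; -2; -1; 30;
  130; -30; 130; 2; 1; 1; 130]; [:: 130; 1; 1; -130; -2; -1; -2; -1; -2; 7; -2; -1; 30; 130;
  -30; 130; 2; 13; -130]; [:: 130; 1; -2; -1; -2; -1; -2; 7; -2; -1; 130; 2; -130; 1; -130;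
  2; -93; 130; 130]; [:: -94; -96; 2; -131; -130; 1; 2; 4; 1; 2; 1; 130; 2; -7; 130; -2; -2;
  -130; 2; -97]; [:: -130; -1; 130; -12; -2; -1; -2; -1; -2; 7; -2; -1; 130; 2; -130; 1;
  -130; 2]; [:: -130; -42; 1; -130; 1; -130; 1; -130; -130; 1; 130; 12; 130]; [:: 130; -1;
  -1; 130; 12]; [:: 42; 42; 12]]
  [:: Zm 1 0 0 0 0 1 0 0 0 0 1 0 0 0 0 1; Zm 1 0 (-1) 0 0 1 0 0 0 0 1 0 0 0 0 1; Zm 1 0 1 0
  0 1 0 0 0 0 1 0 0 0 0 1; Zm 1 0 (-2) 0 0 1 0 0 0 0 1 0 0 0 0 1; Zm 1 0 2 0 0 1 0 0 0 0 1 0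
  0 0 0 1; Zm 1 0 (-3) 0 0 1 0 0 0 0 1 0 0 0 0 1; Zm 1 0 3 0 0 1 0 0 0 0 1 0 0 0 0 1; Zm 1 0
  (-4) 0 0 1 0 0 0 0 1 0 0 0 0 1; Zm 1 0 4 0 0 1 0 0 0 0 1 0 0 0 0 1; Zm 1 1 (-1) 0 0 1 0 0
  3 3 (-2) 0 0 (-4) (-1) 1; Zm 1 (-1) 1 0 0 1 0 0 (-3) 0 (-2) 0 (-3) 4 (-2) 1; Zm (-2) (-2)
  1 0 0 1 0 0 3 3 (-2) 0 0 (-4) (-1) 1; Zm (-2) (-1) (-1) 0 0 1 0 0 (-3) 0 (-2) 0 (-3) 4
  (-2) 1; Zm 1 1 1 0 0 1 0 0 3 3 4 0 0 (-4) (-1) 1; Zm 1 1 (-2) 0 0 1 0 0 3 3 (-5) 0 0 (-4)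
  (-1) 1; Zm (-2) (-2) (-3) 0 0 1 0 0 3 3 4 0 0 (-4) (-1) 1; Zm 4 (-1) 3 0 0 1 0 0 (-3) 0
  (-2) 0 (-3) 4 (-2) 1; Zm 1 (-1) (-1) 0 0 1 0 0 (-3) 0 4 0 (-3) 4 4 1; Zm (-5) (-1) (-3) 0
  0 1 0 0 (-3) 0 (-2) 0 (-3) 4 (-2) 1; Zm (-2) (-2) 3 0 0 1 0 0 3 3 (-5) 0 0 (-4) (-1) 1; Zm
  (-2) (-1) 3 0 0 1 0 0 (-3) 0 4 0 (-3) 4 4 1; Zm 1 (-1) 2 0 0 1 0 0 (-3) 0 (-5) 0 (-3) 4
  (-5) 1; Zm 1 2 1 0 0 1 0 0 (-3) 0 (-2) 0 6 (-5) 4 1; Zm (-5) (-5) 3 0 0 1 0 0 3 3 (-2) 0 0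
  (-4) (-1) 1; Zm (-2) 2 (-1) 0 0 1 0 0 (-3) 0 (-2) 0 6 (-5) 4 1; Zm (-5) (-1) 7 0 0 1 0 0
  (-3) 0 4 0 (-3) 4 4 1; Zm 4 4 (-7) 0 0 1 0 0 3 3 (-5) 0 0 (-4) (-1) 1]
  [:: ([:: 0; 9; 13; 14; 12; 5; 6; 24; 25; 17; 2; 3; 21; 10; 11; 20; 23; 1; 16; 15; 19; 4;
  8; 18; 26; 22; 7]%N, [:: 1; 0; 0; 0; 133; 134; 135; 136; 137; 138; 0; 139; 140; 141; 142;
  143; 144; 0; 145; 146; 147; 0; 148; 149; 150; 151; 152]); ([:: 0; 1; 2; 3; 4; 5; 6; 7; 8;
  9; 10; 11; 12; 13; 14; 15; 16; 17; 18; 19; 20; 21; 22; 23; 24; 25; 26]%N, [:: 2; 2; 2; 2;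
  2; 2; 2; 2; 2; 3; 153; 3; 153; 3; 3; 3; 153; 154; 153; 3; 154; 155; 156; 3; 156; 154; 3]);
  ([:: 2; 0; 4; 1; 6; 3; 8; 5; 7; 16; 12; 9; 18; 17; 26; 13; 10; 20; 22; 14; 25; 19; 24; 11;
  23; 21; 15]%N, [:: 0; 0; 0; 0; 0; 0; 0; 0; 157; 158; 0; 0; 0; 159; 0; 0; 0; 0; 160; 0; 0;
  161; 0; 0; 162; 163; 164]); ([:: 0; 1; 2; 3; 4; 5; 6; 7; 8; 9; 10; 11; 12; 13; 14; 15; 16;
  17; 18; 19; 20; 21; 22; 23; 24; 25; 26]%N, [:: 165; 165; 165; 165; 165; 165; 165; 165;
  165; 166; 167; 166; 167; 168; 169; 168; 167; 170; 167; 169; 170; 171; 172; 166; 172; 170;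
  169]); ([:: 8; 6; 7; 4; 5; 2; 3; 0; 1; 18; 24; 12; 23; 21; 17; 25; 22; 19; 11; 13; 14; 15;
  9; 10; 16; 26; 20]%N, [:: 173; 173; 174; 173; 174; 173; 174; 173; 174; 175; 0; 175; 162;
  176; 177; 178; 0; 179; 162; 180; 179; 181; 182; 175; 183; 179; 177])].

Definition step_34_4 := Step
  [:: Zm 1 2 2 0 0 1 0 0 0 0 1 0 0 (-2) (-2) 1]
  [:: [:: -103; -1; -2; -1; -2; -130]; [:: -16; -1; -2; -16; -1; -2; -2; 7; -1; -30; -130;
  -30; -130; 2; -30; -130; 30; 130; 2; -130; -130; 1; 2; 44; -130; -5]; [:: 130; 2; 7; 130;
  -2; -1; -2; -5]; [:: 2; -6; 1; 2; 130; -2; 41; -130; 2; 12; 2; 2; -30]; [:: -103; 99; -54;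
  1; 2; 130; 2; 130; 130; -2]; [:: 130; -80; 130; 2; 130; 2; 2; 2; 130; 7; -130; 2]; [::
  130; 2; 130; -2; -130]; [:: -130; 30; 130; -30; 130]; [:: -130; -2; -1; -2; -130; 30; 130;
  -42; 2; 57; 1; -130; -2; 130; -2; -67]; [:: -2; -30; 130; 2; 130; -2; -2; -2; -130; 2; 2;
  2; 30]; [:: -8; -130; 30; 130; -30; 130; 8]; [:: -46; 30; 130; 2; -130; -30; 46]; [:: 130;
  2; -130; 7; 130; -2; -130]]
  [:: Zm 1 0 0 0 0 1 0 0 0 0 1 0 0 0 0 1; Zm 1 (-1) (-1) 0 0 1 0 0 0 0 1 0 0 1 1 1; Zm 1
  (-1) (-1) 0 0 0 (-1) (-1) 0 0 1 0 0 1 1 1; Zm 1 0 (-1) 0 0 1 0 0 3 0 (-2) 0 0 (-3) 0 1; Zm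
  1 0 (-1) 0 0 (-2) 0 1 3 0 (-2) 0 0 (-3) 0 1; Zm 4 (-2) (-3) 1 0 (-2) 0 1 3 0 (-2) 0 (-3)
  (-1) 2 0; Zm 1 (-1) (-2) (-1) 0 0 (-1) (-1) 3 (-3) (-5) (-3) 0 1 4 5; Zm 1 (-1) (-2) (-1)
  0 1 3 4 3 (-3) (-5) (-3) 0 1 4 5; Zm (-2) 1 0 (-2) 0 1 3 4 3 (-3) (-5) (-3) 3 (-1) 2 6; Zm
  1 (-2) (-1) 0 0 1 0 0 (-3) 3 4 0 (-3) 8 5 1]
  [:: ([:: 0; 3; 6; 8; 5; 2; 4; 7; 9; 1]%N, [:: 1; 0; 0; 131; 132; 133; 134; 135; 136; 0]);
  ([:: 0; 2; 1; 4; 3; 5; 7; 6; 8; 9]%N, [:: 2; 137; 0; 0; 138; 139; 0; 140; 103; 121]); ([::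
  1; 0; 2; 3; 5; 4; 6; 8; 7; 9]%N, [:: 130; 0; 2; 139; 0; 141; 142; 141; 0; 143])].

Definition step_34_5 := Step
  [::]
  [:: [:: 105; 2; 2; 2; 105; 2; 2; 105; 103; 1; 2; 2; 2; -7; 2; 2; 2; 2; -63; -7; 2; 2; 2;
  2; 57; 57; 57; 111; 3; -75; 2]; [:: 38; 40; 53; -30; 40; 2; 1; 7; 1; 2; 2; 2; 2; 2; 2; 2;
  -7; -63; -1; -6; 15; 15; 15; 15; 2; 2; 123; -2; -2; 75; -18; 2]; [:: -1; -2; -1; -7; -1;
  -2; -16]; [:: -71; 30; 2; -16; -8; -30; 115; 1; -42; 12; 1; 2; -1; 15; -71]; [:: -2; 106;
  1; -2; -2; -2; 7; -2; -2; 63; -2; -2; 7; -2; -2; -2; 1; 2; 2; 1; 3; 111]; [:: 2; 54; -1;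
  -40; -112; 1; 2; -4; 2; -7; -1; 2; 41; 12; -63; 2; 1; 80; -1; -44; 1; -80; 2; -7; -1; 7;
  -2; -1; -2; -1; -4; -2; -1; 38; 2; 113; 114; 114; -30]; [:: 5; 30; -93; 41; 3; 41; -1; -2;
  16; -1; 2; -7; -1; 55; -1; -3; -30]; [:: 1; -2; -2; 7; -1; -40; -63; 2; 12; -3; 75; -3;
  -2; 30; 75; -3; 75; 3; 5; 7; 1; 2; -116; -86; -7; -74]; [:: 30; -5; 16; -1; 2; 2; 2; 2; 2;
  -7; -63; 2; 2; 2; 2; 2; 2; -7; 1; 1; 3; -7; -5]; [:: -71; 30; 75; -67; -4; 1; 2; 2; 2; -7;
  2; 2; 2; 2; -63; -7; 2; 2; 2; 2; -1; -2; 38; -30; 8; 16]; [:: -71; 30; -2; -2; -2; -37;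
  -129; -108; 2; 2; 2; 2; 2; 2; 2; 30; 30; 30; -5]; [:: 1; -2; -2; -2; 7; -2; -2; 63; -2;
  -2; -7; -1; -40; -15; -2; -38]; [:: 1; 2; -4; 2; -7; -1; 2; 41; 12; -63]; [:: -71; 30; 1;
  -2; -2; -2; 7; -2; -2; 63; -2; -2; -7; -1; -40; -15; -2; -38; -30; 71]; [:: 2; 2; 2; 2; 2;
  2; 2; 2; 30; 30; -105; 2; 2; 2; 2; 2; 2; 2; 2; 2; 2; 2; 2; 30; 30; 30; -75; 3; 30; -2; 30;
  38; -2; 71]; [:: 1; -2; -2; -2; 7; -2; -2; 63; -2; -2; 7; -2; -2; -7; -1; -40; 39; 1; 2;
  2; -7; -1; -15; -2; -38; -2]; [:: 68; -30; 1; 2; -4; 2; -7; -1; 2; 41; 12; -63; 2; 1; 80;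
  -1; -44; 1; -80; -1; 30; -68]; [:: 1; -2; -2; -2; 7; -2; -2; 63; -2; -2; 7; -2; -2; -2;
  -2; 16; -2; 7; -1; -2]; [:: 1; -2; -2; -2; 7; -2; -2; 63; -2; -2; 7; -2; -2; -2; -2; 16;
  -2; 7; -1; -2; -75; 2]; [:: 1; -2; -2; -2; 7; -2; -2; 63; -2; -2; 7; -2; -2; -2; -2; 16;
  -2; 7; -1; -2; 3; -30; 1; 39; 40; -15; -2; 7; -1; -2; -1; -2; -2; 7; -2; -1; -1; -12; 42;
  -1; -1; -38]; [:: 126; -99; 128; 1; 2; 2; 2; -7; 2; 2; 2; 2; -63; -7; 2; 2; 2; 2; 57; 2;
  -7; -3; 53; -77]; [:: 38; 1; 1; -42; 12; 1; 1; 2; -7; 2; 2; 1; 2; 1; -7; 2; 15; -40; -39;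
  -1]; [:: -71; 1; -2; -2; -2; 7; -2; -2; 63; -2; -2; 7; -2; -2; -2; -2; 16; -2; 7; -1; -2;
  75; -2; 71]; [:: 68; 117; 99; 2; 1; 2; -4; 2; -7; -1; 2; 41; 12; -63; 1; 2; 4; -7; -1; 7;
  -2; -1; -2; -1; -4; -2; -1; 38; 2; -15; 40; -15; 4; 4; 110]; [:: 1; -2; -2; -2; 7; -2; -2;
  63; -2; -2; 7; -2; -2; -2; -2; 16; -2; 7; -1; -2; 3; -30]; [:: 2; -1; -2; -1; -7; -1; -40;
  15; -39; -2; 75; -39; -75; 2; 1; 1; 63; -2; -2; -2]; [:: -16; 1; -2; -2; -2; 7; -2; -2;
  63; -2; -2; 7; -2; -2; -2; -2; 16; -2; 7; -1; -2; -75; 2; -4; 30; 16]; [:: 118; 100; 76;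
  119; 77; -2; 1; -2; -2; 7; -1; -40; -63; 2; 12; -3; -1; -2; -1; -2; -1; -41; 18; 39; 74]]
  [:: Zm 1 0 0 0 0 1 0 0 0 0 1 0 0 0 0 1; Zm 1 (-2) (-2) 0 0 1 0 0 0 0 1 0 0 2 2 1; Zm 1
  (-2) (-2) 0 0 (-1) (-2) (-1) 0 0 1 0 0 2 2 1; Zm 1 0 0 2 0 (-1) (-2) (-1) 0 0 1 0 0 0 0
  (-1); Zm 1 (-1) (-2) 0 0 1 0 0 3 (-3) (-5) 0 0 (-2) 1 1; Zm 1 (-1) (-2) 0 0 (-1) 1 1 3
  (-3) (-5) 0 0 (-2) 1 1; Zm 1 0 (-3) (-1) 0 (-1) 1 1 0 0 1 0 0 (-6) 6 5; Zm 1 (-1) 0 1 0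
  (-1) (-2) (-1) (-3) 6 7 0 (-3) 4 1 (-3); Zm 1 0 (-3) (-1) 0 5 (-5) (-4) 0 0 1 0 0 (-6) 6
  5; Zm 1 0 (-2) 0 0 1 0 0 6 (-3) (-11) 0 (-3) (-3) 6 1; Zm 1 (-10) 5 7 0 5 (-5) (-4) 0 0 1
  0 0 4 (-2) (-3); Zm 1 (-10) 5 7 0 1 (-3) (-1) 0 0 1 0 0 4 (-2) (-3); Zm 1 (-8) 1 5 0 1
  (-3) (-1) 0 0 1 0 0 2 2 (-1); Zm 1 (-8) 1 5 0 3 (-1) (-2) 0 0 1 0 0 2 2 (-1); Zm (-5) 9 10
  (-1) 0 (-1) (-2) (-1) (-3) 6 7 0 3 (-6) (-9) (-1); Zm (-5) 9 10 (-1) (-3) 5 7 0 (-3) 6 7 0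
  3 (-6) (-9) (-1)]
  [:: ([:: 0; 4; 6; 1; 9; 7; 5; 2; 8; 3; 14; 15; 13; 10; 12; 11]%N, [:: 1; 0; 130; 131; 0;
  132; 0; 0; 133; 134; 135; 136; 137; 138; 139; 140]); ([:: 0; 2; 1; 3; 5; 4; 8; 7; 6; 9;
  11; 10; 13; 12; 15; 14]%N, [:: 2; 141; 0; 2; 0; 142; 143; 16; 0; 77; 144; 0; 0; 145; 146;
  0]); ([:: 1; 0; 3; 2; 6; 13; 4; 14; 10; 15; 8; 12; 11; 5; 7; 9]%N, [:: 147; 0; 148; 0;
  149; 150; 151; 0; 152; 153; 0; 0; 154; 155; 156; 157])].

(** After the first two steps, which reach the preimage of the image of [G]
    modulo 2, all indices are 2. From the thirteenth step on the new generators
    are powers of transvections, and shears, with small entries. The bulk of the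
    library serves to reach unipotent elements of [G] with small entries but no
    short word, such as the transvections along [e_1], [e_3] and [e_4] with
    exponents 4, 32 and 64. They come from the stabiliser of [e_4] in
    [G]: closed paths in the graph of the orbit of [e_4] give elements of this
    stabiliser, which combine into elements whose image in [SL_2(Z)] is trivial
    or unipotent. *)
Definition lib_44 : seq (seq Z) :=
  [:: [:: -1; 2; 1]; [:: 1; 2; -1]; [:: 2; 4; -2]; [:: 3; 5; -3]; [:: 1; 6; -1]; [:: 1; 7;
  -1]; [:: -1; 3; 1]; [:: -3; 9; 3]; [:: -2; 10; 2]; [:: 1; 5; -1]; [:: 3; 5; 2; 8; 11; 2;
  12; 4]; [:: 13; 1]; [:: 14; 1]; [:: -1; 11; 1]; [:: -1; 16; 1]; [:: -3; 17; 3]; [:: -2;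
  18; 2]; [:: -1; 19; 1]; [:: -2; -10; -1; 20; 16]; [:: 21; -1]; [:: 15; -22]; [:: -1; 17;
  1]; [:: -1; 24; 1]; [:: -1; 25; 1]; [:: 2; 26; -2]; [:: -1; 27; 1]; [:: -8; 28; 8]; [::
  11; 29; -11]; [:: -4; 30; 4]; [:: -1; 31; 1]; [:: -4; 32; 4]; [:: 11; 33; -11]; [:: -1;
  34; 1]; [:: -3; 35; 3]; [:: -2; 36; 2]; [:: -1; 32; 1]; [:: -1; 38; 1]; [:: -1; 39; 1];
  [:: 16; 40; -16]; [:: 2; 41; -2]; [:: 4; 19; -4]; [:: -1; 43; 1]; [:: 37; 44; -37]; [::
  26; 45; -26]; [:: -16; 46; 16]; [:: -4; 47; 4]; [:: -1; 48; 1]; [:: -3; 49; 3]; [:: 1; 43;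
  -1]; [:: -11; 51; 11]; [:: -2; 52; 2]; [:: 3; 53; -3]; [:: -1; 54; 1]; [:: 11; 27; -11];
  [:: -8; 56; 8]; [:: 2; 57; -2]; [:: 1; 58; -1]; [:: 59; 55; -59]; [:: -3; 60; 3]; [:: -2;
  61; 2]; [:: -37; 62; 37]; [:: -37; 42; -50; 63]; [:: 64; -1]; [:: 23; -65]; [:: -66; -1];
  [:: -1; 37; 1]; [:: -37; 68; 37]; [:: 1; 37; -1]; [:: -70; 69; 70]; [:: -1; 71; 1]; [::
  -1; 72; 1]; [:: -1; 73; 1]; [:: -1; 74; 1]; [:: -1; 75; 1]; [:: 16; 76; -16]; [:: -11; 77;
  11]; [:: 7; 78; -7]; [:: -1; 79; 1]; [:: -7; 80; 7]; [:: -4; 81; 4]; [:: 37; 82; -37]; [::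
  -16; 83; 16]; [:: 2; 84; -2]; [:: 85; -4; 1; -42; 37]; [:: -67; -86]; [:: -1; 20; 1]; [::
  2; 88; -2]; [:: -1; 89; 1]; [:: 1; 59; -1]; [:: -2; 91; 2]; [:: 1; 92; -1]; [:: -90; 3;
  -1; 93; -7]; [:: -87; -94]; [:: -1; -94]; [:: 95; -96]; [:: -97; -1]; [:: 2; 39; -2]; [::
  3; 40; -3]; [:: -1; 100; 1]; [:: -7; 101; 7]; [:: 3; -5; 99; -102]; [:: -1; 36; 1]; [::
  -1; 104; 1]; [:: 7; 105; -7]; [:: 3; 5; -8; 1; -106]; [:: 103; -107]; [:: -98; 108]; [::
  -1; 85; 1]; [:: 16; 110; -16]; [:: 7; -93; 111; -106]; [:: 112; -107]; [:: -1; -107]; [::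
  113; -114]; [:: 109; -115]; [:: -116; 1]; [:: -59; 4; 85; 4; 4; 4; 1; 2; 2; 12; 4]; [::
  118; 116]; [:: 119; 117]; [:: 120; 116]; [:: 121; 117]; [:: 122; 116]; [:: 123; 115]; [::
  124; -108]; [:: 125; 96]; [:: 1; 84; -1]; [:: 37; 127; -37]; [:: -59; 128; 59]; [:: 3;
  129; -3]; [:: -1; 90; 1]; [:: -1; 131; 1]; [:: -2; 102; 2]; [:: 4; 133; -4]; [:: -1; 134;
  1]; [:: -44; 135; 44]; [:: -2; 104; 2]; [:: -1; 137; 1]; [:: -138; 136; 138]; [:: -3; 139;
  3]; [:: 1; 140; -1]; [:: 1; 141; -1]; [:: 1; 142; -1]; [:: 59; 143; -59]; [:: 2; 144; -2];
  [:: 1; 145; -1]; [:: 1; 146; -1]; [:: 16; 147; -16]; [:: 1; 148; -1]; [:: -2; 100; 2]; [::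
  37; 150; -37]; [:: 26; 151; -26]; [:: 44; 152; -44]; [:: 1; 153; -1]; [:: 1; 154; -1]; [::
  1; 155; -1]; [:: -3; 79; 3]; [:: 2; -130; 132; 131; -149; -156; 157; -2]; [:: 117; -158];
  [:: -159; -94]; [:: 86; -158]; [:: -160; -161]; [:: 126; 162]; [:: 95; 162]; [:: 163;
  -164]; [:: -2; 59; 2]; [:: -26; -166; 12; 4]; [:: 167; 116]; [:: 168; 117]; [:: 169; 116];
  [:: 170; 117]; [:: 171; 116]; [:: 172; 115]; [:: 173; 114]; [:: -1; -117]; [:: -116;
  -107]; [:: 175; 176]; [:: -16; -111; 146; 39]; [:: 178; 116]; [:: 179; 176]; [:: 180;
  -114]; [:: -109; 1]; [:: -182; -1]; [:: -11; 19; 11]; [:: 1; 156; -1]; [:: -90; 185; 90];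
  [:: 1; 8; -1]; [:: 1; 187; -1]; [:: 188; 186; -188]; [:: 59; 189; -59]; [:: -1; 190; 1];
  [:: 16; 191; -16]; [:: 184; -36; -11; 1; 192]; [:: 183; -193]; [:: 194; -98]; [:: -2; 3;
  2]; [:: 16; 93; -16]; [:: -3; 197; 3]; [:: -2; 198; 2]; [:: 2; 196; 199; -12; -12; -85];
  [:: 200; -158]; [:: 201; -161]; [:: -195; 202]; [:: 162; -203]; [:: -204; -193]; [:: 205;
  -98]; [:: 204; -206]; [:: -207; 1]; [:: 181; -208]; [:: 209; 206]; [:: 210; 203]; [:: 1;
  -158]; [:: 212; -161]; [:: 211; -213]; [:: -177; 214]; [:: -1; -215]; [:: -85; -199; 70;
  72]; [:: 217; -117]; [:: 218; -116]; [:: 219; -117]; [:: 220; 176]; [:: -109; -22]; [:: 1;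
  63; -1]; [:: 1; 223; -1]; [:: 1; 224; -1]; [:: 1; 225; -1]; [:: -89; -137; 226; -43; 111;
  16]; [:: 227; -22]; [:: 222; -228]; [:: 221; 229]; [:: -216; 230]; [:: -231; -176]; [::
  232; 115]; [:: 233; 229]; [:: -234; -107]; [:: 174; -235]; [:: 165; 236]; [:: 237; 235];
  [:: 238; -114]; [:: 239; -115]; [:: 240; 117]; [:: 241; 116]; [:: -117; -242]; [:: -2; 8;
  2]; [:: -4; 77; 4]; [:: -1; 245; 1]; [:: -2; 246; 2]; [:: -59; 247; 59]; [:: -188; 248;
  188]; [:: -1; 249; 1]; [:: -90; 250; 90]; [:: -1; 251; 1]; [:: -85; 99; -244; 252]; [::
  253; -1]; [:: 254; -65]; [:: -255; -255]; [:: 256; 256]; [:: 257; 257]; [:: 258; 258]; [::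
  259; 259]; [:: 260; 260]; [:: 243; 261]; [:: -11; 133; 11]; [:: 1; 70; -1]; [:: 1; 264;
  -1]; [:: 263; 265; -71; -1; -130]; [:: 266; 107]; [:: -256; -258; 260]; [:: -267; 268];
  [:: -1; 88; 1]; [:: -2; 270; 2]; [:: -2; 271; 2]; [:: -11; 272; 11]; [:: 273; -20; -8; 1;
  106]; [:: 274; -193]; [:: -255; 257; -259]; [:: -275; 276]; [:: -274; 193]; [:: 255;
  -257]; [:: -278; 279]; [:: -280; -280]; [:: 277; 281]; [:: -282; -282]; [:: 283; 283]; [::
  284; 284]; [:: 285; 285]; [:: 286; 286]; [:: -282; -284; 287]; [:: 269; 288]; [:: 2; -12;
  199; -59]; [:: -290; 94]; [:: -1; -291]; [:: 255; -257; -259]; [:: 292; 293]; [:: -283;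
  -286]; [:: 294; 295]; [:: -282; -285]; [:: 280; 297]; [:: -298; -298; -298]; [:: 296;
  299]; [:: -300; -300]; [:: 301; 301]; [:: 302; 302]; [:: 301; 303]; [:: 298; 304]; [::
  -305; -305]; [:: 306; 306]; [:: 307; 307]; [:: -306; 308]; [:: 300; 309]; [:: 310; 310;
  310; 310]; [:: 305; 311]; [:: -312; -312]; [:: 313; 313]; [:: -312; 314]; [:: 310; 315];
  [:: -289; -289; -289; -289]; [:: 282; 317]; [:: 316; 316]; [:: 319; 319]; [:: 320; 320];
  [:: 321; 321]; [:: 322; 322]; [:: 323; 323]; [:: 324; 324]; [:: 325; 325]; [:: 326; 326];
  [:: 327; 327]; [:: 328; 328]; [:: 329; 329]; [:: 330; 330]; [:: 331; 331]; [:: 332; 332];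
  [:: 333; 333]; [:: 322; 324; 326; 328; -330; 334]; [:: 318; 335]; [:: 316; -336]; [:: 336;
  336]; [:: 338; 338]; [:: 339; 339]; [:: 340; 340]; [:: 341; 341]; [:: 342; 342]; [:: 343;
  343]; [:: 344; 344]; [:: 345; 345]; [:: 346; 346]; [:: 347; 347]; [:: 348; 348]; [:: 349;
  349]; [:: 350; 350]; [:: 351; 351]; [:: -289; -339; -342; -345; -347; -350; 352]; [::
  -353; -353]; [:: 354; 354]; [:: 355; 355]; [:: 356; 356]; [:: 357; 357]; [:: 358; 358];
  [:: 359; 359]; [:: 360; 360]; [:: -352; -352]; [:: -262; 356; -358; 361; 338; -340; -343;
  -345; -347; 350; 362]; [:: -182; 114]; [:: 364; 114]; [:: 365; -176]; [:: -2; -36; -12;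
  -130; -2; -2; -2; -2]; [:: 367; 158]; [:: -366; 368]; [:: -369; -116]; [:: -363; -363];
  [:: 371; 371]; [:: 372; 372]; [:: 373; 373]; [:: 374; 374]; [:: 375; 375]; [:: 376; 376];
  [:: 377; 377]; [:: 378; 378]; [:: 379; 379]; [:: 380; 380]; [:: -361; -361]; [:: 382;
  382]; [:: 383; 383]; [:: -362; -362]; [:: 385; 385]; [:: 386; 386]; [:: 387; 387]; [::
  388; 388]; [:: 389; 389]; [:: 390; 390]; [:: 370; 363; -377; 381; -353; 358; -361; 384;
  342; -345; -348; -350; 352; 386; 391]; [:: 1; 1]; [:: 393; 393]; [:: 394; 394]; [:: -395;
  363; -373; -353; 355; -338; -342; 344]; [:: -227; 235]; [:: 397; -176]; [:: 398; -116];
  [:: 381; 381]; [:: 400; 400]; [:: 384; 384]; [:: 402; 402]; [:: 391; 391]; [:: 404; 404];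
  [:: 405; 405]; [:: 406; 406]; [:: 399; -363; -374; 379; -381; 401; 353; -360; 382; -384;
  403; 337; -339; -341; 344; 347; 350; -362; -386; -389; -391; -405; 407]; [:: 16; 105;
  -16]; [:: -1; 263; 1]; [:: -410; 409; 410]; [:: -1; 411; 1]; [:: -1; 412; 1]; [:: 2; 413;
  -2]; [:: 2; 414; -2]; [:: 4; 415; -4]; [:: 188; 416; -188]; [:: 1; 46; -1]; [:: 3; 418;
  -3]; [:: 90; 419; -90]; [:: -1; 420; 1]; [:: -1; 421; 1]; [:: 16; 422; -16]; [:: -1; 423;
  1]; [:: -1; 424; 1]; [:: -1; 81; 1]; [:: 1; 157; -1]; [:: 1; 427; -1]; [:: 1; 428; -1];
  [:: 4; 429; -4]; [:: -2; 430; 2]; [:: 1; 431; -1]; [:: -1; 273; 1]; [:: 7; 433; -7]; [::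
  -3; 434; 3]; [:: -1; 139; 1]; [:: -1; 436; 1]].

Definition step_44_1 := Step
  [:: Zm 1 0 0 0 0 (-1) 0 0 0 0 1 0 0 0 0 (-1); Zm 1 0 0 0 0 1 0 0 0 0 1 0 0 (-1) 0 1; Zm 1
  0 0 0 0 1 0 0 (-2) 0 1 0 0 0 0 1; Zm 1 0 1 0 0 1 0 0 0 0 1 0 0 0 0 1; Zm 1 0 0 1 0 1 1 0 0
  0 1 0 0 0 0 1]
  [:: [:: 440; 440; 1; -439; -439; -439; -439; 438; 440; 1; 440; -439; -439; 438]; [:: 441;
  440; -441]; [:: -440; 442; 440; 442]; [:: 441; 442; 2]; [:: -442; 441; 440; -441; 442];
  [:: -442; 440; 442]; [:: 441; -442; 2]; [:: 2; 439; 439; -443; 440; -2]; [:: -442; 439;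
  439; -443; 440; 442]; [:: 439; 439; -443; 440]; [:: 441; 438; -439; -439; -443; -440;
  -441]; [:: 441; 439; 439; -443; 440; -441]]
  [:: Zm 1 0 0 0 0 1 0 0 0 0 1 0 0 0 0 1; Zm 1 0 0 0 0 1 0 0 (-1) 0 1 0 0 0 0 1; Zm 0 0 1 0
  0 1 0 0 (-1) 0 1 0 0 0 0 1; Zm 1 0 0 1 (-1) 1 1 (-1) (-1) 0 1 0 0 0 0 1; Zm 1 0 0 1 (-1) 1
  1 (-1) (-1) 0 1 0 (-1) 1 1 0; Zm 1 0 0 1 0 0 0 (-1) (-1) 0 1 0 (-1) 1 1 0; Zm 1 0 0 1 0 0
  0 (-1) 0 0 1 1 (-1) 1 1 0; Zm 0 1 0 0 1 (-1) 0 0 0 0 1 1 (-1) 1 1 0; Zm 0 1 0 0 1 (-1) 0 0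
  0 0 1 1 0 0 1 0; Zm 0 1 0 0 0 0 1 0 0 0 1 1 (-1) 1 1 0; Zm 0 0 1 1 0 0 0 (-1) (-1) 0 1 0
  (-1) 1 1 0; Zm 1 0 0 1 (-1) 1 1 (-1) 0 0 1 1 (-1) 1 1 0; Zm 1 0 0 1 (-1) 1 1 (-1) 0 0 1 1
  0 0 0 1; Zm 0 0 1 1 (-1) 1 1 (-1) (-1) 0 1 0 (-1) 1 1 0; Zm 0 0 1 (-1) 1 1 (-1) 1 (-1) 0 1
  0 0 0 0 1]
  [:: ([:: 0; 2; 1; 14; 13; 10; 6; 7; 8; 9; 5; 11; 12; 4; 3]%N, [:: 441; 0; 444; 445; 0; 0;
  446; 446; 446; 446; 444; 446; 446; 444; 447]); ([:: 1; 0; 2; 12; 11; 6; 5; 7; 8; 9; 10; 4;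
  3; 13; 14]%N, [:: 0; 440; 441; 448; 448; 448; 0; 439; 439; 439; 446; 0; 0; 446; 449]);
  ([:: 0; 14; 3; 2; 4; 5; 7; 6; 8; 11; 10; 9; 12; 13; 1]%N, [:: 449; 0; 447; 0; 439; 439;
  450; 0; 2; 0; 439; 450; 441; 439; 447]); ([:: 0; 1; 2; 4; 3; 5; 6; 8; 7; 9; 10; 12; 11;
  14; 13]%N, [:: 439; 439; 439; 451; 0; 2; 2; 452; 0; 441; 2; 0; 451; 445; 453]); ([:: 0; 1;
  2; 3; 5; 4; 11; 9; 8; 7; 13; 6; 12; 10; 14]%N, [:: 2; 2; 2; 2; 454; 0; 0; 0; 441; 454; 0;
  454; 2; 454; 2])].

Definition step_44_2 := Step
  [:: Zm 1 0 0 0 0 (-1) 0 0 0 0 1 0 0 0 0 (-1); Zm (-1) 0 0 0 0 1 0 0 0 0 (-1) 0 0 0 0 1; Zm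
  1 0 0 0 0 1 0 0 0 0 1 0 0 (-2) 0 1; Zm 1 0 0 0 0 1 0 0 (-2) 0 1 0 0 0 0 1; Zm 1 0 2 0 0 1
  0 0 0 0 1 0 0 0 0 1; Zm 1 (-1) 0 1 0 1 1 0 0 0 1 0 0 0 1 1; Zm 1 0 0 0 (-4) 1 0 0 0 0 1 4
  0 0 0 1]
  [:: [:: 441; 441; 1; -440; -440; 438; 441; 1; 441; -440; 438]; [:: 442; 441; 442; 438;
  440; -445; -441; -1; -441; 438; 440; 440; 445; 440; 441]; [:: 442; 443; 438; 440; -445;
  -441; -1; -441; 438; -441; -441; 444]; [:: -440; -440; 1; -442; 443; 2; 2; 2; 2]; [:: 438;
  -440; -2; -2]; [:: 439; -441; -442]; [:: 438; 440; -445; -441; -1; -441; 438; 443]; [::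
  443; 438; 440; -445; -441; -1; -441; 438]]
  [:: Zm 1 0 0 0 0 1 0 0 0 0 1 0 0 0 0 1; Zm 1 0 0 0 0 1 0 0 0 0 1 0 0 (-1) 0 1; Zm 1 0 (-1)
  0 0 1 0 0 0 0 1 0 0 0 0 1; Zm 1 0 (-1) 0 0 1 0 0 0 0 1 0 0 (-1) 0 1; Zm 1 0 0 0 0 0 0 1 0
  0 1 0 0 (-1) 0 1; Zm 1 0 (-1) 0 0 0 0 1 0 0 1 0 0 (-1) 0 1]
  [:: ([:: 0; 1; 2; 3; 5; 4]%N, [:: 1; 1; 446; 446; 447; 448]); ([:: 0; 4; 2; 5; 1; 3]%N,
  [:: 2; 0; 2; 0; 449; 449]); ([:: 0; 1; 2; 3; 4; 5]%N, [:: 438; 438; 438; 438; 438; 438]);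
  ([:: 1; 0; 3; 2; 4; 5]%N, [:: 0; 440; 0; 440; 2; 2]); ([:: 0; 1; 2; 3; 4; 5]%N, [:: 441;
  441; 450; 450; 441; 450]); ([:: 2; 3; 0; 1; 5; 4]%N, [:: 442; 442; 0; 0; 442; 0]); ([:: 2;
  1; 0; 3; 4; 5]%N, [:: 451; 443; 452; 443; 443; 443])].

Definition step_44_3 := Step
  [:: Zm 1 0 0 0 0 (-1) 0 0 0 0 1 0 0 0 0 (-1); Zm (-1) 0 0 0 0 1 0 0 0 0 (-1) 0 0 0 0 1; Zm
  1 0 0 0 0 1 0 0 (-2) 0 1 0 0 0 0 1; Zm 1 0 2 0 0 1 0 0 0 0 1 0 0 0 0 1; Zm 1 (-1) 0 1 0 1
  1 0 0 0 1 0 0 0 1 1; Zm 1 0 0 0 (-4) 1 0 0 0 0 1 4 0 0 0 1]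
  [:: [:: 440; 440; 1; -440; -1; 438; 1; 438; 440; 1; 440; 440]; [:: 440; 440; 1; -444; 438;
  440; 1; 440; 438]; [:: 438; -444; -2]; [:: 444; -445; -440; -1; -440; 438; -444; 445; 440;
  440; 1; -445; -444; 438; 441; 442]; [:: -445; 443; 1; -438; 1; 1; 444; -445; -440; -1;
  -440; 438; -444; -445; -440; -440]]
  [:: Zm 1 0 0 0 0 1 0 0 0 0 1 0 0 0 0 1; Zm 1 0 0 0 0 1 0 0 0 0 1 0 0 (-2) 0 1]
  [:: ([:: 0; 1]%N, [:: 1; 1]); ([:: 0; 1]%N, [:: 2; 446]); ([:: 0; 1]%N, [:: 438; 438]);
  ([:: 0; 1]%N, [:: 439; 439]); ([:: 1; 0]%N, [:: 0; 444]); ([:: 0; 1]%N, [:: 440; 440]);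
  ([:: 0; 1]%N, [:: 441; 441]); ([:: 0; 1]%N, [:: 442; 447]); ([:: 0; 1]%N, [:: 443; 448])].

Definition step_44_4 := Step
  [:: Zm (-1) 0 0 0 0 (-1) 0 0 0 0 (-1) 0 0 0 0 (-1); Zm 1 0 0 0 0 1 0 0 (-2) 0 1 0 0 0 0 1;
  Zm 1 0 2 0 0 1 0 0 0 0 1 0 0 0 0 1; Zm 1 (-1) 0 1 0 1 1 0 0 0 1 0 0 0 1 1; Zm 1 0 0 0 4 1
  0 0 0 0 1 (-4) 0 0 0 1]
  [:: [:: 439; 1; 439; -1; -439; -439; -439; -439; -1; 439; 1; 439]; [:: 439; 439; 1; -443;
  -439; -1; 443; -439; 443]; [:: 443; -444; -439; -1; -439; -443; 444; -439; 444; -439]]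
  [:: Zm 1 0 0 0 0 1 0 0 0 0 1 0 0 0 0 1; Zm (-1) 0 0 0 0 1 0 0 0 0 (-1) 0 0 0 0 1]
  [:: ([:: 0; 1]%N, [:: 1; 445]); ([:: 0; 1]%N, [:: 2; 2]); ([:: 1; 0]%N, [:: 438; 438]);
  ([:: 1; 0]%N, [:: 0; 0]); ([:: 0; 1]%N, [:: 439; 439]); ([:: 0; 1]%N, [:: 440; 440]); ([::
  0; 1]%N, [:: 441; -441]); ([:: 0; 1]%N, [:: -442; 442])].

Definition step_44_5 := Step
  [:: Zm (-1) 0 0 0 0 (-1) 0 0 0 0 (-1) 0 0 0 0 (-1); Zm 1 0 0 0 0 1 0 0 0 (-2) 1 0 (-2)
  (-2) 0 1; Zm 1 (-1) 0 0 0 1 0 0 0 0 1 0 0 0 1 1; Zm 1 0 2 0 0 1 0 0 0 0 1 0 0 0 0 1; Zm 1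
  (-1) 0 1 0 1 1 0 0 0 1 0 0 0 1 1; Zm (-3) 0 2 0 0 1 0 0 4 0 (-3) 0 0 0 0 1; Zm 1 0 0 0 4 1
  0 0 0 0 1 (-4) 0 0 0 1]
  [:: [:: -439; 440; 439; -440]; [:: 445; -439; 1]; [:: 445; -440; -1]; [:: -445; 439; 440;
  439; 1; -445; 443]; [:: 2; 439; 440; -2]]
  [:: Zm 1 0 0 0 0 1 0 0 0 0 1 0 0 0 0 1; Zm 1 0 0 0 0 1 0 0 (-2) 0 1 0 0 0 0 1]
  [:: ([:: 0; 1]%N, [:: 1; 446]); ([:: 0; 1]%N, [:: 2; 2]); ([:: 0; 1]%N, [:: 438; 438]);
  ([:: 1; 0]%N, [:: 0; 447]); ([:: 0; 1]%N, [:: 441; 448]); ([:: 0; 1]%N, [:: 442; 449]);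
  ([:: 0; 1]%N, [:: 444; 444])].

Definition step_44_6 := Step
  [:: Zm (-1) 0 0 0 0 (-1) 0 0 0 0 (-1) 0 0 0 0 (-1); Zm 1 0 0 0 0 1 0 0 0 0 1 0 0 (-4) 0 1;
  Zm 1 (-1) 0 0 0 1 0 0 0 0 1 0 0 0 1 1; Zm 1 0 0 0 (-2) (-1) 0 0 0 0 1 (-2) 0 0 0 (-1); Zm
  1 0 2 0 0 1 0 0 0 0 1 0 0 0 0 1; Zm (-3) 0 2 0 0 1 0 0 4 0 (-3) 0 0 0 0 1]
  [:: [:: -439; 1]; [:: -439; 440; 1; 441; -2]; [:: -439; 1; 440; 439; -1; -440]; [:: 439;
  440]; [:: 439; 440; 439; 440; 440; 440; 442]; [:: 2; 440; -2]; [:: 440; -439; 1; -2; 438;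
  439; -440; -1; 440; 2; -438; -440; -438; 440; 439]; [:: 439; -440; -1; 440; 1; -439; 440;
  443; -440]; [:: 438; -440; 441; 440; -441]; [:: -439; 438; -440; 441; 440; 439; -441]]
  [:: Zm 1 0 0 0 0 1 0 0 0 0 1 0 0 0 0 1; Zm 1 0 0 0 0 1 0 0 0 (-2) 1 0 (-2) (-2) 0 1]
  [:: ([:: 0; 1]%N, [:: 1; 444]); ([:: 0; 1]%N, [:: 2; 445]); ([:: 0; 1]%N, [:: 438; 438]);
  ([:: 1; 0]%N, [:: 0; 446]); ([:: 0; 1]%N, [:: 440; 447]); ([:: 0; 1]%N, [:: 442; 448]);
  ([:: 0; 1]%N, [:: 449; 450]); ([:: 0; 1]%N, [:: 443; 451]); ([:: 0; 1]%N, [:: 452; 453])].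

Definition step_44_7 := Step
  [:: Zm (-1) 0 0 0 0 (-1) 0 0 0 0 (-1) 0 0 0 0 (-1); Zm 1 0 0 0 0 1 0 0 0 0 1 0 0 (-4) 0 1;
  Zm 1 (-1) 0 0 0 1 0 0 0 0 1 0 0 0 1 1; Zm 1 0 2 0 0 1 0 0 0 0 1 0 0 0 0 1; Zm (-3) 0 2 0 0
  1 0 0 4 0 (-3) 0 0 0 0 1]
  [:: [:: -1; -440; 439; 2; -439; 1; 440; 439; -1; -440; -439; -439; -439; 1; 440; 439; 438;
  -2; -439; 1]; [:: -1; 439; -440; 439; -1; 439; -440; -440; -1; -440; -1]; [:: -1; 439; 2;
  438; 439; -440; -440; -1; -1; -1; -4; -440]; [:: -440; 2; 2; 440; 440; -2; -441; -2; -440;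
  392; -157; 425]; [:: 440; -2; 184; -439; 1; 440; -439; 440; 440; 442; -3; -1; 2]]
  [:: Zm 1 0 0 0 0 1 0 0 0 0 1 0 0 0 0 1; Zm 1 0 0 0 (-2) (-1) 0 0 0 0 1 (-2) 0 0 0 (-1)]
  [:: ([:: 0; 1]%N, [:: 1; 443]); ([:: 0; 1]%N, [:: 2; 2]); ([:: 0; 1]%N, [:: 438; 438]);
  ([:: 0; 1]%N, [:: 439; 444]); ([:: 0; 1]%N, [:: 440; 445]); ([:: 1; 0]%N, [:: 0; 0]); ([::
  0; 1]%N, [:: 441; 446]); ([:: 0; 1]%N, [:: 442; 447])].

Definition step_44_8 := Step
  [:: Zm 1 0 0 0 0 1 0 0 0 0 1 0 0 (-4) 0 1; Zm 1 (-1) 0 0 0 1 0 0 0 0 1 0 0 0 1 1; Zm 1 0 2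
  0 0 1 0 0 0 0 1 0 0 0 0 1; Zm (-3) 0 2 0 0 1 0 0 4 0 (-3) 0 0 0 0 1]
  [::]
  [:: Zm 1 0 0 0 0 1 0 0 0 0 1 0 0 0 0 1; Zm (-1) 0 0 0 0 (-1) 0 0 0 0 (-1) 0 0 0 0 (-1)]
  [:: ([:: 0; 1]%N, [:: 1; 1]); ([:: 0; 1]%N, [:: 2; 2]); ([:: 1; 0]%N, [:: 0; 0]); ([:: 0;
  1]%N, [:: 438; 438]); ([:: 0; 1]%N, [:: 439; 439]); ([:: 0; 1]%N, [:: 440; 440]); ([:: 0;
  1]%N, [:: 441; 441])].

Definition step_44_9 := Step
  [:: Zm 1 (-1) 0 0 0 1 0 0 0 0 1 0 0 4 1 1; Zm 1 0 2 0 0 1 0 0 0 0 1 0 0 0 0 1; Zm 1 (-3) 0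
  1 0 1 1 0 0 0 1 0 0 (-4) (-1) 1; Zm (-3) 0 2 0 0 1 0 0 4 0 (-3) 0 0 0 0 1]
  [:: [:: 438; 440; 3]; [:: -438; -438; -1; 438; 1; 438; -1; -438; 1; 438]; [:: -438; -438;
  -1; 438; 1; 438; -1; -438; 1; 438; 438]]
  [:: Zm 1 0 0 0 0 1 0 0 0 0 1 0 0 0 0 1; Zm 1 0 0 0 0 1 0 0 0 0 1 0 0 (-4) 0 1]
  [:: ([:: 0; 1]%N, [:: 1; 1]); ([:: 0; 1]%N, [:: 2; 442]); ([:: 1; 0]%N, [:: 0; 443]); ([::
  1; 0]%N, [:: 438; 444]); ([:: 0; 1]%N, [:: 439; 439]); ([:: 0; 1]%N, [:: 441; 441])].

Definition step_44_10 := Step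
  [:: Zm 1 (-1) 0 0 0 1 0 0 0 0 1 0 0 4 1 1; Zm 1 0 2 0 0 1 0 0 0 0 1 0 0 0 0 1]
  [:: [:: -2; -438; -1; -1; -1; -4; -2]; [:: -2; 1; 438; 438; -1; -438; 1; 438; 438; 438;
  439; 85]; [:: 438; 438; 70; -438; -439; -439; -438; 392]; [:: -438; -1; 438; 1; -438; -1;
  -438; 1; 438; -1; 438; 1; -438; -1; -438; 1; -438; -439]; [:: -438; -1; 438; -1; -438; 2;
  1; 438; 438; -1; -438; 1; 438; 1; 438; -3]; [:: -2; -438; -1; 438; 1; -438; -1; -438; 1;
  440; -438]; [:: 438; -37; -438; -1; 438; 1; -438; -1; -438; 1; 440; 439]]
  [:: Zm 1 0 0 0 0 1 0 0 0 0 1 0 0 0 0 1; Zm 1 (-1) 0 (-1) 0 1 (-1) 0 0 0 1 0 0 4 (-3) 1]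
  [:: ([:: 0; 1]%N, [:: 1; 441]); ([:: 0; 1]%N, [:: 2; 442]); ([:: 0; 1]%N, [:: 438; 443]);
  ([:: 0; 1]%N, [:: 439; 439]); ([:: 1; 0]%N, [:: 444; 0]); ([:: 1; 0]%N, [:: 445; 446])].

Definition step_44_11 := Step
  [:: Zm 1 0 0 0 0 1 0 0 0 (-4) 1 0 (-4) (-4) 0 1; Zm 1 (-2) 0 0 0 1 0 0 0 0 1 0 0 0 2 1; Zm
  1 0 2 0 0 1 0 0 0 0 1 0 0 0 0 1]
  [:: [:: -438; -1; 438; 1]; [:: -441; 438; 1]; [:: 441; -439; 3; 439; -441]; [:: -441;
  439]]
  [:: Zm 1 0 0 0 0 1 0 0 0 0 1 0 0 0 0 1; Zm 1 (-1) 0 0 0 1 0 0 0 0 1 0 0 4 1 1]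
  [:: ([:: 0; 1]%N, [:: 1; 442]); ([:: 0; 1]%N, [:: 2; 443]); ([:: 1; 0]%N, [:: 0; 444]);
  ([:: 0; 1]%N, [:: 440; 440])].

Definition step_44_12 := Step
  [:: Zm 1 0 0 0 0 1 0 0 0 0 1 0 0 (-8) 0 1; Zm 1 (-2) 0 0 0 1 0 0 0 4 1 0 4 (-4) 2 1; Zm 1
  0 2 0 0 1 0 0 0 0 1 0 0 0 0 1; Zm 1 0 0 2 0 1 2 0 0 0 1 0 0 0 0 1]
  [:: [:: -438; 1]; [:: 439; 2; 392; 441; -439]; [:: -438; 1; 439; -438; -1; -439]; [::
  -438; 1; 439; -1; 438]; [:: 1; 439; 439; -1; 439; 438; 438; 438; 438; 439; 438; 438; 438;
  438; 440]]
  [:: Zm 1 0 0 0 0 1 0 0 0 0 1 0 0 0 0 1; Zm 1 0 0 0 0 1 0 0 0 (-4) 1 0 (-4) (-4) 0 1]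
  [:: ([:: 0; 1]%N, [:: 1; 442]); ([:: 0; 1]%N, [:: 2; 443]); ([:: 1; 0]%N, [:: 0; 444]);
  ([:: 1; 0]%N, [:: 439; 445]); ([:: 0; 1]%N, [:: 440; 446])].

Definition step_44_13 := Step
  [:: Zm 1 (-4) 1 (-1) 0 5 (-1) 1 0 0 1 0 0 (-16) 4 (-3); Zm 1 0 (-2) 2 0 1 2 0 0 0 1 0 0 0
  0 1; Zm 1 0 0 0 0 1 0 0 0 0 1 0 0 (-32) 0 1; Zm 1 0 0 0 0 1 0 0 0 (-16) 1 0 (-16) (-16) 0
  1; Zm 1 (-4) 0 0 0 1 0 0 0 (-8) 1 0 (-8) (-8) 4 1; Zm 1 0 0 0 0 1 0 0 0 0 1 0 0 (-16) 0 1;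
  Zm 1 0 0 0 0 1 0 0 0 (-8) 1 0 (-8) (-8) 0 1; Zm 1 (-2) 0 0 0 1 0 0 0 (-4) 1 0 (-4) 4 2 1;
  Zm (-7) 0 4 0 0 1 0 0 (-16) 0 9 0 0 0 0 1; Zm 1 0 0 0 0 1 0 0 0 0 1 0 0 (-8) 0 1]
  [:: [:: 392; 426; -2; -3; -447; -392; -445; -7; 2; 1; 2; -447; -443; -445; 444; -442]; [::
  447; -444; 445; -447]; [:: -445; 444; -443; -442]; [:: 392; 439]]
  [:: Zm 1 0 0 0 0 1 0 0 0 0 1 0 0 0 0 1; Zm 1 0 (-2) 0 0 1 0 0 0 0 1 0 0 0 0 1]
  [:: ([:: 0; 1]%N, [:: 1; 448]); ([:: 0; 1]%N, [:: 2; 2]); ([:: 0; 1]%N, [:: 447; 447]);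
  ([:: 0; 1]%N, [:: 449; 450]); ([:: 1; 0]%N, [:: 392; 0]); ([:: 1; 0]%N, [:: 451; 439])].

Definition step_44_14 := Step
  [:: Zm 1 0 0 0 0 (-7) 0 1 0 0 1 0 0 (-64) 0 9; Zm 1 0 0 0 0 1 0 0 0 0 1 0 0 (-32) 0 1; Zm
  1 0 0 0 0 1 0 0 0 (-16) 1 0 (-16) (-16) 0 1; Zm 1 (-4) 0 0 0 1 0 0 0 (-8) 1 0 (-8) (-8) 4
  1; Zm 1 0 0 0 0 1 0 0 0 0 1 0 0 (-16) 0 1; Zm 1 0 0 0 0 1 0 0 0 (-8) 1 0 (-8) (-8) 0 1; Zm
  1 (-2) 0 0 0 1 0 0 0 (-4) 1 0 (-4) 4 2 1; Zm (-7) 0 4 0 0 1 0 0 (-16) 0 9 0 0 0 0 1]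
  [:: [:: -1; 442; 438; -442; 1]; [:: 1; 443; 438; 443; -1; -439; 440; -396; 4; -2; -2;
  -392]; [:: 3; 1; 1; 443; -1; 442; -396; 438; -443; -1; 4; -2; 392; -130; -85]]
  [:: Zm 1 0 0 0 0 1 0 0 0 0 1 0 0 0 0 1; Zm 1 0 0 0 0 1 0 0 0 0 1 0 0 (-8) 0 1]
  [:: ([:: 0; 1]%N, [:: 1; 1]); ([:: 0; 1]%N, [:: 2; 438]); ([:: 0; 1]%N, [:: 446; 3]); ([::
  0; 1]%N, [:: 447; 448]); ([:: 0; 1]%N, [:: 439; 439]); ([:: 0; 1]%N, [:: 440; 440]); ([::
  0; 1]%N, [:: 441; 441]); ([:: 0; 1]%N, [:: 442; 442]); ([:: 0; 1]%N, [:: 443; 443]); ([::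
  0; 1]%N, [:: 444; 444]); ([:: 0; 1]%N, [:: 445; 445]); ([:: 1; 0]%N, [:: 0; 442])].

Definition step_44_15 := Step
  [:: Zm 1 0 0 0 0 1 0 0 0 0 1 0 0 (-32) 0 1; Zm 1 0 0 0 0 1 0 0 0 (-16) 1 0 (-16) (-16) 0
  1; Zm 1 (-4) 0 0 0 1 0 0 0 (-8) 1 0 (-8) (-8) 4 1; Zm 1 0 0 0 0 1 0 0 0 0 1 0 0 (-16) 0 1;
  Zm 1 0 0 0 0 1 0 0 0 (-8) 1 0 (-8) (-8) 0 1; Zm 1 (-2) 0 0 0 1 0 0 0 (-4) 1 0 (-4) 4 2 1]
  [:: [:: -107; -1]; [:: 444; -107]; [:: 445; -108]; [:: 446; -206]; [:: 447; 108]; [:: 448;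
  -208]; [:: 449; 108]; [:: 450; -208]; [:: 451; 108]; [:: 452; -208]; [:: 453; 108]; [::
  443; 443]; [:: 455; 455]; [:: 456; 456]; [:: 457; 457]; [:: 458; 458]; [:: 459; 459]; [::
  460; 460]; [:: 461; 461]; [:: 462; 462]; [:: 463; 463]; [:: 464; 464]; [:: 465; 465]; [::
  466; 466]; [:: 467; 467]; [:: 468; 468]; [:: 469; 469]; [:: 470; 470]; [:: 471; 471]; [::
  472; 472]; [:: 473; 473]; [:: -403; -403]; [:: 475; 475]; [:: 476; 476]; [:: 477; 477];
  [:: 478; 478]; [:: -407; -407]; [:: 480; 480]; [:: 481; 481]; [:: 482; 482]; [:: 483;
  483]; [:: 484; 484]; [:: 485; 485]; [:: 486; 486]; [:: 487; 487]; [:: 488; 488]; [:: 417;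
  91; 91; -4; -5; -7; 454; 455; 459; -461; -464; -466; 468; 474; -353; 355; -359; 383; -402;
  -476; 479; 441; 340; -342; -344; -347; 350; 386; -391; -480; -482; 484; -486; 489; 17];
  [:: 2; 440; 432; -3; 440; 1; -3; 392; -85; 392; 7]; [:: 490; -408]; [:: 1; -363; -363;
  -363; -1; -443; -441; -442; 440; -442; -363; -443; 1; -363; -363; -363; -363; -1]; [::
  -440; -443; 442; -441; -443; -438; -440; -440; -337; -440; -440; -440; -440]]
  [:: Zm 1 0 0 0 0 1 0 0 0 0 1 0 0 0 0 1; Zm (-7) 0 4 0 0 1 0 0 (-16) 0 9 0 0 0 0 1]
  [:: ([:: 0; 1]%N, [:: 1; 491]); ([:: 0; 1]%N, [:: 2; 2]); ([:: 1; 0]%N, [:: 492; 490]);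
  ([:: 0; 1]%N, [:: 438; 438]); ([:: 0; 1]%N, [:: 439; 493]); ([:: 0; 1]%N, [:: 440; 440]);
  ([:: 0; 1]%N, [:: 441; 441]); ([:: 0; 1]%N, [:: 442; 494]); ([:: 0; 1]%N, [:: 443; 443]);
  ([:: 1; 0]%N, [:: 0; 408])].

Definition step_44_16 := Step
  [:: Zm 1 0 0 0 0 1 0 0 0 0 1 0 0 (-32) 0 1; Zm 1 0 0 0 0 1 0 0 0 (-16) 1 0 (-16) (-16) 0
  1; Zm 1 (-4) 0 0 0 1 0 0 0 (-8) 1 0 (-8) (-8) 4 1; Zm 1 0 0 0 0 1 0 0 0 0 1 0 0 (-16) 0 1;
  Zm 1 0 0 0 0 1 0 0 0 (-8) 1 0 (-8) (-8) 0 1]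
  [:: [:: 1; -441; 442]; [:: -1; -440; 1; 440]; [:: 442; -438]; [:: -441; 440]]
  [:: Zm 1 0 0 0 0 1 0 0 0 0 1 0 0 0 0 1; Zm 1 (-2) 0 0 0 1 0 0 0 (-4) 1 0 (-4) 4 2 1]
  [:: ([:: 0; 1]%N, [:: 1; 443]); ([:: 0; 1]%N, [:: 2; 11]); ([:: 0; 1]%N, [:: 438; 438]);
  ([:: 0; 1]%N, [:: 439; 444]); ([:: 0; 1]%N, [:: 440; 440]); ([:: 0; 1]%N, [:: 441; 441]);
  ([:: 0; 1]%N, [:: 442; 445]); ([:: 1; 0]%N, [:: 0; 446])].

Definition step_44_17 := Step
  [:: Zm 1 0 0 0 0 1 0 0 0 0 1 0 0 (-32) 0 1; Zm 1 0 0 0 0 1 0 0 0 (-16) 1 0 (-16) (-16) 0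
  1; Zm 1 (-4) 0 0 0 1 0 0 0 (-8) 1 0 (-8) (-8) 4 1; Zm 1 0 0 0 0 1 0 0 0 0 1 0 0 (-16) 0 1]
  [:: [:: 1; -441]; [:: 440; 337]]
  [:: Zm 1 0 0 0 0 1 0 0 0 0 1 0 0 0 0 1; Zm 1 0 0 0 0 1 0 0 0 (-8) 1 0 (-8) (-8) 0 1]
  [:: ([:: 0; 1]%N, [:: 1; 442]); ([:: 0; 1]%N, [:: 2; 138]); ([:: 0; 1]%N, [:: 438; 438]);
  ([:: 0; 1]%N, [:: 439; 439]); ([:: 0; 1]%N, [:: 440; 443]); ([:: 0; 1]%N, [:: 441; 441]);
  ([:: 1; 0]%N, [:: 0; 439])].

Definition step_44_18 := Step
  [:: Zm 1 0 0 0 0 1 0 0 0 0 1 0 0 (-32) 0 1; Zm 1 0 0 0 0 1 0 0 0 (-16) 1 0 (-16) (-16) 0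
  1; Zm 1 (-4) 0 0 0 1 0 0 0 (-8) 1 0 (-8) (-8) 4 1]
  [::]
  [:: Zm 1 0 0 0 0 1 0 0 0 0 1 0 0 0 0 1; Zm 1 0 0 0 0 1 0 0 0 0 1 0 0 (-16) 0 1]
  [:: ([:: 0; 1]%N, [:: 1; 1]); ([:: 0; 1]%N, [:: 2; 131]); ([:: 0; 1]%N, [:: 438; 438]);
  ([:: 0; 1]%N, [:: 439; 439]); ([:: 0; 1]%N, [:: 440; 440]); ([:: 1; 0]%N, [:: 0; 438])].

Definition step_44_19 := Step
  [:: Zm 1 0 0 0 0 1 0 0 0 0 1 0 0 (-32) 0 1; Zm 1 0 0 0 0 1 0 0 0 (-16) 1 0 (-16) (-16) 0
  1]
  [:: [:: 1; 439; -337]; [:: 439; -337; -337]; [:: 1; 363; -1]]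
  [:: Zm 1 0 0 0 0 1 0 0 0 0 1 0 0 0 0 1; Zm 1 (-4) 0 0 0 1 0 0 0 (-8) 1 0 (-8) (-8) 4 1]
  [:: ([:: 0; 1]%N, [:: 1; 440]); ([:: 0; 1]%N, [:: 2; 432]); ([:: 0; 1]%N, [:: 438; 438]);
  ([:: 0; 1]%N, [:: 439; 441]); ([:: 1; 0]%N, [:: 0; 442])].

Definition step_44_20 := Step
  [:: Zm 1 0 0 0 0 1 0 0 0 0 1 0 0 (-32) 0 1]
  [:: [:: 1; -438]; [:: -1; -396; -1; -438; 396; 1; -438; 1]]
  [:: Zm 1 0 0 0 0 1 0 0 0 0 1 0 0 0 0 1; Zm 1 0 0 0 0 1 0 0 0 (-16) 1 0 (-16) (-16) 0 1]
  [:: ([:: 0; 1]%N, [:: 1; 439]); ([:: 0; 1]%N, [:: 2; 435]); ([:: 0; 1]%N, [:: 438; 438]);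
  ([:: 1; 0]%N, [:: 0; 440])].

Definition step_44_21 := Step
  [::]
  [::]
  [:: Zm 1 0 0 0 0 1 0 0 0 0 1 0 0 0 0 1; Zm 1 0 0 0 0 1 0 0 0 0 1 0 0 (-32) 0 1]
  [:: ([:: 0; 1]%N, [:: 1; 1]); ([:: 0; 1]%N, [:: 2; 437]); ([:: 1; 0]%N, [:: 0; 337])].

(** The pivots are listed by increasing level; those which are 1 modulo [q] but
    not modulo [p q] have the component [p q]. When the image of [G] has index
    [p^i] in the layer between [q] and [p q], there are [10 - i] of them. *)
Definition pivots_23_2 : seq pivot :=
  [:: (Zm (-1) 0 4 4 0 (-3) 4 0 0 0 (-1) 0 0 0 0 (-3), 0%N, 4); (Zm 1 2 4 0 4 (-3) 0 0 0 4 1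
  4 4 4 (-2) (-3), 1%N, 4); (Zm (-3) 4 2 4 0 (-3) 4 4 0 0 (-3) 0 0 (-2) 4 (-3), 2%N, 4); (Zm
  (-3) 4 4 (-2) 4 1 (-2) 4 0 0 (-3) 4 0 0 4 1, 3%N, 4); (Zm 1 0 0 0 (-2) 1 0 0 4 4 1 2 4 0 0
  1, 4%N, 4); (Zm 1 0 4 4 0 3 4 0 0 0 1 0 0 0 0 3, 5%N, 4); (Zm 1 0 0 0 0 1 0 2 0 0 1 0 0 0
  0 1, 7%N, 4); (Zm 1 0 4 0 4 (-3) 0 0 4 (-2) 1 4 (-2) 0 0 (-3), 9%N, 4); (Zm (-3) 0 0 0 0 1
  0 0 0 0 (-3) 0 0 0 0 1, 0%N, 8); (Zm 1 4 0 0 0 1 0 0 0 0 1 0 0 0 4 1, 1%N, 8); (Zm 1 0 4 0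
  0 1 0 0 0 0 1 0 0 4 0 1, 2%N, 8); (Zm 1 0 0 4 0 1 4 0 0 0 1 0 0 0 0 1, 3%N, 8); (Zm 1 0 0
  0 4 1 0 0 0 0 1 4 0 0 0 1, 4%N, 8); (Zm 1 0 0 0 0 (-3) 0 0 0 0 1 0 0 0 0 (-3), 5%N, 8);
  (Zm 1 0 0 0 0 1 0 4 0 0 1 0 0 0 0 1, 7%N, 8); (Zm 1 0 0 0 0 1 0 0 0 4 1 0 4 0 0 1, 9%N,
  8)].

Definition pivots_34_2 : seq pivot :=
  [:: (Zm (-1) 0 0 0 0 (-1) 0 0 0 0 (-1) 0 0 0 0 (-1), 0%N, 4); (Zm 1 0 2 2 0 1 2 0 0 0 1 0
  0 0 0 1, 2%N, 4); (Zm 1 0 0 0 2 (-1) 0 0 0 0 1 2 0 0 0 (-1), 4%N, 4); (Zm 1 0 0 0 0 1 0 2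
  0 0 1 0 0 0 0 1, 7%N, 4); (Zm 1 0 0 0 0 1 0 0 2 0 1 0 0 0 0 1, 8%N, 4); (Zm 1 0 0 0 0 1 0
  0 0 2 1 0 2 2 0 1, 9%N, 4)].

Definition pivots_34_3 : seq pivot :=
  [:: (Zm 4 0 0 0 0 1 0 0 0 (-3) (-2) 0 (-3) 0 0 1, 0%N, 9); (Zm 1 3 0 0 0 1 0 0 0 0 1 0 0 3
  (-3) 1, 1%N, 9); (Zm 1 0 3 0 0 1 0 0 0 0 1 0 0 3 0 1, 2%N, 9); (Zm 1 0 0 3 0 1 3 0 0 0 1 0
  0 0 0 1, 3%N, 9); (Zm 1 0 0 0 3 1 0 0 0 0 1 (-3) 0 0 0 1, 4%N, 9); (Zm 1 0 0 0 0 4 0 0 0 0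
  1 0 0 0 0 (-2), 5%N, 9); (Zm 1 0 0 0 0 1 0 3 0 0 1 0 0 0 0 1, 7%N, 9)].

Definition pivots_44_2 : seq pivot :=
  [:: (Zm 1 2 0 0 0 1 0 0 8 12 1 0 (-4) (-12) (-2) 1, 1%N, 4); (Zm 17 4 14 (-8) 4 (-19)
  (-16) 24 32 24 1 (-20) 24 24 (-4) (-11), 2%N, 4); (Zm 9 28 4 (-2) (-4) 5 (-26) 12 0 (-8)
  25 (-12) (-8) (-8) (-28) 13, 3%N, 4); (Zm 1 0 0 0 0 1 0 2 0 0 1 0 0 0 0 1, 7%N, 4); (Zm
  (-3) (-16) (-24) 24 16 29 24 8 32 (-16) 21 (-16) (-16) 32 16 (-11), 0%N, 8); (Zm 1 4 0 0 0
  1 0 0 16 (-24) 1 0 (-24) 8 (-4) 1, 1%N, 8); (Zm (-31) 8 12 24 24 (-23) (-8) 0 0 (-16)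
  (-31) (-24) (-16) (-16) (-8) 25, 2%N, 8); (Zm (-15) (-8) (-24) (-12) (-24) 25 20 24 0
  (-16) 17 24 (-16) (-16) 8 (-23), 3%N, 8); (Zm 1 0 0 0 0 1 0 4 0 0 1 0 0 0 0 1, 7%N, 8);
  (Zm 25 0 0 16 0 25 16 0 0 32 (-23) 0 32 0 0 (-23), 0%N, 16); (Zm 17 8 32 16 (-16) 17 16 32
  32 16 (-15) 16 16 16 (-8) (-15), 1%N, 16); (Zm (-15) 32 24 16 16 1 16 32 32 0 17 (-16) 0 0
  32 1, 2%N, 16); (Zm 1 16 32 24 16 17 24 0 0 32 1 (-16) 32 32 (-16) (-15), 3%N, 16); (Zm
  (-31) 16 (-16) 16 (-24) (-23) 16 32 0 0 (-31) 24 0 0 (-16) 25, 4%N, 16); (Zm 17 32 (-16)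
  16 (-16) (-15) 16 24 0 0 (-15) 16 0 0 32 17, 7%N, 16); (Zm (-15) 32 32 32 32 1 32 32 0 32
  17 32 32 32 32 1, 0%N, 32); (Zm 1 16 32 32 32 1 32 0 32 0 1 32 0 0 (-16) 1, 1%N, 32); (Zm
  (-31) 32 (-16) 32 32 1 32 0 0 0 (-31) 32 0 0 32 1, 2%N, 32); (Zm 1 0 0 16 32 (-31) 16 0 0
  32 1 32 32 32 0 (-31), 3%N, 32); (Zm 1 0 32 32 (-16) (-31) 32 32 32 32 1 16 32 32 0 (-31),
  4%N, 32); (Zm 1 0 0 0 32 17 0 32 0 0 1 32 0 0 0 (-15), 5%N, 32); (Zm 1 0 0 32 32 1 32
  (-16) 32 32 1 32 32 32 0 1, 7%N, 32); (Zm (-31) 0 0 0 0 1 0 0 0 0 (-31) 0 0 0 0 1, 0%N,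
  64); (Zm 1 32 0 0 0 1 0 0 0 0 1 0 0 0 32 1, 1%N, 64); (Zm 1 0 32 0 0 1 0 0 0 0 1 0 0 0 0
  1, 2%N, 64); (Zm 1 0 0 32 0 1 32 0 0 0 1 0 0 0 0 1, 3%N, 64); (Zm 1 0 0 0 32 1 0 0 0 0 1
  32 0 0 0 1, 4%N, 64); (Zm 1 0 0 0 0 (-31) 0 0 0 0 1 0 0 0 0 (-31), 5%N, 64); (Zm 1 0 0 0 0
  1 0 32 0 0 1 0 0 0 0 1, 7%N, 64); (Zm 1 0 0 0 0 1 0 0 32 0 1 0 0 0 0 1, 8%N, 64); (Zm 1 0
  0 0 0 1 0 0 0 32 1 0 32 32 0 1, 9%N, 64)].

Definition pivots_65_2 : seq pivot :=
  [:: (Zm (-1) 0 4 0 4 (-3) 0 0 0 0 (-1) 4 0 0 0 (-3), 0%N, 4); (Zm (-3) 2 4 0 4 1 0 0 0 0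
  (-3) 4 0 4 (-2) 1, 1%N, 4); (Zm 1 0 2 0 0 (-3) 0 4 0 4 1 0 4 (-2) 0 (-3), 2%N, 4); (Zm
  (-3) 4 4 (-2) 0 1 (-2) 4 0 0 (-3) 0 0 0 4 1, 3%N, 4); (Zm 1 0 0 0 (-2) 1 0 0 4 4 1 2 4 0 0
  1, 4%N, 4); (Zm 1 0 4 0 4 3 0 0 0 0 1 4 0 0 0 3, 5%N, 4); (Zm 1 0 0 0 0 1 0 2 0 0 1 0 0 0
  0 1, 7%N, 4); (Zm (-3) 0 4 0 4 1 0 0 4 (-2) (-3) 4 (-2) 0 0 1, 9%N, 4); (Zm (-3) 0 0 0 0 1
  0 0 0 0 (-3) 0 0 0 0 1, 0%N, 8); (Zm 1 4 0 0 0 1 0 0 0 0 1 0 0 0 4 1, 1%N, 8); (Zm 1 0 4 0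
  0 1 0 0 0 0 1 0 0 4 0 1, 2%N, 8); (Zm 1 0 0 4 0 1 4 0 0 0 1 0 0 0 0 1, 3%N, 8); (Zm 1 0 0
  0 4 1 0 0 0 0 1 4 0 0 0 1, 4%N, 8); (Zm 1 0 0 0 0 (-3) 0 0 0 0 1 0 0 0 0 (-3), 5%N, 8);
  (Zm 1 0 0 0 0 1 0 4 0 0 1 0 0 0 0 1, 7%N, 8); (Zm 1 0 0 0 0 1 0 0 0 4 1 0 4 0 0 1, 9%N,
  8)].

Definition pivots_65_3 : seq pivot :=
  [:: (Zm 4 0 0 0 0 1 0 0 0 3 (-2) 0 3 0 0 1, 0%N, 9); (Zm 1 3 0 0 0 1 0 0 0 0 1 0 0 (-3)
  (-3) 1, 1%N, 9); (Zm 1 0 3 0 0 1 0 0 0 0 1 0 0 3 0 1, 2%N, 9); (Zm 1 0 0 3 0 1 3 0 0 0 1 0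
  0 0 0 1, 3%N, 9); (Zm 1 0 0 0 3 1 0 0 0 0 1 (-3) 0 0 0 1, 4%N, 9); (Zm 1 0 0 0 0 4 0 0 0 0
  1 0 0 0 0 (-2), 5%N, 9); (Zm 1 0 0 0 0 1 0 3 0 0 1 0 0 0 0 1, 7%N, 9)].

Definition pivots_96_3 : seq pivot :=
  [:: (Zm 1 3 0 0 0 1 0 0 27 (-27) 1 0 (-27) 27 (-3) 1, 1%N, 9); (Zm 28 9 (-24) 18 27 28 18
  0 0 0 (-26) (-27) 0 0 (-9) (-26), 2%N, 9); (Zm 1 18 36 (-6) 27 (-26) (-6) 27 0 0 1 (-27) 0
  0 (-18) 28, 3%N, 9); (Zm 1 0 0 0 0 1 0 3 0 0 1 0 0 0 0 1, 7%N, 9); (Zm 1 9 0 0 0 1 0 0 0 0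
  1 0 0 0 (-9) 1, 1%N, 27); (Zm 1 0 9 0 0 1 0 0 0 0 1 0 0 0 0 1, 2%N, 27); (Zm 1 27 (-27) 9
  0 1 9 27 0 0 1 0 0 0 (-27) 1, 3%N, 27); (Zm (-26) 0 0 27 0 37 27 (-27) 0 0 28 0 0 27 0
  (-35), 5%N, 27); (Zm 1 0 0 0 0 1 0 9 0 0 1 0 0 0 0 1, 7%N, 27); (Zm 28 0 0 0 0 1 0 0 0 0
  (-26) 0 0 0 0 1, 0%N, 81); (Zm 1 27 0 0 0 1 0 0 0 0 1 0 0 0 (-27) 1, 1%N, 81); (Zm 1 0 27
  0 0 1 0 0 0 0 1 0 0 0 0 1, 2%N, 81); (Zm 1 0 0 27 0 1 27 0 0 0 1 0 0 0 0 1, 3%N, 81); (Zm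
  1 0 0 0 27 1 0 0 0 0 1 (-27) 0 0 0 1, 4%N, 81); (Zm 1 0 0 0 0 28 0 0 0 0 1 0 0 0 0 (-26),
  5%N, 81); (Zm 1 0 0 0 0 1 0 27 0 0 1 0 0 0 0 1, 7%N, 81); (Zm 1 0 0 0 0 1 0 0 0 0 1 0 0 27
  0 1, 13%N, 81)].

(** * The indices *)

Lemma packed_13 : packed setT (gen_by (MN 1 3)) 6.
Proof. by apply: (@packed_mod_p 1 3 2 0 _ 6 119 [::] (packed_2 0)); by_compute. Qed.

Lemma packed_12 : packed setT (gen_by (MN 1 2)) 10.
Proof. by apply: (@packed_mod_p 1 2 2 0 _ 10 71 [::] (packed_2 0)); by_compute. Qed.

Lemma packed_23 : packed setT (gen_by (MN 2 3)) 960.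
Proof. by apply: (@packed_mod_p 2 3 2 2 _ 960 11 pivots_23_2 (packed_2 2)); by_compute. Qed.

Lemma packed_44 : packed setT (gen_by (MN 4 4)) (2 ^ 20 * 3 ^ 2 * 5).
Proof.
apply: (@packed_mod_p 4 4 2 5 _ _ 7 pivots_44_2 (packed_2 5));
  [by []|by_compute|by_compute|by rewrite zprime_powers; by_compute].
Qed.

Lemma packed_34 : packed setT (gen_by (MN 3 4)) (2 ^ 9 * 3 ^ 5 * 5 ^ 2).
Proof.
apply: (@packed_mod_2_3 3 4 4 9 (15 * 48) 1 (80 * 648) 1 _ 71 71 pivots_34_2 pivots_34_3);
  [|by_compute|by_compute|by_compute|by_compute|by rewrite zprime_powers; by_compute].
by apply: (@packed_2_3 1 4 1) => //; exists 1.
Qed.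

Lemma packed_65 : packed setT (gen_by (MN 6 5)) (2 ^ 10 * 3 ^ 6 * 5 ^ 2).
Proof.
apply: (@packed_mod_2_3 6 5 8 9 (15 * 48) 2 (80 * 648) 1 _ 11 71 pivots_65_2 pivots_65_3);
  [|by_compute|by_compute|by_compute|by_compute|by rewrite zprime_powers; by_compute].
by apply: (@packed_2_3 2 (-8) 1) => //; exists (-1).
Qed.

Lemma packed_96 : packed setT (gen_by (MN 9 6)) (2 ^ 8 * 3 ^ 13 * 5 ^ 2).
Proof.
apply: (@packed_mod_2_3 9 6 2 81 (15 * 48) 0 (80 * 648) 3 _ 71 80 [::] pivots_96_3);
  [|by_compute|by_compute|by_compute|by_compute|by rewrite zprime_powers; by_compute].
by apply: (@packed_2_3 0 (-2) 3) => //; exists (-1).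
Qed.

Theorem theorem3 :
  index_eq (Gdk 1%Z 3%Z) 6 /\
  index_eq (Gdk 1%Z 2%Z) 10 /\
  index_eq (Gdk 2%Z 3%Z) 960 /\
  index_eq (Gdk 3%Z 4%Z) (2 ^ 9 * 3 ^ 5 * 5 ^ 2)%N /\
  index_eq (Gdk 4%Z 4%Z) (2 ^ 20 * 3 ^ 2 * 5)%N /\
  index_ge (Gdk 6%Z 5%Z) (2 ^ 10 * 3 ^ 6 * 5 ^ 2)%N /\
  index_ge (Gdk 9%Z 6%Z) (2 ^ 8 * 3 ^ 13 * 5 ^ 2)%N.
Proof.
have ge d k n := @packed_index_ge _ _ n (gen_by_subgroup (MN d k)).
rewrite !Gdk_gen; repeat split.
- by apply: (index_eq_chain (lib := lib_13) (steps := [:: step_13_1]) _ _ packed_13); by_compute.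
- by apply: (index_eq_chain (lib := lib_12) (steps := [:: step_12_1]) _ _ packed_12); by_compute.
- by apply: (index_eq_chain (lib := lib_23) _ _ packed_23
      (steps := [:: step_23_1; step_23_2; step_23_3; step_23_4])); by_compute.
- apply: (index_eq_chain (lib := lib_34) _ _ packed_34
      (steps := [:: step_34_1; step_34_2; step_34_3; step_34_4; step_34_5])).
    by by_compute.
  by rewrite zprime_powers; by_compute.
- apply: (index_eq_chain (lib := lib_44) _ _ packed_44 (steps :=
      [:: step_44_1; step_44_2; step_44_3; step_44_4; step_44_5; step_44_6; step_44_7;
          step_44_8; step_44_9; step_44_10; step_44_11; step_44_12; step_44_13; step_44_14;
          step_44_15; step_44_16; step_44_17; step_44_18; step_44_19; step_44_20;
          step_44_21])).
    by by_compute.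
  by rewrite zprime_powers; by_compute.
- exact: ge packed_65.
- exact: ge packed_96.
Qed.
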